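(* Let $n\ge 7$ and let $G$ be a connected graph on $n$ vertices. Then $$\Gamma_G<\Gamma_{K_4+P_\infty}=\frac{5+3\sqrt3}{2}\quad\Longleftrightarrow\quad G\cong K_4+P_{n-4}.$$ In particular, among $n$-vertex connected graphs, $\Gamma_G$ is minimized by $G=K_4+P_{n-4}$. This latter statement (that $K_4+P_{n-4}$ minimizes $\Gamma_G$ among $n$-vertex connected graphs) holds for every $n\ge 6$.
   Context: All graphs are simple. For a finite connected graph $G$ with adjacency matrix $A_G$, let $\lambda_G$ be the largest eigenvalue of $A_G$ and $x=(x_v)_{v\in V(G)}$ the corresponding eigenvector with positive entries (the Perron vector, unique up to positive scaling). The effective order of $G$ is $\Gamma_G:=\|x\|_1^2/\|x\|_2^2=\big(\sum_v x_v\big)^2/\sum_v x_v^2$. $K_4$ is the complete graph on $4$ vertices, $P_k$ the path on $k$ vertices, and $P_\infty$ the infinite one-ended path. $K_4+P_k$ (resp. $K_4+P_\infty$) is obtained from the disjoint union of $K_4$ and $P_k$ (resp. $P_\infty$) by adding one edge joining a vertex of $K_4$ to an endpoint of the path (so $K_4+P_k$ has $k+4$ vertices). The adjacency operator of $K_4+P_\infty$ on $\ell^2$ has a positive eigenvector $x\in\ell^1$ whose eigenvalue is the top of the spectrum, and $\Gamma_{K_4+P_\infty}:=\|x\|_1^2/\|x\|_2^2$ for this $x$. *)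

(* Defs.v *)
From mathcomp Require Import all_boot all_order all_algebra.
From mathcomp Require Import all_classical all_reals all_analysis.

Set Implicit Arguments.
Unset Strict Implicit.
Unset Printing Implicit Defensive.

Import Order.TTheory GRing.Theory Num.Theory.

Local Open Scope classical_set_scope.
Local Open Scope ring_scope.

Definition connected_graph (n : nat) (T : finType) (e : rel T) : Prop :=
  [/\ #|T| = n, symmetric e, irreflexive e & forall x y : T, connect e x y].

Definition graph_iso (T1 T2 : Type) (e1 : rel T1) (e2 : rel T2) : Prop :=
  exists2 f : T1 -> T2, bijective f & forall x y, e2 (f x) (f y) = e1 x y.

(* K_4 on 'I_4, a path on T whose vertices are numbered by [pos], and one edge
   joining vertex 0 of K_4 to the vertex of position 0 of the path. *)
Definition K4_plus (T : Type) (pos : T -> nat) : rel ('I_4 + T) :=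
  fun u v =>
    match u, v with
    | inl a, inl b => a != b
    | inr i, inr j => ((pos i).+1 == pos j) || ((pos j).+1 == pos i)
    | inl a, inr i | inr i, inl a => (a == ord0) && (pos i == 0%N)
    end.

Definition K4_path (k : nat) : rel ('I_4 + 'I_k) := K4_plus (@nat_of_ord k).
Arguments K4_path : clear implicits.

Definition K4_ray : rel ('I_4 + nat) := K4_plus id.

Definition greatest (R : realType) (S : set R) (m : R) : Prop :=
  S m /\ ubound S m.

Section FiniteGraphs.
Context {R : realType} {T : finType}.
Implicit Type e : rel T.

Definition adjmx e : 'M[R]_#|T| :=
  \matrix_(i, j) (e (enum_val i) (enum_val j))%:R.

Definition perron_vector e (x : 'rV[R]_#|T|) : Prop :=
  (forall i, 0 < x 0 i) /\
  exists2 lambda : R, greatest [set a | eigenvalue (adjmx e) a] lambda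
                    & x *m adjmx e = lambda *: x.

(* For a connected graph, Perron vectors exist and agree up to positive scaling,
   which leaves the quotient unchanged; the default 0 is then never used. *)
Definition effective_order e : R :=
  let x := xget 0 [set x | perron_vector e x] in
  (\sum_i x 0 i) ^+ 2 / \sum_i x 0 i ^+ 2.

End FiniteGraphs.

Section InfiniteGraphs.
Context {R : realType} {V : choiceType}.
Implicit Types (e : rel V) (x : V -> R).

Definition ell1 : set (V -> R) :=
  [set x | summable setT (fun v => (x v)%:E)].

Definition ell2 : set (V -> R) :=
  [set x | summable setT (fun v => (x v ^+ 2)%:E)].

Definition norm1 x : R := fine (\esum_(v in setT) `|x v|%:E).

Definition norm2 x : R := Num.sqrt (fine (\esum_(v in setT) (x v ^+ 2)%:E)).

(* The sum is meaningful for locally finite graphs. *)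
Definition adjop e x : V -> R := fun v => \sum_(w \in [set w | e v w]) x w.

(* The second conjunct says that the inverse on ell2 is bounded. *)
Definition ell2_invertible (F : (V -> R) -> (V -> R)) : Prop :=
  set_bij ell2 ell2 F /\
  exists C : R, forall x, ell2 x -> norm2 x <= C * norm2 (F x).

(* Real ell2 suffices: the adjacency operator is self-adjoint, so its complex
   spectrum is real, and it commutes with complex conjugation. *)
Definition spectrum e : set R :=
  [set l | ~ ell2_invertible (fun x v => adjop e x v - l * x v)].

Definition top_eigenvector e x : Prop :=
  [/\ forall v, 0 < x v, ell1 x
    & exists2 lambda : R, greatest (spectrum e) lambda
                        & forall v, adjop e x v = lambda * x v].

Definition effective_order_inf e : R :=
  let x := xget (fun=> 0) [set x | top_eigenvector e x] in
  norm1 x ^+ 2 / norm2 x ^+ 2.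

End InfiniteGraphs.

(* Main.v *)
Require Import Defs.
From Stdlib Require Import ZArith.
From mathcomp Require Import all_boot all_order all_algebra.
From mathcomp Require Import all_classical all_reals all_analysis.
From mathcomp Require Import ring lra zify ssrZ.

(** The effective order is small only for vectors concentrated on few entries. Let
    [x] be a Perron vector with eigenvalue [lam], scaled so that its largest entry,
    at the vertex [v], is [1]; then [lam] is the sum of [x] over the neighbours of
    [v]. Let [S] and [Q] be the sums of the entries and of their squares. For all
    [m] and [c], [S ^+ 2 - c * Q >= \sum_u (2 * m * x u - c * x u ^+ 2) - m ^+ 2],
    and if [c <= 2 * m] then all summands are nonnegative. So it suffices to know
    some vertices near [v] to bound [S ^+ 2 / Q] from below by [c].

    If [v] has at least six neighbours, they alone suffice ([large_star_bound]).
    Otherwise a finite case analysis discovers the graph step by step around [v]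
    until the known vertices suffice: the eigenvalue equations are linear
    constraints on the entries once [lam] is confined to a short interval, and the
    objective is concave, so that chords give rigorous bounds. The case analysis is
    a tree that is checked by computation ([check_sound]). With seven or more
    vertices it gives [51 / 10], slightly more than [(5 + 3 * sqrt 3) / 2], and with
    six vertices [488 / 100], slightly more than the effective order of [K_4 + P_2]
    ([K4_path2_order]). A single configuration escapes: [v] belongs to a [K_4] that
    meets the rest of the graph along one edge at [v] ([K4_hinge]).

    In that configuration, walk away from the [K_4] ([tail_dichotomy]). As long as
    no vertex branches, consecutive entries satisfy the recurrence of the ray
    [K_4 + P_oo], whose ratio of decay is a repelling fixed point. If the graph is
    not [K_4] with a path, a branching forces [lam] to be at least the eigenvalue of
    the ray; then the ratios stay above the ratio of the ray, and the vertices after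
    the branching contribute more to the sum above than the infinite path would. For
    [m] equal to the sum of the eigenvector of the ray, this compares the graph with
    the ray itself and gives [S ^+ 2 >= c * Q] with [c] the effective order of the
    ray ([hinge_dichotomy]). For [K_4] with a path the ratios stay below the ratio of
    the ray, and summing the defects shows [S ^+ 2 < c * Q] ([path_order_lt]).

    For the ray, a positive eigenfunction bounds the norm of the adjacency operator
    by the Schur test, so that its eigenvalue is the top of the spectrum
    ([spectrum_top]); the eigenfunction is geometric along the path and the sums are
    explicit ([effective_order_ray]). *)

Set Implicit Arguments.
Unset Strict Implicit.
Unset Printing Implicit Defensive.

Import Order.TTheory GRing.Theory Num.Theory.
Import numFieldNormedType.Exports.

Local Open Scope ring_scope.
Local Delimit Scope Z_scope with BZ.

(** * Perron vectors of finite graphs *)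

Section Rayleigh.
Local Open Scope classical_set_scope.
Variables (R : realType) (n : nat) (A : 'M[R]_n).
Implicit Types y z : 'rV[R]_n.

Definition qform y : R := \sum_i (y *m A) 0 i * y 0 i.
Definition sqnorm y : R := \sum_i y 0 i ^+ 2.

Lemma continuous_sumr (I : finType) (f : I -> 'rV[R]_n -> R) :
  (forall i, continuous (f i)) -> continuous (fun y => \sum_i f i y).
Proof.
by move=> cf; apply: continuous_big => [|i _]; [exact: add_continuous | exact: cf].
Qed.

Lemma continuous_mulr (f g : 'rV[R]_n -> R) :
  continuous f -> continuous g -> continuous (fun y => f y * g y).
Proof. by move=> cf cg y; exact: (cvgM (cf y) (cg y)). Qed.

Lemma continuous_coord j : continuous (fun y : 'rV[R]_n => y 0 j).
Proof. by move=> y; exact: (@coord_continuous R 1 n 0 j y). Qed.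

Lemma qform_continuous : continuous qform.
Proof.
have cA i : continuous (fun y => (y *m A) 0 i).
  rewrite (_ : (fun y => _) = fun y => \sum_j y 0 j * A j i); last first.
    by apply/funext => y; rewrite mxE.
  apply: continuous_sumr => j; apply: continuous_mulr; first exact: continuous_coord.
  exact: cst_continuous.
apply: continuous_sumr => i; apply: continuous_mulr; first exact: cA.
exact: continuous_coord.
Qed.

Lemma sqnorm_continuous : continuous sqnorm.
Proof.
apply: continuous_sumr => i.
rewrite (_ : (fun y : 'rV[R]_n => y 0 i ^+ 2) = fun y => y 0 i * y 0 i); last first.
  by apply/funext => y; rewrite expr2.
by apply: continuous_mulr; exact: continuous_coord.
Qed.

Lemma sqnorm_ge0 y : 0 <= sqnorm y.
Proof. by apply: sumr_ge0 => i _; exact: sqr_ge0. Qed.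

Lemma sqnorm_eq0 y : sqnorm y = 0 -> y = 0.
Proof.
move=> /eqP; rewrite psumr_eq0; last by move=> i _; exact: sqr_ge0.
move=> /allP y0; apply/rowP => i; rewrite mxE; apply/eqP.
by have := y0 i; rewrite mem_index_enum sqrf_eq0 => /(_ isT).
Qed.

Lemma sqnormZ a y : sqnorm (a *: y) = a ^+ 2 * sqnorm y.
Proof. by rewrite /sqnorm mulr_sumr; apply: eq_bigr => i _; rewrite mxE exprMn. Qed.

Lemma qformZ a y : qform (a *: y) = a ^+ 2 * qform y.
Proof.
rewrite /qform mulr_sumr; apply: eq_bigr => i _.
by rewrite -scalemxAl !mxE expr2 mulrACA.
Qed.

Lemma compact_sphere : compact [set y | sqnorm y = 1].
Proof.
apply: bounded_closed_compact.
  exists 1; split=> // M M1 y /= ny; apply/(le_trans _ (ltW M1)).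
  rewrite [leLHS]mx_normrE; apply/bigmax_leP; split=> // -[i j] _ /=.
  rewrite ord1 -(@expr_le1 _ 2)// real_normK ?num_real// -ny /sqnorm.
  by rewrite (bigD1 j)//= lerDl sumr_ge0// => k _; rewrite sqr_ge0.
apply: (@preimage_closed _ _ sqnorm [set 1]); last exact: closed_eq.
by move=> y _; exact: sqnorm_continuous.
Qed.

(** The quadratic form is maximal at some point of the compact unit sphere, and
    homogeneity turns this into a bound on the whole space. *)
Lemma rayleigh_max : (0 < n)%N ->
  exists2 z, sqnorm z = 1 & forall y, qform y <= qform z * sqnorm y.
Proof.
move=> n0.
have [||z] := compact_EVT_max (A := [set y | sqnorm y = 1]) (f := qform) _
  compact_sphere.
- exists (delta_mx 0 (Ordinal n0)); rewrite /= /sqnorm (bigD1 (Ordinal n0))//=.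
  rewrite mxE !eqxx expr1n big1 ?addr0// => i /negbTE i0.
  by rewrite mxE i0 andbF expr0n.
- by apply: continuous_subspaceT => y; exact: qform_continuous.
rewrite inE /= => z1 zmax; exists z => // y.
have [y0|y_neq0] := eqVneq (sqnorm y) 0.
  rewrite y0 mulr0 (sqnorm_eq0 y0) /qform big1// => i _.
  by rewrite mul0mx !mxE mul0r.
have y_gt0 : 0 < sqnorm y by rewrite lt_neqAle eq_sym y_neq0 sqnorm_ge0.
have /zmax : (Num.sqrt (sqnorm y))^-1 *: y \in [set y | sqnorm y = 1].
  by rewrite inE /= sqnormZ exprVn sqr_sqrtr ?sqnorm_ge0// mulVf.
by rewrite qformZ exprVn sqr_sqrtr ?sqnorm_ge0// mulrC ler_pdivrMr.
Qed.

(** Evaluating at [t = - b / (1 + `|a|)] makes the quadratic term too small to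
    compensate the linear one unless [b = 0]. *)
Lemma quadratic_nonneg_linear0 (a b : R) :
  (forall t, 0 <= t * b *+ 2 + t ^+ 2 * a) -> b = 0.
Proof.
move=> H; have := H (- b / (1 + `|a|)).
have a0 : 0 < 1 + `|a| by rewrite ltr_pwDl.
have -> : - b / (1 + `|a|) * b *+ 2 + (- b / (1 + `|a|)) ^+ 2 * a =
    (b / (1 + `|a|)) ^+ 2 * (a - (1 + `|a|) *+ 2) by field; rewrite gt_eqF.
move=> +; have al : a <= `|a| by exact: ler_norm.
rewrite nmulr_lge0; last by rewrite mulr2n; lra.
rewrite real_exprn_even_le0 ?num_real//= mulf_eq0 invr_eq0 (gt_eqF a0) orbF.
by move/eqP.
Qed.

Hypothesis A_sym : A^T = A.

Lemma qformD y z : qform (z + y) = qform z + (\sum_i (z *m A) 0 i * y 0 i) *+ 2 + qform y.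
Proof.
have mixed : \sum_i (y *m A) 0 i * z 0 i = \sum_i (z *m A) 0 i * y 0 i.
  under eq_bigr => i _ do rewrite mxE mulr_suml.
  under [RHS]eq_bigr => i _ do rewrite mxE mulr_suml.
  rewrite exchange_big; apply: eq_bigr => i _; apply: eq_bigr => j _ /=.
  by rewrite -[in LHS]A_sym mxE; ring.
rewrite mulr2n -{1}mixed /qform -!big_split; apply: eq_bigr => i _.
by rewrite mulmxDl !mxE /=; ring.
Qed.

Lemma sqnormD y z : sqnorm (z + y) = sqnorm z + (\sum_i z 0 i * y 0 i) *+ 2 + sqnorm y.
Proof.
rewrite mulr2n /sqnorm -!big_split; apply: eq_bigr => i _.
by rewrite !mxE /=; ring.
Qed.

(** At a maximum of the Rayleigh quotient the form [l sqnorm - qform] is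
    nonnegative and vanishes; moving away from the maximum in any direction
    changes it by a linear and a quadratic term, so the linear term is zero. *)
Lemma rayleigh_eigen z : sqnorm z = 1 ->
  (forall y, qform y <= qform z * sqnorm y) -> z *m A = qform z *: z.
Proof.
move=> z1 zmax; set l := qform z.
pose y := l *: z - z *m A.
suff /sqnorm_eq0/eqP : sqnorm y = 0 by rewrite subr_eq0 => /eqP.
apply: (@quadratic_nonneg_linear0 (l * sqnorm y - qform y)) => t.
have := zmax (z + t *: y).
rewrite qformD sqnormD z1 -/l -subr_ge0; congr (0 <= _).
rewrite sqnormZ qformZ.
have -> : \sum_i z 0 i * (t *: y) 0 i = t * \sum_i z 0 i * y 0 i.
  by rewrite mulr_sumr; apply: eq_bigr => i _; rewrite !mxE; ring.
have -> : \sum_i (z *m A) 0 i * (t *: y) 0 i = t * \sum_i (z *m A) 0 i * y 0 i.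
  by rewrite mulr_sumr; apply: eq_bigr => i _; rewrite !mxE; ring.
have -> : sqnorm y = l * \sum_i z 0 i * y 0 i - \sum_i (z *m A) 0 i * y 0 i.
  rewrite /sqnorm mulr_sumr -sumrB; apply: eq_bigr => i _.
  by rewrite {1}/y expr2 {1}mxE mxE [X in _ + X]mxE; ring.
ring.
Qed.

(** Replacing the entries of a maximizer by their absolute values does not
    decrease the form when the matrix has nonnegative entries. *)
Lemma nonneg_eigenvector : (0 < n)%N -> (forall i j, 0 <= A i j) ->
  exists z, exists l, [/\ sqnorm z = 1, forall i, 0 <= z 0 i & z *m A = l *: z].
Proof.
move=> n0 A0; have [z z1 zmax] := rayleigh_max n0.
pose z' : 'rV[R]_n := \row_i `|z 0 i|.
have z'1 : sqnorm z' = 1.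
  by rewrite -z1; apply: eq_bigr => i _; rewrite mxE real_normK ?num_real.
exists z', (qform z'); split=> //; first by move=> i; rewrite mxE.
apply: rayleigh_eigen => // y; apply: le_trans (zmax y) _.
apply: ler_wpM2r; first exact: sqnorm_ge0.
apply: ler_sum => i _; rewrite !mxE !mulr_suml; apply: ler_sum => j _.
apply: le_trans (ler_norm _) _.
by rewrite !mxE !normrM (ger0_norm (A0 _ _)).
Qed.

End Rayleigh.

(** Eigenvectors of the adjacency matrix, indexed by vertices instead of by their
    ranks in an enumeration. *)
Definition eigenfun (R : realType) (T : finType) (e : rel T) (x : T -> R) (lam : R) :=
  forall v, \sum_(w | e v w) x w = lam * x v.

Lemma sum_nbr_seq (R : realType) (T : finType) (e : rel T) (x : T -> R) lam z (l : seq T) :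
  eigenfun e x lam -> uniq l -> e z =i l -> \sum_(w <- l) x w = lam * x z.
Proof.
by move=> xe l_uniq zl; rewrite -xe big_uniq//; apply: eq_bigl => w; rewrite -zl.
Qed.

Section Perron.
Local Open Scope classical_set_scope.
Variables (R : realType) (T : finType) (e : rel T).
Hypothesis e_sym : symmetric e.
Hypothesis e_conn : forall u v, connect e u v.
Implicit Types (x y : T -> R) (lam mu : R).

Local Notation A := (@adjmx R T e).
Definition row_fun x : 'rV[R]_#|T| := \row_i x (enum_val i).

Lemma row_funE (x : T -> R) v : row_fun x 0 (enum_rank v) = x v.
Proof. by rewrite mxE enum_rankK. Qed.

Lemma sum_row_fun (F : R -> R) x :
  \sum_i F (row_fun x 0 i) = \sum_v F (x v).
Proof.
rewrite (reindex_onto (@enum_rank T) enum_val) /=; last by move=> i _; rewrite enum_valK.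
by apply: eq_big => [v|v _]; rewrite ?row_funE// enum_rankK eqxx.
Qed.

Lemma row_fun_mul x v : (row_fun x *m A) 0 (enum_rank v) = \sum_(w | e v w) x w.
Proof.
rewrite mxE (reindex_onto (@enum_rank T) enum_val) /=; last by move=> i _; rewrite enum_valK.
rewrite [RHS]big_mkcond /=; apply: eq_big => [w|w _]; first by rewrite enum_rankK eqxx.
rewrite row_funE mxE !enum_rankK e_sym; case: (e v w); first by rewrite mulr1.
by rewrite mulr0.
Qed.

Lemma eigenfunE x lam : eigenfun e x lam <-> row_fun x *m A = lam *: row_fun x.
Proof.
split=> [ex|ex v].
  by apply/rowP => i; rewrite -(enum_valK i) row_fun_mul ex !mxE enum_rankK.
by rewrite -row_fun_mul ex !mxE enum_rankK.
Qed.

Lemma row_funP (y : 'rV[R]_#|T|) : y = row_fun (fun v => y 0 (enum_rank v)).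
Proof. by apply/rowP => i; rewrite mxE enum_valK. Qed.

(** A zero propagates to the neighbours, hence everywhere by connectedness. *)
Lemma eigenfun_zero x lam : (forall v, 0 <= x v) -> eigenfun e x lam ->
  forall v, x v = 0 -> forall w, x w = 0.
Proof.
move=> x0 ex v xv w; have /connectP[p + ->] := e_conn v w.
elim: p v xv => [|u p IHp] v xv //= /andP[vu pu]; apply: IHp pu => //.
have /eqP := ex v; rewrite xv mulr0 psumr_eq0// => /allP /(_ u).
by rewrite mem_index_enum vu => /(_ isT) /eqP.
Qed.

Lemma perron_exists : (0 < #|T|)%N ->
  exists x, exists lam, (forall v, 0 < x v) /\ eigenfun e x lam.
Proof.
move=> T0.
have [||z [lam [z1 z0 ez]]] := @nonneg_eigenvector R _ A _ T0.
- by apply/matrixP => i j; rewrite !mxE e_sym.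
- by move=> i j; rewrite mxE ler0n.
move: z1 z0 ez; rewrite (row_funP z); set x := fun v => _ => z1 z0 /eigenfunE ex.
have x0 v : 0 <= x v by rewrite -row_funE.
exists x, lam; split=> // v; rewrite lt_neqAle x0 andbT eq_sym.
apply/eqP => xv; have := eigenfun_zero x0 ex xv => x_eq0.
move/eqP: z1; rewrite /sqnorm (sum_row_fun (fun t => t ^+ 2)) big1 ?(eq_sym 0) ?oner_eq0//.
by move=> w _; rewrite x_eq0 expr0n.
Qed.

(** Pairing the eigenvector equation of any other eigenvalue with a positive
    eigenfunction bounds that eigenvalue: no positive vector can belong to an
    eigenvalue below the largest one. *)
Lemma positive_eigenvalue_max x lam : (forall v, 0 < x v) -> eigenfun e x lam ->
  forall a, eigenvalue A a -> a <= lam.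
Proof.
move=> x0 ex a /eigenvalueP[y]; rewrite (row_funP y); set y' := fun v => _.
move=> /eigenfunE ey y_neq0.
have [v yv] : exists v, y' v != 0.
  apply/existsP; apply: contraNT y_neq0; rewrite negb_exists => /forallP y0.
  by apply/eqP/rowP => i; rewrite !mxE; have := y0 (enum_val i); rewrite negbK => /eqP.
have pair_gt0 : 0 < \sum_u `|y' u| * x u.
  rewrite (bigD1 v)//= ltr_pwDl//; first by rewrite mulr_gt0// normr_gt0.
  by apply: sumr_ge0 => u _; rewrite mulr_ge0// ltW.
rewrite -(ler_pM2r pair_gt0).
have -> : lam * \sum_u `|y' u| * x u = \sum_u \sum_(w | e u w) `|y' u| * x w.
  by rewrite mulr_sumr; apply: eq_bigr => u _; rewrite -mulr_sumr ex; ring.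
rewrite mulr_sumr (exchange_big_dep predT)//=; apply: ler_sum => w _.
rewrite mulrA -mulr_suml ler_wpM2r//; first exact: ltW.
apply: (@le_trans _ _ `|a * y' w|).
  by rewrite normrM ler_wpM2r// ler_norm.
rewrite -ey; apply: le_trans (ler_norm_sum _ _ _) _.
by under eq_bigl do rewrite e_sym.
Qed.

(** Two positive eigenvectors for the same eigenvalue are proportional: subtract
    from one the largest multiple of the other that keeps the difference
    nonnegative; it vanishes somewhere, hence everywhere. *)
Lemma perron_vectorP x lam : (0 < #|T|)%N -> (forall v, 0 < x v) -> eigenfun e x lam ->
  perron_vector e (row_fun x) /\
  forall y : 'rV[R]_#|T|, perron_vector e y -> exists2 m, 0 < m & y = row_fun (fun v => m * x v).
Proof.
move=> T0 x0 ex; have [v0 _] : exists v0 : T, v0 \in T by apply/card_gt0P.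
have lam_max : greatest [set a | eigenvalue A a] lam.
  split; last by move=> a /=; exact: positive_eigenvalue_max.
  apply/eigenvalueP; exists (row_fun x); first exact/eigenfunE.
  apply/eqP => /rowP /(_ (enum_rank v0)); rewrite !mxE enum_rankK => xv0.
  by have := x0 v0; rewrite xv0 ltxx.
split.
  split; first by move=> i; rewrite mxE.
  by exists lam => //; exact/eigenfunE.
move=> y [y0 [mu [mu_eig mu_max]]]; rewrite (row_funP y) in y0 *.
set y' := fun v => _ in y0 * => /eigenfunE ey.
have mulam : mu = lam.
  by apply: le_anti; rewrite (proj2 lam_max mu mu_eig) (mu_max lam (proj1 lam_max)).
rewrite mulam in ey.
have y'0 v : 0 < y' v by rewrite -row_funE.
have [v /= _ vmin] := @Order.TotalTheory.arg_minP _ _ _ v0 xpredT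
  (fun v => y' v / x v) isT.
exists (y' v / x v); first by rewrite divr_gt0.
congr row_fun; apply/funext => w.
pose d u := y' u - y' v / x v * x u.
suff : d w = 0 by move/eqP; rewrite subr_eq0 => /eqP.
apply: (@eigenfun_zero d lam) (_ : d v = 0) _.
- by move=> u; rewrite subr_ge0 -ler_pdivlMr// vmin.
- by move=> u; rewrite sumrB -mulr_sumr ex ey /d; ring.
- by rewrite /d divfK ?subrr// gt_eqF.
Qed.

(** Since all Perron vectors are proportional, any positive eigenfunction computes
    the effective order. *)
Lemma effective_orderE x lam : (0 < #|T|)%N -> (forall v, 0 < x v) -> eigenfun e x lam ->
  effective_order e = (\sum_v x v) ^+ 2 / \sum_v x v ^+ 2.
Proof.
move=> T0 x0 ex; rewrite /effective_order.
have [xP uniq] := perron_vectorP T0 x0 ex.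
case: xgetP => [y _ /uniq[m m0 ->]|/(_ _ xP)//].
rewrite (sum_row_fun id) (sum_row_fun (fun t => t ^+ 2)).
rewrite -mulr_sumr exprMn; under [X in _ / X]eq_bigr do rewrite exprMn.
by rewrite -mulr_sumr -mulf_div divff ?mul1r// expf_neq0// gt_eqF.
Qed.

End Perron.

(** * Interval propagation with integers *)

(** Reals are approximated by integers in fixed-point arithmetic: the integer [a]
    stands for [a / 10000]. *)
Definition unitZ : Z := 10000%BZ.

Section Propagation.
Local Open Scope Z_scope.

Definition interval := (Z * Z)%type.

(** The largest value on the box [B] of the linear form with coefficients [r]. *)
Fixpoint row_sup (r : seq Z) (B : seq interval) : Z :=
  match r, B with
  | c :: r', b :: B' => Z.max (c * b.1) (c * b.2) + row_sup r' B'
  | _, _ => 0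
  end.

(** If a linear form of supremum [M] over the box is nonnegative, its term with
    coefficient [c] is at least [s]; this is solved for the variable, rounding
    outwards. *)
Definition tighten1 (M c : Z) (b : interval) : interval :=
  let s := Z.max (c * b.1) (c * b.2) - M in
  if 0 <? c then (Z.max b.1 (s / c), b.2)
  else if c <? 0 then (b.1, Z.min b.2 (- (s / - c))) else b.

Definition tighten (B : seq interval) (r : seq Z) : seq interval :=
  let M := row_sup r B in [seq tighten1 M p.1 p.2 | p <- zip r B].

Definition empty_box (B : seq interval) : bool := has (fun b => b.2 <? b.1) B.

(** A lower bound over [b] of [200 M z - cn z ^+ 2 - th z], through the chord of
    [z ^+ 2]. *)
Definition gain (cn M th : Z) (b : interval) : Z :=
  let a := 200 * M - cn * (b.1 + b.2) - th in
  Z.min (a * b.1) (a * b.2) + cn * (b.1 * b.2).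

Arguments gain : simpl never.

Definition gains (cn M th : Z) (B : seq interval) : Z :=
  foldr (fun b s => gain cn M th b + s) 0 B.

(** The slope of the chord minorant; these are the only values of the Lagrange
    multiplier at which the knapsack bound can be optimal. *)
Definition slope (cn M : Z) (b : interval) : Z := 200 * M - cn * (b.1 + b.2).

(** A sufficient test for [S ^+ 2 >= c * Q], with [cn = 100 c]. The integer [m]
    is in hundredths, so that [M = 100 m] is in units of [unitZ]. The first entry
    of the box is the maximal vertex and the next [d] are its neighbours, whose sum
    is known to lie between [L1] and [L2]. *)
Definition bounded_below (d : nat) (cn m L1 L2 : Z) (B : seq interval) : bool :=
  if B is b :: B' then
    let M := 100 * m in
    let N := take d B' in
    let base := gain cn M 0 b + gains cn M 0 (drop d B') - 100 * (M * M) in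
    (cn <=? 2 * m) &&
    has (fun th => 0 <=? base + gains cn M th N + Z.min (th * L1) (th * L2))
        (0 :: map (slope cn M) N)
  else false.

End Propagation.

Section CastZ.
Variable R : realType.
(** [Z] has a binary representation, which makes the search feasible; [int] does
    not. *)
Definition zr (z : Z) : R := (int_of_Z z)%:~R.

Lemma zrD a b : zr (a + b)%BZ = zr a + zr b.
Proof. by rewrite /zr -intrD; congr (_%:~R); lia. Qed.
Lemma zrM a b : zr (a * b)%BZ = zr a * zr b.
Proof. by rewrite /zr -intrM; congr (_%:~R); lia. Qed.
Lemma zrN a : zr (- a)%BZ = - zr a.
Proof. by rewrite /zr -mulrNz; congr (_%:~R); lia. Qed.
Lemma zrB a b : zr (a - b)%BZ = zr a - zr b.
Proof. by rewrite -zrN -zrD. Qed.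
Lemma zr0 : zr 0%BZ = 0. Proof. by []. Qed.
Lemma zr1 : zr 1%BZ = 1. Proof. by []. Qed.
Lemma zr_nat k : zr (Z.of_nat k) = k%:R.
Proof. by rewrite /zr; have -> : int_of_Z (Z.of_nat k) = k%:Z by lia. Qed.
Lemma ler_zr a b : (zr a <= zr b) = (a <=? b)%BZ.
Proof. by rewrite /zr ler_int; lia. Qed.
Lemma ltr_zr a b : (zr a < zr b) = (a <? b)%BZ.
Proof. by rewrite /zr ltr_int; lia. Qed.
Lemma zr_max a b : zr (Z.max a b) = Num.max (zr a) (zr b).
Proof.
have [h|h] := Z.max_spec a b; case: h => [h ->].
  by rewrite max_r// ler_zr; lia.
by rewrite max_l// ler_zr; lia.
Qed.
Lemma zr_min a b : zr (Z.min a b) = Num.min (zr a) (zr b).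
Proof.
have [h|h] := Z.min_spec a b; case: h => [h ->].
  by rewrite min_l// ler_zr; lia.
by rewrite min_r// ler_zr; lia.
Qed.
Lemma zr_floor a b : (0 < b)%BZ -> zr b * zr (a / b)%BZ <= zr a.
Proof. by move=> b0; rewrite -zrM ler_zr; have := Z.mul_div_le a b b0; lia. Qed.
End CastZ.

Section PropagationSound.
Variable R : realType.
Local Notation zr := (@zr R).
Implicit Types (r : seq Z) (B : seq interval) (X : seq R).

Definition in_box B X := all2 (fun (b : interval) x => zr b.1 <= x <= zr b.2) B X.

Fixpoint dot r X : R :=
  match r, X with c :: r', x :: X' => zr c * x + dot r' X' | _, _ => 0 end.

Lemma mul_le_ends (c l u x : R) : l <= x <= u -> c * x <= Num.max (c * l) (c * u).
Proof.
move=> /andP[lx xu]; rewrite le_max; have [c0|c0] := lerP 0 c.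
  by rewrite (ler_wpM2l c0 xu) orbT.
by rewrite ler_nM2l// lx.
Qed.

Lemma dot_le_row_sup r B X : in_box B X -> dot r X <= zr (row_sup r B).
Proof.
elim: r B X => [|c r IHr] [|b B] [|x X]//= /andP[bx BX].
by rewrite zrD zr_max !zrM lerD ?mul_le_ends ?IHr.
Qed.

Lemma tighten1_sound M c (b : interval) x :
  zr (Z.max (c * b.1) (c * b.2) - M)%BZ <= zr c * x ->
  zr b.1 <= x <= zr b.2 ->
  zr (tighten1 M c b).1 <= x <= zr (tighten1 M c b).2.
Proof.
rewrite /tighten1; set s := (_ - M)%BZ => sx /andP[lx xu].
case: Z.ltb_spec => c0 /=.
  rewrite xu andbT zr_max ge_max lx /=.
  have c0' : 0 < zr c by rewrite -(zr0 R) ltr_zr; lia.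
  by rewrite -(ler_pM2l c0'); apply: le_trans sx; exact: zr_floor.
case: Z.ltb_spec => c1 /=; last by rewrite lx xu.
rewrite lx /= zr_min le_min xu /= zrN lerNr.
have c0' : 0 < zr (- c)%BZ by rewrite -(zr0 R) ltr_zr; lia.
rewrite -(ler_pM2l c0'); apply: le_trans (zr_floor _ _ _) _; first by lia.
by rewrite zrN mulrNN.
Qed.

Lemma tighten_sound r B X : size r = size B ->
  in_box B X -> 0 <= dot r X -> in_box (tighten B r) X.
Proof.
rewrite /tighten => srB BX d0; set M := row_sup r B.
have : - zr M <= dot r X - zr (row_sup r B) by rewrite -/M lerBrDr addNr.
elim: r B X srB BX M {d0} => [|c r IHr] [|b B] [|x X]//= [srB] /andP[bx BX] M.
have := dot_le_row_sup r BX; have := mul_le_ends (zr c) bx.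
rewrite zrD zr_max !zrM => h1 h2 h3; rewrite tighten1_sound//=.
  by apply: IHr => //; lra.
by rewrite zrB zr_max !zrM; lra.
Qed.

Lemma size_tighten B r : size r = size B -> size (tighten B r) = size B.
Proof. by move=> srB; rewrite size_map size_zip srB minnn. Qed.

Lemma foldl_tighten_sound rs B X :
  all (fun r => size r == size B) rs -> all (fun r => 0 <= dot r X) rs ->
  in_box B X ->
  in_box (foldl tighten B rs) X /\ size (foldl tighten B rs) = size B.
Proof.
elim: rs B => [|r rs IHrs] B //= /andP[/eqP sr srs] /andP[dr drs] BX.
rewrite -(size_tighten sr); apply: IHrs => //; last exact: tighten_sound.
by apply: sub_all srs => r' /eqP ->; rewrite size_tighten.
Qed.

Lemma in_box_nonempty B X : in_box B X -> ~~ empty_box B.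
Proof.
elim: B X => [|b B IHB] [|x X]//= /andP[/andP[lx xu] BX].
rewrite negb_or (IHB _ BX) andbT -(@ltr_zr R) -leNgt.
exact: le_trans xu.
Qed.

(** On an interval the concave parabola lies above its chord; the chord is
    linear and takes its minimum at an endpoint. *)
Lemma gain_sound cn M th (b : interval) x : (0 <= cn)%BZ -> zr b.1 <= x <= zr b.2 ->
  zr (gain cn M th b) <= 200 * zr M * x - zr cn * x ^+ 2 - zr th * x.
Proof.
move=> cn0 /andP[lx xu]; have cn0' : 0 <= zr cn by rewrite -(zr0 R) ler_zr; lia.
rewrite /gain zrD zr_min !zrM; set a := zr (_ - th)%BZ.
have aE : a = 200 * zr M - zr cn * (zr b.1 + zr b.2) - zr th.
  by rewrite /a !zrB !zrM zrD; congr (_ * _ - _ - _).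
have h : Num.min (a * zr b.1) (a * zr b.2) <= a * x.
  rewrite ge_min; have [a0|a0] := lerP 0 a; first by rewrite ler_wpM2l.
  by rewrite (ler_nM2l a0) (ler_nM2l a0) xu orbT.
have h2 : 0 <= zr cn * ((x - zr b.1) * (zr b.2 - x)).
  by rewrite mulr_ge0// mulr_ge0// subr_ge0.
move: h; rewrite aE; nra.
Qed.

Lemma gains_sound cn M th B X : (0 <= cn)%BZ -> in_box B X ->
  zr (gains cn M th B) <=
    \sum_(x <- X) (200 * zr M * x - zr cn * x ^+ 2 - zr th * x).
Proof.
move=> cn0; elim: B X => [|b B IHB] [|x X]//=; first by rewrite big_nil.
move=> /andP[bx BX]; rewrite big_cons zrD lerD//; last exact: IHB.
exact: gain_sound.
Qed.

Lemma in_box_cat B1 B2 X1 X2 : size B1 = size X1 ->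
  in_box (B1 ++ B2) (X1 ++ X2) = in_box B1 X1 && in_box B2 X2.
Proof.
elim: B1 X1 => [|b B1 IHB] [|x X1]//= [s12].
by have := IHB _ s12; rewrite /in_box => ->; rewrite andbA.
Qed.

(** The middle block of coordinates has a sum known up to [L1, L2]; subtracting
    the multiple [th] of it from the objective is Lagrangian duality for the
    resulting knapsack problem. *)
Lemma bounded_below_sound d cn m L1 L2 B x XN XR : (0 <= cn)%BZ ->
  in_box B (x :: XN ++ XR) -> size XN = d ->
  zr L1 <= \sum_(y <- XN) y <= zr L2 ->
  bounded_below d cn m L1 L2 B ->
  [/\ zr cn <= 2 * zr m &
   0 <= \sum_(y <- x :: XN ++ XR) (200 * (100 * zr m) * y - zr cn * y ^+ 2)
        - 100 * (100 * zr m) ^+ 2].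
Proof.
case: B => [//|b B] cn0 bBX sN LN /andP[cnm /hasP[th _ H]].
have /andP[bx BX] : (zr b.1 <= x <= zr b.2) && in_box B (XN ++ XR) by [].
split; first by move: cnm; rewrite -(@ler_zr R) zrM.
have szB : size B = size (XN ++ XR).
  by move: BX; rewrite /in_box all2E => /andP[/eqP].
have sT : size (take d B) = size XN.
  by rewrite size_takel ?sN// szB size_cat sN leq_addr.
have : in_box (take d B ++ drop d B) (XN ++ XR) by rewrite cat_take_drop.
rewrite in_box_cat// => /andP[BN BR].
have {}H : (0 <=? gain cn (100 * m) 0 b + gains cn (100 * m) 0 (drop d B)
    - 100 * (100 * m * (100 * m)) + gains cn (100 * m) th (take d B)
    + Z.min (th * L1) (th * L2))%BZ by exact: H.
move: H (gain_sound (100 * m)%BZ 0%BZ cn0 bx) (gains_sound (100 * m)%BZ 0%BZ cn0 BR)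
  (gains_sound (100 * m)%BZ th cn0 BN).
move: (gain _ _ _ _) (gains _ _ 0%BZ _) (gains _ _ th _) => g1 g2 g3.
rewrite -(@ler_zr R) !(zrD, zrN, zr_min, zrM) zr0 (_ : zr 100%BZ = 100)//.
rewrite big_cons big_cat/= !sumrB -!mulr_sumr !mul0r.
have : Num.min (zr th * zr L1) (zr th * zr L2) <= zr th * \sum_(y <- XN) y.
  case/andP: LN => l1 l2; rewrite ge_min; have [a0|a0] := lerP 0 (zr th).
    by rewrite ler_wpM2l.
  by rewrite (ler_nM2l a0) (ler_nM2l a0) l2 orbT.
rewrite !expr2; lra.
Qed.

Lemma dot_map_iota (f : nat -> Z) X m :
  dot [seq f j | j <- iota m (size X)] X =
  \sum_(j < size X) zr (f (m + j)%N) * X`_j.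
Proof.
elim: X m => [|x X IHX] m /=; first by rewrite big_ord0.
rewrite big_ord_recl /= addn0 IHX; congr (_ + _).
by apply: eq_bigr => j _; rewrite addSnnS.
Qed.

End PropagationSound.

(** * Case analysis around the maximal vertex *)

Section Search.
Local Open Scope Z_scope.

(** What is known about a graph at a node of the search: [known] vertices, named
    by numbers, with [0] for the maximal vertex; some adjacencies and
    non-adjacencies between them; and a list of vertices all of whose neighbours
    are among the known ones. *)
Record state := State {
  known : nat;
  edges : seq (nat * nat);
  nonedges : seq (nat * nat);
  closed : seq nat }.

Definition linked (s : state) i j := ((i, j) \in edges s) || ((j, i) \in edges s).
Definition apart (s : state) i j := ((i, j) \in nonedges s) || ((j, i) \in nonedges s).

(** The eigenvalue equation at vertex [i], for an eigenvalue between [L1] and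
    [L2], gives a lower bound of the entry by the entries of the known neighbours,
    and for a closed vertex an upper bound by the entries of all vertices not known
    to be non-adjacent. *)
Definition lower_row s (L2 : Z) i : seq Z :=
  [seq if j == i then L2 else if linked s i j then - unitZ else 0 | j <- iota 0 (known s)].
Definition upper_row s (L1 : Z) i : seq Z :=
  [seq if j == i then - L1 else if apart s i j then 0 else unitZ | j <- iota 0 (known s)].
Definition sort_row s i : seq Z :=
  [seq if j == i then 1 else if j == i.+1 then -1 else 0 | j <- iota 0 (known s)].

Definition rows d s L1 L2 : seq (seq Z) :=
  [seq lower_row s L2 i | i <- iota 0 (known s)] ++
  [seq upper_row s L1 i | i <- closed s] ++
  [seq sort_row s i | i <- iota 1 d.-1].

Definition start_box s : seq interval := (unitZ, unitZ) :: nseq (known s).-1 (0, unitZ).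

(** Every pass makes each constraint tighten the box once; a few passes come close
    to the fixpoint. *)
Definition final_box d s L1 L2 : seq interval :=
  let rs := rows d s L1 L2 in iter 5 (fun B => foldl tighten B rs) (start_box s).

Definition add_edge s i j := State (known s) ((i, j) :: edges s) (nonedges s) (closed s).
Definition add_nonedge s i j := State (known s) (edges s) ((i, j) :: nonedges s) (closed s).
Definition close s i := State (known s) (edges s) (nonedges s) (i :: closed s).
Definition add_vertex s i :=
  State (known s).+1 ((i, known s) :: edges s)
        ([seq (j, known s) | j <- closed s] ++ nonedges s) (closed s).

(** Search trees. [Bound], [Full] and [Hinge] close a node: by the numerical
    bound with parameter [m], because the number of vertices is wrong, or because a
    hinged [K_4] has been found. [Cut] splits the range of the eigenvalue, [Ask]
    asks whether two known vertices are adjacent, and [Grow] whether a vertex has a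
    neighbour that is not yet known. *)
Inductive plan :=
| Bound of Z
| Full
| Hinge
| Cut of Z & plan & plan
| Ask of nat & nat & plan & plan
| Grow of nat & plan & plan.

(** The bound [32000], that is [16 / 5], leaves room above [ray_eig] for the
    analysis of hinged graphs. *)
Definition hinge_ok d s (L2 : Z) : bool :=
  [&& d == 4%N, (4 < known s)%N, L2 <=? 32000 &
      all (fun i => (i \in closed s) &&
        all (fun j => (j == i) || if (j < 4)%N then linked s i j else apart s i j)
            (iota 0 (known s))) [:: 1; 2; 3]%N].

(** The graphs to exclude have at least [n] vertices, or exactly [n] when
    [exact_n] holds. *)
Fixpoint check (n : nat) (exact_n : bool) (cn : Z) (d : nat) (p : plan)
    (s : state) (L1 L2 : Z) : bool :=
  match p with
  | Bound m => let B := final_box d s L1 L2 in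
               empty_box B || bounded_below d cn m L1 L2 B
  | Full => ((known s < n)%N && all (fun i => i \in closed s) (iota 0 (known s)))
            || (exact_n && (n < known s)%N)
  | Hinge => hinge_ok d s L2
  | Cut q p1 p2 => check n exact_n cn d p1 s L1 q && check n exact_n cn d p2 s q L2
  | Ask i j p1 p2 => [&& (i < known s)%N, (j < known s)%N,
                         check n exact_n cn d p1 (add_edge s i j) L1 L2
                       & check n exact_n cn d p2 (add_nonedge s i j) L1 L2]
  | Grow i p1 p2 => [&& (i < known s)%N, check n exact_n cn d p1 (close s i) L1 L2
                      & check n exact_n cn d p2 (add_vertex s i) L1 L2]
  end.

Definition start_state d := State d.+1 [seq (0%N, j) | j <- iota 1 d] [::] [:: 0%N].

End Search.

(** A [K_4] on [v, a, b, c] that meets the rest of the graph only along the edge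
    from [v] to [y]. *)
Definition K4_hinge (T : eqType) (e : rel T) (v a b c y : T) : Prop :=
  [/\ uniq [:: v; a; b; c; y],
      e v =i [:: a; b; c; y], e a =i [:: v; b; c],
      e b =i [:: v; a; c] & e c =i [:: v; a; b]].

Section SearchSound.
Variables (R : realType) (T : finType) (e : rel T).
Hypotheses (e_sym : symmetric e) (e_irr : irreflexive e).
Hypothesis e_conn : forall u w, connect e u w.
Variables (x : T -> R) (lam : R).
Hypotheses (x_gt0 : forall u, 0 < x u) (x_le1 : forall u, x u <= 1).
Hypothesis x_eig : eigenfun e x lam.
Variables (v : T) (N : seq T).
Hypotheses (xv : x v = 1) (N_uniq : uniq N) (N_nbr : e v =i N).
Hypothesis N_sorted : sorted (fun a b => x b <= x a) N.
Variables (n : nat) (exact_n : bool).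
Hypotheses (n_le : (n <= #|T|)%N) (n_exact : exact_n -> #|T| = n).

Local Notation zr := (@zr R).
Local Notation K := (zr unitZ).
Local Notation d := (size N).

(** The list [us] names vertices of the graph for which everything recorded in [s]
    is true. *)
Record realizes (s : state) (us : seq T) : Prop := Realizes {
  real_size : size us = known s;
  real_uniq : uniq us;
  real_star : exists rest, us = v :: N ++ rest;
  real_edge : forall i j, (i, j) \in edges s ->
    [/\ (i < known s)%N, (j < known s)%N & e (nth v us i) (nth v us j)];
  real_nonedge : forall i j, (i, j) \in nonedges s ->
    [/\ (i < known s)%N, (j < known s)%N & ~~ e (nth v us i) (nth v us j)];
  real_closed : forall i, i \in closed s ->
    (i < known s)%N /\ forall w, e (nth v us i) w -> w \in us }.

Definition scaled (us : seq T) : seq R := [seq K * x u | u <- us].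

Lemma unit_gt0 : 0 < K. Proof. by rewrite -(zr0 R) ltr_zr. Qed.

Lemma linkedP s us i j : realizes s us -> linked s i j -> e (nth v us i) (nth v us j).
Proof.
by move=> rs /orP[/(real_edge rs)[]//|/(real_edge rs)[_ _]]; rewrite e_sym.
Qed.

Lemma apartP s us i j : realizes s us -> apart s i j -> ~~ e (nth v us i) (nth v us j).
Proof.
by move=> rs /orP[/(real_nonedge rs)[]//|/(real_nonedge rs)[_ _]]; rewrite e_sym.
Qed.

Lemma sum_seq_nbr us a : uniq us ->
  \sum_(w <- us | e a w) x w = \sum_(w | (e a w) && (w \in us)) x w.
Proof.
move=> us_uniq; rewrite -big_filter big_uniq ?filter_uniq//.
by apply: eq_bigl => w; rewrite mem_filter.
Qed.

Lemma sum_seq_nbr_le us a : uniq us -> \sum_(w <- us | e a w) x w <= lam * x a.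
Proof.
move=> us_uniq; rewrite sum_seq_nbr// -x_eig [leRHS](bigID (mem us))/=.
by rewrite lerDl sumr_ge0// => w _; exact: ltW.
Qed.

Lemma sum_seq_nbr_eq us a : uniq us -> (forall w, e a w -> w \in us) ->
  \sum_(w <- us | e a w) x w = lam * x a.
Proof.
move=> us_uniq aus; rewrite sum_seq_nbr// -x_eig; apply: eq_bigl => w.
by case: (boolP (e a w)) => // /aus ->.
Qed.

Lemma sum_seq_index us (P : pred T) :
  \sum_(w <- us | P w) x w = \sum_(j < size us | P (nth v us j)) x (nth v us j).
Proof. by rewrite (big_nth v) big_mkord. Qed.

Lemma dot_scaled us (f : nat -> Z) k : size us = k ->
  dot [seq f j | j <- iota 0 k] (scaled us) =
  \sum_(j < size us) zr (f j) * (K * x (nth v us j)).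
Proof.
move=> <-; have := dot_map_iota f (scaled us) 0.
rewrite size_map => ->; apply: eq_bigr => j _.
by rewrite (nth_map v).
Qed.

Lemma lower_row_ge0 s us L2 i : realizes s us -> K * lam <= zr L2 -> (i < known s)%N ->
  0 <= dot (lower_row s L2 i) (scaled us).
Proof.
move=> rs lamL2 i_lt; rewrite (dot_scaled _ (real_size rs)).
have i_lt' : (i < size us)%N by rewrite (real_size rs).
rewrite (bigD1 (Ordinal i_lt'))//= eqxx.
set y := x _.
have : \sum_(j < size us | (val j != i) && linked s i j) x (nth v us j) <= lam * y.
  apply: le_trans (sum_seq_nbr_le (nth v us i) (real_uniq rs)).
  rewrite sum_seq_index [leRHS]big_mkcond [leLHS]big_mkcond; apply: ler_sum => j _ /=.
  case: ifP => [/andP[_ /(linkedP rs) -> //]|_].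
  by case: ifP => // _; exact: ltW.
rewrite [X in _ -> 0 <= _ + X](_ : _ =
  - (K * (K * \sum_(j < size us | (val j != i) && linked s i j) x (nth v us j)))).
  move=> sum_le; rewrite subr_ge0 [leRHS]mulrCA ler_pM2l ?unit_gt0//.
  apply: le_trans (_ : K * (lam * y) <= _); first by rewrite ler_pM2l ?unit_gt0.
  by rewrite mulrA ler_pM2r ?x_gt0.
rewrite !mulr_sumr -sumrN big_mkcondr; apply: eq_big => [j|j j_neq] /=.
  by rewrite -val_eqE.
rewrite -val_eqE /= in j_neq; rewrite (negbTE j_neq).
by case: ifP => _; [rewrite -[zr _]/(zr (- unitZ)%BZ) zrN mulNr | rewrite zr0 mul0r].
Qed.

Lemma upper_row_ge0 s us L1 i : realizes s us -> zr L1 <= K * lam -> i \in closed s ->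
  0 <= dot (upper_row s L1 i) (scaled us).
Proof.
move=> rs lamL1 /(real_closed rs)[i_lt i_closed]; rewrite (dot_scaled _ (real_size rs)).
have i_lt' : (i < size us)%N by rewrite (real_size rs).
rewrite (bigD1 (Ordinal i_lt'))//= eqxx.
set y := x _.
have : lam * y <= \sum_(j < size us | (val j != i) && ~~ apart s i j) x (nth v us j).
  rewrite -(sum_seq_nbr_eq (real_uniq rs) i_closed).
  rewrite sum_seq_index [leRHS]big_mkcond [leLHS]big_mkcond; apply: ler_sum => j _ /=.
  case: ifP => [eij|_]; last by case: ifP => // _; exact: ltW.
  have -> : val j != i by apply: contraTneq eij => ->; rewrite e_irr.
  by case: (boolP (apart s i j)) => // /(apartP rs); rewrite eij.
rewrite [X in _ -> 0 <= _ + X](_ : _ =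
  K * (K * \sum_(j < size us | (val j != i) && ~~ apart s i j) x (nth v us j))).
  move=> sum_ge; rewrite zrN mulNr addrC subr_ge0 [leLHS]mulrCA ler_pM2l ?unit_gt0//.
  apply: le_trans (_ : K * (lam * y) <= _); last by rewrite ler_pM2l ?unit_gt0.
  by rewrite mulrA ler_pM2r ?x_gt0.
rewrite !mulr_sumr big_mkcondr; apply: eq_big => [j|j j_neq] /=.
  by rewrite -val_eqE.
rewrite -val_eqE /= in j_neq; rewrite (negbTE j_neq).
by case: ifP => _; rewrite /= ?zr0 ?mul0r.
Qed.

(** Numbering the neighbours of [v] by decreasing entries breaks the symmetry of
    the search. *)
Lemma sort_row_ge0 s us i : realizes s us -> (0 < i < d)%N ->
  0 <= dot (sort_row s i) (scaled us).
Proof.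
move=> rs /andP[i0 i_lt]; rewrite (dot_scaled _ (real_size rs)).
have [rest usE] := real_star rs.
have i1_lt : (i.+1 < size us)%N by rewrite usE /= size_cat ltnS (leq_trans i_lt)// leq_addr.
have i_lt' : (i < size us)%N by exact: ltn_trans i1_lt.
rewrite (bigD1 (Ordinal i_lt'))//= eqxx (bigD1 (Ordinal i1_lt))/=; last first.
  by rewrite -val_eqE /= gtn_eqF.
rewrite eqxx (gtn_eqF (ltnSn i)) big1 => [|j]; last first.
  by rewrite -!val_eqE /= => /andP[/negbTE -> /negbTE ->]; rewrite zr0 mul0r.
rewrite addr0 zr1 (_ : zr (-1)%BZ = -1)// mul1r mulN1r subr_ge0 ler_pM2l ?unit_gt0//.
rewrite usE; case: i i0 i_lt {i1_lt i_lt'} => // i _ i_lt /=.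
rewrite !nth_cat i_lt (ltnW i_lt).
by move/sortedP: N_sorted => /(_ v i i_lt).
Qed.

Lemma final_box_sound s us L1 L2 : realizes s us -> zr L1 <= K * lam <= zr L2 ->
  in_box (final_box d s L1 L2) (scaled us).
Proof.
move=> rs /andP[lam1 lam2]; rewrite /final_box; set rs' := rows _ _ _ _.
have rows_size : all (fun r => size r == known s) rs'.
  rewrite /rs' /rows !all_cat !all_map; apply/and3P; split; apply/allP => i _ /=;
  by rewrite size_map size_iota.
have rows_ge0 : all (fun r => 0 <= dot r (scaled us)) rs'.
  rewrite /rs' /rows !all_cat !all_map; apply/and3P; split; apply/allP => i /=.
  - by rewrite mem_iota /= => i_lt; exact: lower_row_ge0.
  - exact: upper_row_ge0.
  - rewrite mem_iota => i_lt; apply: sort_row_ge0 => //; move: i_lt.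
    by case: (d) => [|m] /=; lia.
have start : in_box (start_box s) (scaled us) /\ size (start_box s) = known s.
  have [rest usE] := real_star rs; have := real_size rs; rewrite usE /= => <-.
  rewrite /start_box /= size_nseq; split=> //.
  rewrite /scaled /= xv mulr1 !lexx /=.
  move: (N ++ rest) => l; elim: l => //= w l IHl; rewrite zr0 IHl andbT.
  have K0 := ltW unit_gt0; apply/andP; split; first by rewrite mulr_ge0// ltW.
  by rewrite ler_piMr.
suff : forall m, in_box (iter m (fun B => foldl tighten B rs') (start_box s)) (scaled us)
   /\ size (iter m (fun B => foldl tighten B rs') (start_box s)) = known s.
  by move=> /(_ 5)[].
elim=> //= m [IH szm]; have [|h1 h2] := foldl_tighten_sound _ rows_ge0 IH.
  by apply: sub_all rows_size => r /eqP ->; rewrite szm.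
by rewrite h2.
Qed.

Lemma sum_N : \sum_(w <- N) x w = lam.
Proof.
rewrite -[RHS]mulr1 -xv -x_eig big_uniq//.
by apply: eq_bigl => w; rewrite -N_nbr.
Qed.

(** [S ^+ 2 - c Q >= \sum_u (2 m x_u - c x_u ^+ 2) - m ^+ 2], and since
    [c <= 2 m] and [x_u <= 1] the vertices that are not known can only increase the
    right-hand side. *)
Lemma bound_sound (cn m L1 L2 : Z) s us : (0 <= cn)%BZ -> realizes s us ->
  zr L1 <= K * lam <= zr L2 -> bounded_below d cn m L1 L2 (final_box d s L1 L2) ->
  zr cn * \sum_u x u ^+ 2 <= 100 * (\sum_u x u) ^+ 2.
Proof.
move=> cn0 rs lamL bb; have := final_box_sound rs lamL.
have [rest usE] := real_star rs.
rewrite usE /scaled /= map_cat => boxed.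
have [||cnm] := bounded_below_sound cn0 boxed _ _ bb.
- by rewrite size_map.
- by rewrite big_map -mulr_sumr sum_N.
rewrite -map_cat -(map_cons (fun u => K * x u)) -usE big_map.
set m' := zr m / 100.
have mE : 100 * zr m = K * m'.
  by rewrite -[unitZ]/(100 * 100)%BZ zrM (_ : zr 100%BZ = 100)// /m'; field.
have m'E : 200 * m' = 2 * zr m by rewrite /m'; field.
rewrite mE => H.
have : 0 <= \sum_(u <- us) (200 * m' * x u - zr cn * x u ^+ 2) - 100 * m' ^+ 2.
  rewrite -(pmulr_rge0 _ (_ : 0 < K ^+ 2)) ?exprn_gt0 ?unit_gt0//.
  move: H; congr (0 <= _); move: K => K'.
  rewrite mulrBr mulr_sumr; congr (_ - _); last by ring.
  by apply: eq_bigr => u _; ring.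
have : \sum_(u <- us) (200 * m' * x u - zr cn * x u ^+ 2) <=
    200 * m' * (\sum_u x u) - zr cn * \sum_u x u ^+ 2.
  rewrite !mulr_sumr -sumrB big_uniq ?(real_uniq rs)// [leRHS](bigID (mem us))/=.
  rewrite lerDl; apply: sumr_ge0 => u _; rewrite expr2 mulrA -mulrBl.
  apply: mulr_ge0; last exact: ltW.
  have cn0' : 0 <= zr cn by rewrite -(zr0 R) ler_zr; exact/Z.leb_le.
  have : zr cn * x u <= zr cn by rewrite ler_piMr.
  by rewrite m'E; lra.
set S := \sum_u x u; have := sqr_ge0 (S - m'); rewrite !expr2; nra.
Qed.

Lemma hinge_sound s us L2 : realizes s us -> K * lam <= zr L2 -> hinge_ok d s L2 ->
  lam <= 16 / 5 /\ exists a b c y, K4_hinge e v a b c y.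
Proof.
move=> rs lamL2 /and4P[/eqP d4 k4 L2_le /allP tri]; split.
  have : K * lam <= zr 32000%BZ by apply: le_trans lamL2 _; rewrite ler_zr.
  rewrite -(ler_pM2l (_ : 0 < 5)) ?ltr0n// mulrCA (_ : 5 * zr _ = K * 16); last first.
    by rewrite -[5]/(zr 5%BZ) -[16]/(zr 16%BZ) -!zrM.
  by rewrite ler_pM2l ?unit_gt0//; lra.
have [rest usE] := real_star rs.
case: N N_uniq N_nbr d4 usE => [|a [|b [|c [|y [|? ?]]]]]//= Nu Nn _ usE.
have us4 : us = [:: v; a; b; c] ++ y :: rest by rewrite usE.
have us5 : us = [:: v; a; b; c; y] ++ rest by rewrite usE.
have us_uniq := real_uniq rs.
have nbr i : i \in [:: 1; 2; 3]%N ->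
    forall w, e (nth v us i) w = (w \in rem (nth v us i) [:: v; a; b; c]).
  move=> i123 w; have /andP[i_closed /allP i_row] := tri i i123.
  have [i_lt i_nbr] := real_closed rs i_closed.
  have uniq4 : uniq [:: v; a; b; c].
    by move: us_uniq; rewrite us4 cat_uniq => /andP[].
  rewrite mem_rem_uniq// inE /=.
  have in4 j : (j < 4)%N -> nth v us j \in [:: v; a; b; c].
    by rewrite usE; case: j => [|[|[|[|]]]]//=; rewrite !inE eqxx ?orbT.
  have [w_us|w_us] := boolP (w \in us); last first.
    rewrite (contraNF (i_nbr w) w_us); apply/esym/negbTE.
    rewrite negb_and; apply/orP; right; apply: contra w_us => w4.
    by rewrite us4 mem_cat w4.
  have [j j_lt <-] : exists2 j, (j < known s)%N & nth v us j = w.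
    by exists (index w us); rewrite ?nth_index// -(real_size rs) index_mem.
  have := i_row j; rewrite mem_iota /= => /(_ j_lt).
  have [->|ji] := eqVneq j i; first by rewrite e_irr eqxx.
  rewrite nth_uniq ?(real_size rs)// ji /=.
  case: ltnP => j4; first by move=> /(linkedP rs) ->; rewrite in4.
  move=> /(apartP rs)/negbTE ->; apply/esym/negbTE.
  apply/negP => /(nthP v)[l /= l4 lE].
  have : nth v us l == nth v us j.
    by rewrite -lE us4 nth_cat l4 eqxx.
  rewrite nth_uniq ?(real_size rs)//; first by move=> /eqP lj; move: l4; rewrite lj ltnNge j4.
  exact: leq_trans l4 (leq_trans j4 (ltnW j_lt)).
have uniq5 : uniq [:: v; a; b; c; y].
  by move: us_uniq; rewrite us5 cat_uniq => /andP[].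
have [va [vb [vc [ab [ac bc]]]]] : v != a /\ v != b /\ v != c /\ a != b /\ a != c /\ b != c.
  by move: uniq5; rewrite /= !inE !negb_or -!andbA; case/and5P=> ? ? ? ? /and5P[? ? ? ? _].
exists a, b, c, y; split=> // w.
- by have := nbr 1%N isT w; rewrite usE /= (negbTE va) eqxx -[w \in e a]/(e a w) => ->.
- by have := nbr 2%N isT w; rewrite usE /= (negbTE vb) (negbTE ab) eqxx -[w \in e b]/(e b w) => ->.
- by have := nbr 3%N isT w; rewrite usE /= (negbTE vc) (negbTE ac) (negbTE bc) eqxx -[w \in e c]/(e c w) => ->.
Qed.

(** If all known vertices are closed then they are all vertices, by
    connectedness. *)
Lemma full_sound s us : realizes s us ->
  ((known s < n)%N && all (fun i => i \in closed s) (iota 0 (known s)))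
            || (exact_n && (n < known s)%N) -> False.
Proof.
move=> rs; have us_le : (size us <= #|T|)%N by rewrite -(card_uniqP (real_uniq rs)) max_card.
case/orP => /andP[]; last first.
  by move=> /n_exact T_n; rewrite -(real_size rs) ltnNge -T_n us_le.
move=> k_lt /allP all_closed.
have us_all w : w \in us.
  have v_us : v \in us by have [rest ->] := real_star rs; rewrite mem_head.
  have /connectP[p + ->] := e_conn v w.
  elim: p v v_us => [|u p IHp] u' u'_us //= /andP[u'u up]; apply: IHp up.
  have := all_closed (index u' us); rewrite mem_iota /= -(real_size rs) index_mem.
  move=> /(_ u'_us)/(real_closed rs)[_]; rewrite nth_index//.
  exact.
move: k_lt; rewrite -(real_size rs) => /leq_trans/(_ n_le); apply/negP.
rewrite -leqNgt -(card_uniqP (real_uniq rs)); apply: subset_leq_card.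
by apply/fintype.subsetP => w _; exact: us_all.
Qed.

Theorem check_sound (cn : Z) p s us L1 L2 : (0 <= cn)%BZ ->
  realizes s us -> zr L1 <= K * lam <= zr L2 ->
  check n exact_n cn d p s L1 L2 ->
  zr cn * \sum_u x u ^+ 2 <= 100 * (\sum_u x u) ^+ 2 \/
  (lam <= 16 / 5 /\ exists a b c y, K4_hinge e v a b c y).
Proof.
move=> cn0; elim: p s us L1 L2 => [m|||q p1 IH1 p2 IH2|i j p1 IH1 p2 IH2|i p1 IH1 p2 IH2]
  s us L1 L2 rs lamL.
- case/orP => [|bb]; last by left; exact: (bound_sound cn0 rs lamL bb).
  by have /negP := in_box_nonempty (final_box_sound rs lamL).
- by move=> /(full_sound rs).
- by move=> hg; right; case/andP: lamL => _ lamL2; exact: (hinge_sound rs lamL2 hg).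
- case/andP=> c1 c2; have [lam_q|/ltW lam_q] := lerP (K * lam) (zr q).
    by apply: IH1 rs _ c1; rewrite lam_q andbT; case/andP: lamL.
  by apply: IH2 rs _ c2; rewrite lam_q /=; case/andP: lamL.
- case/and4P=> i_lt j_lt c1 c2; have [eij|eij] := boolP (e (nth v us i) (nth v us j)).
    apply: (IH1 _ us) lamL c1; case: rs => *; split=> // i' j'.
    by rewrite inE => /predU1P[[-> ->]//|]; auto.
  apply: (IH2 _ us) lamL c2; case: rs => *; split=> // i' j'.
  by rewrite inE => /predU1P[[-> ->]//|]; auto.
- case/and3P=> i_lt c1 c2.
  have [/existsP[w /andP[iw w_us]]|] := boolP [exists w, e (nth v us i) w && (w \notin us)].
    have nthr j : (j < known s)%N -> nth v (rcons us w) j = nth v us j.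
      by rewrite nth_rcons -(real_size rs) => ->.
    have nthw : nth v (rcons us w) (known s) = w.
      by rewrite nth_rcons -(real_size rs) ltnn eqxx.
    apply: (IH2 _ (rcons us w)) lamL c2; split=> /=.
    + by rewrite size_rcons (real_size rs).
    + by rewrite rcons_uniq w_us (real_uniq rs).
    + by have [rest ->] := real_star rs; exists (rcons rest w); rewrite -cats1 /= -catA cats1.
    + move=> i' j'; rewrite inE => /predU1P[[-> ->]|/(real_edge rs)[h1 h2 h3]].
        by rewrite nthr// nthw; split=> //; exact: ltnW.
      by rewrite !nthr//; split=> //; exact: ltnW.
    + move=> i' j'; rewrite mem_cat => /orP[/mapP[l l_closed [-> ->]]|/(real_nonedge rs)[h1 h2 h3]].
        have [l_lt l_nbr] := real_closed rs l_closed; rewrite nthr// nthw.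
        by split; [exact: ltnW| exact: ltnSn| apply: contra w_us => /l_nbr].
      by rewrite !nthr//; split=> //; exact: ltnW.
    + move=> l /(real_closed rs)[l_lt l_nbr]; split; first exact: ltnW.
      by move=> u; rewrite nthr// mem_rcons inE => /l_nbr ->; rewrite orbT.
  rewrite negb_exists => /forallP i_closed.
  have rs' := rs; apply: (IH1 _ us) lamL c1; case: rs => *; split=> // l.
  rewrite inE => /predU1P[->|/(real_closed rs')//]; split=> // w iw.
  by have := i_closed w; rewrite iw negbK.
Qed.

Lemma realizes_start : realizes (start_state d) (v :: N).
Proof.
have vN : v \notin N by rewrite -N_nbr -[v \in _]/(e v v) e_irr.
split=> //=.
- by rewrite vN N_uniq.
- by exists [::]; rewrite cats0.
- move=> i j /mapP[l]; rewrite mem_iota => /andP[l0 l_lt] [-> ->] /=; split=> //.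
  by case: l l0 l_lt => // l _ l_lt /=; rewrite -[e _ _]/(_ \in e v) N_nbr mem_nth.
- move=> i; rewrite inE => /eqP ->; split=> // w /= vw.
  by rewrite inE -N_nbr -[w \in e v]/(e v w) vw orbT.
Qed.

End SearchSound.

(** * Search trees *)

Section Plans.
Local Open Scope Z_scope.
Arguments Ask (_ _)%_nat_scope _ _.
Arguments Grow _%_nat_scope _ _.

(** Search trees for each degree of the maximal vertex (first number), for graphs
    with exactly six vertices and for graphs with at least seven. Any trees that
    pass [check] would do. The argument of [Bound] approximates in hundredths the
    optimal [m], which is the sum of the entries; [Bound 0] can only close a node
    whose constraints are contradictory. *)
Definition plan_1_6 : plan :=
  Grow 1 Full (Bound 0).

Definition plan_1_7 : plan :=
  Grow 1 Full (Bound 0).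

Definition plan_2_6 : plan :=
  Cut 14062 (Bound 0) (Ask 1 2 (Cut 19628 (Bound 0) (Grow 1 (Grow 2 Full (Bound 0)) (Bound 0)))
  (Grow 1 (Grow 2 Full (Cut 17031 (Bound 0) (Bound 0))) (Cut 15917 (Bound 0) (Ask 2 3 (Cut
  19744 (Bound 0) (Grow 1 (Grow 2 (Grow 3 Full (Bound 0)) (Bound 0)) (Bound 0))) (Cut 16172
  (Bound 0) (Grow 2 (Cut 16411 (Grow 1 (Grow 3 Full (Bound 0)) (Bound 0)) (Bound 0)) (Cut 17129
  (Bound 0) (Grow 1 (Grow 2 (Grow 3 (Grow 4 Full (Bound 391)) (Bound 400)) (Bound 415)) (Bound
  403))))))))).

Definition plan_2_7 : plan :=
  Cut 14062 (Bound 0) (Ask 1 2 (Cut 19628 (Bound 0) (Grow 1 (Grow 2 Full (Bound 0)) (Bound 0)))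
  (Grow 1 (Grow 2 Full (Cut 17031 (Bound 0) (Bound 0))) (Cut 15917 (Bound 0) (Ask 2 3 (Cut
  19744 (Bound 0) (Grow 1 (Grow 2 (Grow 3 Full (Bound 0)) (Bound 0)) (Bound 0))) (Cut 16172
  (Bound 0) (Grow 2 (Cut 16411 (Grow 1 (Grow 3 Full (Bound 0)) (Bound 0)) (Bound 0)) (Cut 17129
  (Bound 0) (Grow 1 (Grow 2 (Grow 3 (Grow 4 Full (Cut 18564 (Bound 416) (Bound 416))) (Cut
  18564 (Bound 411) (Bound 430))) (Bound 415)) (Bound 403))))))))).

Definition plan_3_6 : plan :=
  Cut 17304 (Bound 0) (Ask 1 3 (Cut 23018 (Bound 0) (Ask 2 3 (Cut 29986 (Cut 26502 (Bound 0)
  (Cut 28244 (Bound 0) (Cut 29115 (Bound 0) (Cut 29550 (Bound 0) (Cut 29768 (Bound 0) (Cut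
  29877 (Bound 0) (Cut 29931 (Bound 0) (Cut 29958 (Bound 0) (Cut 29972 (Bound 0) (Bound
  0)))))))))) (Grow 3 (Ask 1 2 (Grow 1 (Grow 2 Full (Bound 0)) (Bound 0)) (Grow 1 (Bound 0)
  (Grow 1 (Bound 499) (Bound 466)))) (Bound 0))) (Grow 3 (Cut 27326 (Ask 1 2 (Cut 25591 (Cut
  24304 (Bound 0) (Cut 24947 (Bound 0) (Cut 25269 (Bound 0) (Cut 25430 (Bound 0) (Cut 25510
  (Bound 0) (Bound 0)))))) (Grow 1 (Grow 2 Full (Cut 26389 (Cut 25990 (Bound 0) (Cut 26189
  (Bound 0) (Cut 26289 (Bound 0) (Cut 26339 (Bound 0) (Bound 0))))) (Grow 2 (Grow 4 Full (Cut
  26857 (Bound 416) (Bound 440))) (Bound 435)))) (Bound 0))) (Grow 1 (Cut 23034 (Grow 2 (Bound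
  0) (Grow 2 (Bound 406) (Bound 396))) (Bound 0)) (Cut 24212 (Bound 0) (Grow 2 (Cut 25769
  (Bound 418) (Bound 0)) (Cut 25769 (Bound 398) (Bound 416)))))) (Bound 0)) (Cut 24981 (Bound
  0) (Grow 1 (Grow 2 (Grow 3 (Grow 4 Full (Cut 26117 (Cut 25549 (Bound 403) (Cut 25833 (Bound
  406) (Cut 25975 (Bound 408) (Bound 409)))) (Cut 28371 (Ask 2 4 (Bound 448) (Bound 0)) (Cut
  29185 (Cut 28778 (Bound 434) (Bound 458)) (Bound 482))))) (Cut 27490 (Bound 412) (Bound
  424))) (Cut 27490 (Cut 26235 (Bound 407) (Bound 413)) (Bound 424))) (Cut 27490 (Bound 402)
  (Bound 424))))))) (Cut 17316 (Bound 0) (Grow 1 (Cut 23099 (Ask 1 2 (Cut 21686 (Bound 0) (Grow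
  2 (Grow 3 Full (Cut 22127 (Bound 0) (Grow 3 (Grow 4 Full (Cut 22293 (Bound 369) (Cut 22370
  (Ask 2 3 (Bound 0) (Bound 371)) (Cut 22734 (Cut 22552 (Cut 22461 (Cut 22415 (Cut 22392 (Cut
  22381 (Bound 371) (Bound 371)) (Bound 371)) (Bound 371)) (Bound 372)) (Bound 373)) (Bound
  377))))) (Bound 380)))) (Bound 0))) (Cut 17327 (Grow 2 (Grow 3 Full (Bound 0)) (Bound 0))
  (Bound 0))) (Bound 0)) (Cut 18466 (Bound 0) (Grow 1 (Cut 18477 (Bound 0) (Cut 29064 (Ask 1 2
  (Cut 22942 (Bound 0) (Grow 2 (Cut 22953 (Bound 0) (Ask 2 3 (Cut 27237 (Cut 25095 (Bound 0)
  (Cut 26166 (Bound 0) (Cut 26701 (Bound 0) (Cut 26969 (Bound 0) (Cut 27103 (Bound 0) (Cut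
  27170 (Bound 0) (Cut 27203 (Bound 0) (Bound 0)))))))) (Cut 27368 (Grow 3 (Grow 4 Full (Bound
  461)) (Bound 0)) (Cut 28216 (Cut 27792 (Cut 27580 (Cut 27474 (Cut 27421 (Cut 27394 (Cut 27381
  (Bound 443) (Bound 443)) (Bound 443)) (Bound 444)) (Bound 444)) (Bound 445)) (Bound 446))
  (Bound 450)))) (Grow 3 (Grow 4 Full (Cut 24109 (Cut 23531 (Bound 401) (Cut 23820 (Bound 403)
  (Cut 23964 (Bound 405) (Cut 24036 (Bound 405) (Cut 24072 (Bound 405) (Cut 24090 (Bound 406)
  (Bound 406))))))) (Cut 25566 (Ask 2 4 (Bound 0) (Bound 396)) (Cut 27315 (Cut 26440 (Cut 26003
  (Bound 414) (Bound 437)) (Bound 460)) (Bound 0))))) (Cut 24002 (Bound 397) (Cut 26425 (Ask 2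
  4 (Bound 0) (Cut 25213 (Bound 394) (Bound 436))) (Cut 27744 (Cut 27084 (Cut 26754 (Cut 26589
  (Cut 26507 (Cut 26466 (Cut 26445 (Bound 416) (Bound 416)) (Bound 416)) (Bound 416)) (Bound
  417)) (Bound 418)) (Bound 421)) (Bound 430))))))) (Cut 26003 (Cut 24472 (Bound 406) (Bound
  407)) (Cut 27533 (Cut 26768 (Bound 416) (Bound 419)) (Bound 427))))) (Cut 23759 (Ask 2 3 (Cut
  21118 (Bound 0) (Cut 22438 (Bound 0) (Cut 23098 (Bound 395) (Bound 408)))) (Grow 2 (Grow 3
  (Grow 4 Full (Cut 20622 (Cut 19549 (Bound 364) (Cut 20085 (Bound 366) (Cut 20353 (Bound 368)
  (Cut 20487 (Bound 369) (Cut 20554 (Bound 370) (Cut 20588 (Bound 370) (Bound 370))))))) (Cut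
  23139 (Ask 2 4 (Bound 421) (Bound 0)) (Bound 381)))) (Cut 22025 (Cut 20251 (Bound 349) (Cut
  21138 (Bound 360) (Cut 21581 (Bound 366) (Cut 21803 (Bound 369) (Cut 21914 (Bound 370) (Cut
  21969 (Bound 371) (Bound 371))))))) (Cut 22953 (Ask 2 4 (Bound 404) (Bound 0)) (Bound 379))))
  (Cut 21148 (Cut 19812 (Bound 353) (Cut 20480 (Bound 360) (Cut 20814 (Bound 364) (Cut 20981
  (Bound 366) (Cut 21064 (Bound 367) (Cut 21106 (Bound 368) (Cut 21127 (Bound 368) (Cut 21137
  (Bound 368) (Bound 368))))))))) (Cut 22953 (Ask 2 4 (Bound 0) (Cut 22938 (Ask 3 4 (Bound 402)
  (Grow 4 (Cut 22043 (Cut 21595 (Cut 21371 (Bound 367) (Bound 368)) (Cut 21819 (Bound 369)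
  (Bound 369))) (Bound 368)) Full)) (Bound 379))) (Bound 379))))) (Bound 402))) (Cut 29532 (Cut
  29298 (Bound 454) (Bound 465)) (Bound 476)))) (Cut 22328 (Cut 20397 (Bound 374) (Cut 21362
  (Bound 380) (Cut 21845 (Bound 384) (Cut 22086 (Bound 387) (Cut 22207 (Bound 388) (Cut 22267
  (Bound 388) (Cut 22297 (Bound 389) (Bound 389)))))))) (Cut 26788 (Ask 1 2 (Cut 24558 (Bound
  0) (Bound 410)) (Ask 2 4 (Cut 24558 (Bound 410) (Bound 411)) (Ask 2 5 (Cut 24558 (Bound 410)
  (Bound 411)) (Grow 2 (Cut 24558 (Cut 23443 (Cut 22885 (Bound 384) (Bound 388)) (Bound 400))
  (Bound 0)) Full)))) (Cut 28394 (Cut 27591 (Cut 27189 (Cut 26988 (Cut 26888 (Cut 26838 (Cut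
  26813 (Bound 418) (Bound 418)) (Bound 419)) (Bound 419)) (Bound 421)) (Bound 423)) (Bound
  429)) (Bound 439))))))))).

Definition plan_3_7 : plan :=
  Cut 17187 (Bound 0) (Ask 1 3 (Cut 22792 (Bound 0) (Ask 2 3 (Cut 29774 (Cut 26283 (Bound 0)
  (Cut 28028 (Bound 0) (Cut 28901 (Bound 0) (Cut 29337 (Bound 0) (Bound 0))))) (Grow 3 (Ask 1 2
  (Grow 1 (Grow 2 Full (Bound 0)) (Bound 0)) (Grow 1 (Bound 0) (Grow 1 (Grow 2 (Grow 4 Full
  (Bound 524)) (Bound 524)) (Bound 463)))) (Bound 0))) (Cut 23017 (Bound 0) (Grow 2 (Cut 25635
  (Ask 1 2 (Cut 25307 (Bound 0) (Grow 1 (Grow 3 Full (Bound 0)) (Bound 0))) (Bound 0)) (Bound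
  0)) (Ask 3 4 (Cut 26508 (Cut 24762 (Bound 0) (Cut 25635 (Bound 0) (Bound 0))) (Grow 1 (Grow 2
  (Grow 3 (Grow 4 Full (Bound 437)) (Bound 449)) (Bound 435)) (Bound 435))) (Grow 3 (Cut 27381
  (Ask 1 2 (Cut 26290 (Bound 0) (Ask 1 4 (Bound 0) (Grow 1 (Grow 2 (Grow 4 Full (Cut 26835
  (Grow 4 (Grow 5 Full (Bound 424)) (Bound 443)) (Bound 439))) (Bound 434)) (Bound 0)))) (Grow
  1 (Grow 2 (Grow 4 Full (Cut 25199 (Bound 401) (Bound 465))) (Cut 23835 (Bound 390) (Cut 26017
  (Ask 1 4 (Bound 428) (Bound 0)) (Bound 430)))) (Cut 24926 (Bound 397) (Cut 26017 (Grow 1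
  (Grow 2 (Grow 4 (Grow 5 Full (Bound 424)) (Bound 421)) (Bound 431)) (Bound 449)) (Cut 26699
  (Cut 26358 (Cut 26187 (Bound 423) (Bound 426)) (Bound 429)) (Bound 434)))))) (Bound 0)) (Cut
  25635 (Bound 392) (Cut 29127 (Grow 1 (Grow 2 (Grow 3 (Grow 4 (Grow 5 Full (Cut 27381 (Bound
  423) (Bound 437))) (Cut 27381 (Bound 421) (Bound 437))) (Bound 432)) (Bound 420)) (Bound
  421)) (Cut 29563 (Cut 29345 (Bound 453) (Bound 456)) (Bound 459)))))))))) (Grow 1 (Cut 23192
  (Ask 1 2 (Cut 21690 (Bound 0) (Ask 2 3 (Bound 0) (Grow 2 (Grow 3 Full (Cut 22065 (Bound 0)
  (Grow 3 (Grow 4 Full (Cut 22628 (Grow 4 (Grow 5 Full (Bound 380)) (Bound 403)) (Bound 402)))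
  (Bound 379)))) (Bound 0)))) (Cut 17562 (Grow 2 (Grow 3 Full (Bound 0)) (Bound 0)) (Bound 0)))
  (Bound 0)) (Cut 18387 (Bound 0) (Ask 1 2 (Cut 22741 (Bound 0) (Ask 2 3 (Cut 27050 (Bound 0)
  (Ask 2 4 (Bound 0) (Grow 2 (Ask 3 4 (Cut 28893 (Cut 27971 (Bound 0) (Cut 28432 (Bound 0)
  (Bound 0))) (Grow 1 (Grow 3 (Grow 4 Full (Bound 484)) (Bound 0)) (Bound 482))) (Grow 1 (Grow
  3 (Grow 4 Full (Bound 452)) (Cut 28525 (Bound 448) (Bound 477))) (Cut 28525 (Cut 27787 (Bound
  438) (Bound 444)) (Cut 29262 (Bound 450) (Bound 456))))) (Bound 0)))) (Ask 2 4 (Cut 27050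
  (Cut 24895 (Bound 0) (Cut 25972 (Bound 0) (Bound 0))) (Grow 3 (Cut 28525 (Bound 0) (Bound 0))
  (Bound 443))) (Grow 2 (Cut 25689 (Grow 1 (Ask 3 4 (Cut 24583 (Bound 0) (Grow 3 (Grow 4 Full
  (Bound 449)) (Bound 439))) (Grow 3 (Cut 23109 (Grow 4 Full (Bound 0)) (Bound 0)) (Cut 23109
  (Bound 0) (Cut 24952 (Grow 3 (Grow 4 (Grow 5 Full (Bound 397)) (Bound 406)) (Bound 411))
  (Bound 418))))) (Bound 402)) (Bound 0)) (Cut 24101 (Bound 409) (Cut 29092 (Grow 1 (Grow 2
  (Grow 3 (Grow 4 (Grow 5 Full (Cut 26596 (Bound 418) (Cut 27844 (Bound 431) (Bound 446))))
  (Cut 26596 (Bound 417) (Cut 27844 (Bound 431) (Bound 446)))) (Cut 26596 (Bound 415) (Bound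
  433))) (Bound 420)) (Bound 415)) (Cut 29546 (Cut 29319 (Bound 452) (Bound 456)) (Bound
  459)))))))) (Grow 1 (Cut 24555 (Ask 2 3 (Cut 23013 (Bound 0) (Grow 2 (Grow 3 (Grow 4 Full
  (Bound 410)) (Bound 0)) (Bound 458))) (Ask 3 4 (Cut 21856 (Bound 0) (Grow 2 (Grow 3 (Grow 4
  Full (Bound 408)) (Bound 410)) (Bound 392))) (Grow 3 (Cut 22627 (Grow 2 (Grow 4 Full (Cut
  19447 (Bound 365) (Cut 21302 (Ask 2 4 (Bound 0) (Bound 409)) (Cut 21964 (Bound 391) (Bound
  438))))) (Cut 19977 (Bound 350) (Cut 21037 (Grow 2 (Grow 4 (Grow 5 Full (Bound 390)) (Bound
  388)) (Bound 0)) (Cut 21832 (Bound 383) (Bound 430))))) (Bound 0)) (Cut 20700 (Bound 344)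
  (Cut 23398 (Grow 2 (Grow 3 (Grow 4 (Grow 5 Full (Cut 22049 (Bound 383) (Bound 384))) (Cut
  22049 (Bound 383) (Bound 383))) (Bound 396)) (Bound 373)) (Bound 407)))))) (Bound 0)) (Cut
  20927 (Bound 366) (Cut 29274 (Grow 1 (Cut 21187 (Bound 388) (Cut 28230 (Ask 4 5 (Cut 24708
  (Bound 418) (Cut 26469 (Bound 426) (Bound 435))) (Ask 3 4 (Cut 24708 (Bound 397) (Cut 26469
  (Cut 25588 (Bound 423) (Cut 26028 (Cut 25808 (Bound 430) (Bound 431)) (Bound 432))) (Bound
  433))) (Ask 3 5 (Cut 24708 (Bound 397) (Cut 26469 (Cut 25588 (Bound 423) (Cut 26028 (Cut
  25808 (Bound 430) (Bound 431)) (Bound 432))) (Bound 433))) (Grow 3 (Cut 26469 (Grow 2 (Grow 4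
  (Grow 5 Full (Cut 23828 (Cut 22507 (Bound 407) (Bound 402)) (Cut 24818 (Ask 2 3 (Bound 410)
  (Bound 442)) (Cut 25643 (Bound 417) (Bound 433))))) (Cut 23828 (Cut 22507 (Bound 407) (Bound
  402)) (Cut 24818 (Ask 2 3 (Bound 410) (Bound 441)) (Cut 25643 (Bound 417) (Bound 433)))))
  (Cut 23828 (Bound 387) (Cut 25148 (Cut 24488 (Bound 410) (Bound 420)) (Bound 433)))) (Bound
  436)) (Cut 24708 (Cut 22947 (Bound 396) (Cut 23827 (Bound 404) (Cut 24267 (Bound 409) (Bound
  410)))) (Cut 25368 (Ask 2 3 (Bound 442) (Grow 3 (Bound 417) (Bound 436))) (Cut 26799 (Cut
  26083 (Cut 25725 (Cut 25546 (Bound 418) (Bound 420)) (Bound 423)) (Bound 428)) (Bound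
  440)))))))) (Bound 446))) (Cut 25100 (Bound 397) (Cut 27187 (Bound 418) (Bound 445)))) (Cut
  29637 (Bound 455) (Bound 460))))))))).

Definition plan_4_6 : plan :=
  Cut 19843 (Bound 0) (Cut 36484 (Grow 4 (Grow 2 (Grow 1 (Grow 3 Full (Cut 23743 (Bound 324)
  (Cut 34143 (Ask 3 4 (Cut 28943 (Bound 358) (Cut 31543 (Bound 405) (Cut 32843 (Bound 430)
  (Bound 441)))) (Cut 33818 (Grow 3 (Grow 5 (Cut 33503 (Ask 1 3 (Cut 29233 (Bound 393) (Ask 2 3
  (Bound 415) (Cut 31368 (Cut 30300 (Cut 29766 (Bound 412) (Bound 416)) (Bound 421)) (Bound
  431)))) (Cut 29538 (Ask 1 4 (Cut 26640 (Bound 359) (Bound 383)) (Cut 26640 (Bound 353) (Bound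
  0))) (Cut 31520 (Bound 406) (Bound 0)))) (Bound 448)) Full) Full) (Bound 452))) (Bound
  452)))) (Cut 22443 (Bound 323) (Cut 34143 (Grow 1 (Grow 3 (Grow 5 (Ask 1 4 (Cut 28293 (Bound
  346) (Cut 31218 (Cut 29755 (Bound 402) (Bound 414)) (Cut 32680 (Cut 31949 (Bound 428) (Bound
  434)) (Cut 33411 (Bound 440) (Bound 447))))) (Cut 33777 (Ask 1 3 (Cut 28464 (Cut 25453 (Bound
  0) (Cut 26958 (Bound 380) (Bound 391))) (Ask 1 2 (Cut 31120 (Bound 409) (Cut 32448 (Cut 31784
  (Bound 434) (Bound 439)) (Cut 33112 (Bound 444) (Bound 450)))) (Cut 31120 (Cut 29792 (Bound
  404) (Bound 415)) (Bound 0)))) (Cut 29172 (Ask 1 2 (Cut 26017 (Bound 388) (Cut 28330 (Ask 3 5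
  (Bound 403) (Bound 382)) (Bound 403))) (Cut 25807 (Cut 24125 (Bound 345) (Bound 358)) (Bound
  0))) (Cut 31474 (Bound 402) (Bound 0)))) (Bound 452))) Full) Full) Full) (Bound 452)))) (Cut
  23223 (Bound 341) (Cut 34143 (Grow 1 (Grow 2 (Grow 3 (Grow 5 (Ask 2 4 (Cut 28683 (Bound 353)
  (Cut 31413 (Cut 30048 (Bound 405) (Bound 417)) (Cut 32778 (Cut 32095 (Bound 429) (Bound 435))
  (Bound 441)))) (Cut 33801 (Ask 3 5 (Cut 28512 (Bound 364) (Cut 31156 (Cut 29834 (Bound 414)
  (Cut 30495 (Bound 425) (Bound 430))) (Cut 32478 (Cut 31817 (Bound 436) (Bound 441)) (Bound
  445)))) (Ask 2 3 (Cut 28512 (Bound 389) (Ask 1 2 (Cut 31156 (Bound 412) (Cut 32478 (Bound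
  435) (Bound 445))) (Cut 31156 (Cut 29834 (Cut 29173 (Bound 405) (Bound 411)) (Bound 415))
  (Bound 428)))) (Cut 30825 (Ask 3 4 (Cut 27024 (Bound 353) (Cut 28924 (Bound 388) (Bound
  404))) (Cut 29161 (Ask 1 4 (Bound 360) (Cut 28047 (Ask 1 5 (Cut 25635 (Bound 375) (Cut 26841
  (Bound 394) (Bound 408))) (Cut 26841 (Ask 1 3 (Bound 354) (Bound 357)) (Bound 389))) (Bound
  405))) (Bound 409))) (Bound 419)))) (Bound 452))) Full) Full) Full) Full) (Bound 452)))) (Cut
  24523 (Cut 22183 (Bound 0) (Bound 361)) (Cut 34143 (Ask 1 4 (Cut 29333 (Bound 365) (Cut 31738
  (Bound 409) (Cut 32940 (Bound 432) (Bound 442)))) (Ask 1 5 (Cut 29333 (Bound 375) (Cut 31738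
  (Bound 418) (Bound 438))) (Grow 1 (Cut 31136 (Ask 1 3 (Cut 26795 (Bound 361) (Ask 1 2 (Cut
  28151 (Bound 387) (Ask 2 4 (Bound 401) (Ask 2 5 (Bound 416) (Ask 3 4 (Bound 402) (Ask 3 5
  (Bound 417) (Grow 2 (Ask 2 3 (Cut 30762 (Bound 0) (Grow 3 Hinge Full)) (Bound 0)) Full))))))
  (Bound 0))) (Bound 356)) (Cut 32639 (Cut 31887 (Bound 422) (Bound 435)) (Bound 448))) Full)))
  (Bound 452)))) (Bound 464)).

Definition plan_4_7 : plan :=
  Cut 19843 (Bound 0) (Grow 3 (Ask 1 3 (Cut 24567 (Bound 0) (Ask 2 3 (Cut 29148 (Bound 0) (Ask
  3 4 (Cut 33895 (Bound 0) (Grow 1 (Grow 2 (Grow 4 Full (Cut 36947 (Cut 35421 (Bound 455) (Cut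
  36184 (Bound 469) (Bound 478))) (Bound 486))) (Cut 36947 (Bound 458) (Bound 489))) (Cut 36947
  (Cut 35421 (Bound 459) (Bound 474)) (Bound 489)))) (Cut 36608 (Grow 1 (Cut 29381 (Bound 0)
  (Grow 2 (Grow 4 Full (Cut 34123 (Ask 1 4 (Cut 33826 (Cut 31603 (Bound 413) (Cut 32714 (Bound
  433) (Cut 33270 (Bound 443) (Cut 33548 (Bound 448) (Bound 451))))) (Ask 1 2 (Bound 456)
  (Bound 0))) (Cut 31752 (Ask 1 2 (Cut 30566 (Bound 0) (Ask 2 4 (Bound 0) (Cut 31455 Hinge
  (Bound 430)))) (Bound 0)) (Bound 433))) (Cut 35365 (Bound 456) (Bound 472)))) (Cut 29832
  (Bound 421) (Cut 33671 (Grow 2 (Grow 4 (Grow 5 Full (Cut 31751 (Bound 431) (Cut 32711 (Bound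
  447) (Bound 454)))) (Cut 31751 (Bound 432) (Bound 446))) (Bound 436)) (Cut 35139 (Cut 34405
  (Bound 455) (Bound 463)) (Bound 473)))))) (Cut 29847 (Bound 417) (Cut 33577 (Grow 1 (Grow 2
  (Grow 4 (Grow 5 Full (Cut 31712 (Bound 430) (Cut 32644 (Cut 32178 (Bound 447) (Cut 32411
  (Bound 451) (Bound 452))) (Bound 452)))) (Cut 31712 (Bound 431) (Bound 445))) (Bound 436))
  (Bound 436)) (Cut 35092 (Cut 34334 (Cut 33955 (Cut 33766 (Bound 454) (Bound 456)) (Bound
  458)) (Bound 462)) (Bound 472))))) (Bound 0)))) (Cut 35658 (Ask 3 4 (Cut 29071 (Bound 0)
  (Grow 1 (Grow 2 (Grow 4 Full (Cut 32364 (Bound 413) (Cut 34011 (Cut 33187 (Bound 440) (Bound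
  449)) (Bound 460)))) (Cut 32364 (Cut 30717 (Bound 413) (Bound 427)) (Cut 34011 (Cut 33187
  (Cut 32775 (Cut 32569 (Bound 443) (Bound 444)) (Cut 32981 (Bound 446) (Bound 448))) (Cut
  33599 (Cut 33393 (Bound 450) (Bound 452)) (Bound 455))) (Bound 460)))) (Cut 32569 (Cut 30820
  (Bound 413) (Cut 31694 (Bound 428) (Cut 32131 (Bound 436) (Cut 32350 (Bound 440) (Bound
  442))))) (Cut 33393 (Grow 1 (Grow 2 (Grow 4 (Grow 5 Full (Bound 450)) (Bound 459)) (Bound
  461)) (Bound 461)) (Cut 34525 (Bound 451) (Bound 468)))))) (Cut 32538 (Grow 2 (Cut 31292 (Ask
  1 2 (Cut 26668 (Bound 0) (Ask 2 4 (Cut 29269 (Bound 0) (Grow 1 (Grow 4 Full (Bound 412))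
  (Bound 419))) (Cut 30136 (Grow 1 (Grow 4 Full (Cut 26884 (Bound 0) (Cut 29052 (Ask 1 4 (Bound
  0) (Cut 27426 (Grow 4 (Grow 5 Full (Bound 393)) (Bound 405)) (Bound 391))) (Bound 408))))
  (Cut 28402 (Bound 399) (Bound 411))) (Bound 0)))) (Cut 25407 (Cut 24987 (Bound 0) (Bound 0))
  (Cut 25827 (Grow 1 (Grow 4 Full (Bound 377)) (Bound 0)) (Cut 28559 (Cut 27193 (Cut 26510 (Cut
  26168 (Cut 25997 (Bound 0) (Bound 0)) (Bound 0)) (Bound 0)) (Bound 0)) (Bound 0))))) (Bound
  0)) (Cut 25563 (Bound 370) (Cut 30794 (Ask 1 5 (Cut 28178 (Bound 403) (Cut 29486 (Bound 423)
  (Bound 434))) (Ask 4 5 (Cut 28178 (Bound 392) (Cut 29486 (Bound 414) (Bound 428))) (Grow 1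
  (Grow 2 (Ask 1 4 (Cut 29486 (Bound 410) (Cut 29813 (Ask 1 2 (Bound 0) (Bound 0)) (Cut 30303
  (Bound 419) (Bound 426)))) (Cut 28832 (Ask 1 2 (Cut 28014 (Cut 26788 (Bound 0) (Cut 27401
  (Bound 0) (Bound 401))) (Cut 28627 (Grow 4 (Grow 5 Full (Bound 419)) (Bound 419)) (Bound
  410))) (Bound 377)) (Bound 409))) (Cut 28178 (Bound 394) (Cut 29486 (Bound 416) (Bound
  433)))) (Cut 28178 (Bound 399) (Cut 29486 (Bound 419) (Bound 433)))))) (Cut 31666 (Bound 432)
  (Bound 444))))) (Bound 0))) (Bound 0)))) (Cut 35905 (Ask 2 3 (Cut 24360 (Bound 0) (Cut 35654
  (Ask 3 4 (Cut 29654 (Bound 0) (Grow 1 (Grow 2 (Grow 4 Full (Cut 32654 (Bound 418) (Bound 0)))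
  (Cut 32654 (Bound 421) (Bound 0))) (Cut 33029 (Cut 31341 (Bound 418) (Cut 32185 (Bound 433)
  (Cut 32607 (Bound 441) (Cut 32818 (Bound 445) (Bound 446))))) (Cut 33404 (Grow 1 (Grow 2
  (Grow 4 (Grow 5 Full (Bound 455)) (Bound 464)) (Bound 467)) (Bound 466)) (Cut 34529 (Bound
  452) (Bound 468)))))) (Cut 32477 (Grow 1 (Cut 29685 (Ask 1 2 (Cut 28686 (Cut 26523 (Bound 0)
  (Cut 27604 (Bound 0) (Cut 28145 (Bound 0) (Cut 28415 (Bound 0) (Bound 0))))) (Ask 1 4 (Cut
  29185 (Bound 0) (Grow 2 (Grow 4 Full (Bound 0)) (Bound 0))) (Bound 0))) (Cut 25358 (Bound 0)
  (Cut 26023 (Grow 2 (Grow 4 Full (Bound 375)) (Bound 0)) (Bound 0)))) (Bound 0)) (Cut 25627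
  (Bound 368) (Cut 30954 (Ask 2 5 (Cut 28290 (Bound 408) (Cut 29622 (Bound 427) (Bound 436)))
  (Ask 4 5 (Cut 28290 (Bound 392) (Cut 29622 (Bound 415) (Bound 429))) (Grow 1 (Grow 2 (Ask 1 2
  (Cut 28623 (Bound 386) (Grow 4 (Grow 5 Full (Bound 420)) (Bound 421))) (Cut 28290 (Ask 1 4
  (Bound 378) (Bound 396)) (Bound 429))) (Cut 28290 (Bound 401) (Cut 29622 (Bound 422) (Bound
  435)))) (Cut 28290 (Bound 394) (Cut 29622 (Bound 417) (Bound 435)))))) (Bound 434)))) (Bound
  0))) (Bound 0))) (Cut 30132 (Ask 1 4 (Cut 25308 (Bound 0) (Cut 26273 (Ask 3 4 (Bound 0)
  (Bound 0)) (Cut 28202 (Cut 27237 (Cut 26755 (Bound 0) (Bound 0)) (Bound 0)) (Bound 0)))) (Ask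
  3 4 (Cut 25308 (Bound 0) (Grow 1 (Grow 2 (Grow 4 Full (Bound 372)) (Bound 369)) (Cut 27117
  (Bound 374) (Cut 27720 (Grow 1 (Grow 2 (Grow 4 (Grow 5 Full (Bound 402)) (Bound 0)) (Bound
  411)) (Bound 411)) (Cut 28926 (Cut 28323 (Cut 28021 (Bound 398) (Bound 403)) (Bound 407))
  (Cut 29529 (Bound 416) (Bound 424))))))) (Cut 27559 (Ask 2 4 (Bound 0) (Grow 4 (Grow 1 (Grow
  2 Full (Cut 22254 (Cut 21048 (Bound 0) (Bound 335)) (Cut 22977 (Ask 1 2 (Bound 0) (Bound 0))
  (Cut 25268 (Cut 24122 (Cut 23549 (Bound 356) (Bound 0)) (Bound 0)) (Bound 0))))) (Cut 21530
  (Bound 330) (Grow 1 (Grow 2 (Grow 5 Full (Cut 24544 (Cut 23037 (Bound 358) (Cut 23790 (Cut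
  23413 (Bound 371) (Bound 372)) (Bound 374))) (Cut 26051 (Bound 385) (Bound 408)))) (Cut 24544
  (Bound 355) (Bound 391))) (Cut 24544 (Bound 364) (Bound 391))))) (Cut 23701 (Bound 0) (Cut
  25630 (Bound 0) (Bound 0))))) (Bound 0)))) (Bound 0))) (Bound 0))) (Cut 22677 (Bound 322)
  (Cut 35590 (Grow 3 (Cut 22878 (Bound 350) (Ask 3 4 (Cut 28836 (Bound 385) (Grow 1 (Grow 2
  (Grow 4 (Grow 5 Full (Cut 32001 (Cut 30418 (Bound 416) (Cut 31209 (Bound 429) (Cut 31605
  (Bound 436) (Bound 439)))) (Cut 34745 (Ask 1 3 (Bound 446) (Ask 1 4 (Bound 443) (Bound 438)))
  (Bound 465)))) (Cut 32213 (Bound 420) (Bound 446))) (Cut 32213 (Bound 419) (Cut 33901 (Bound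
  449) (Bound 463)))) (Cut 32213 (Bound 419) (Cut 33901 (Bound 449) (Bound 462))))) (Ask 4 5
  (Cut 28042 (Cut 25460 (Bound 373) (Cut 26751 (Bound 393) (Bound 401))) (Cut 34398 (Grow 1
  (Grow 2 (Grow 4 (Grow 5 Full (Cut 31220 (Bound 419) (Cut 32809 (Bound 445) (Bound 457))))
  (Cut 31220 (Bound 424) (Bound 445))) (Cut 31220 (Bound 419) (Cut 32809 (Bound 446) (Bound
  458)))) (Cut 31220 (Bound 419) (Cut 32809 (Bound 446) (Bound 458)))) (Bound 468))) (Grow 4
  (Cut 35192 (Ask 1 5 (Cut 26725 (Bound 387) (Cut 33652 (Grow 1 (Grow 2 (Grow 5 Full (Cut 30188
  (Bound 410) (Cut 31920 (Cut 31054 (Bound 441) (Bound 446)) (Cut 32786 (Bound 452) (Bound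
  458))))) (Cut 30188 (Bound 409) (Cut 31920 (Bound 438) (Cut 32786 (Bound 453) (Bound 460)))))
  (Cut 30188 (Bound 413) (Cut 31920 (Bound 441) (Bound 453)))) (Bound 463))) (Ask 2 5 (Cut
  26725 (Bound 387) (Cut 33652 (Grow 1 (Grow 2 (Grow 5 Full (Cut 30188 (Bound 410) (Cut 31920
  (Cut 31054 (Bound 441) (Bound 446)) (Cut 32786 (Bound 452) (Bound 458))))) (Cut 30188 (Bound
  413) (Cut 31920 (Bound 441) (Bound 453)))) (Cut 30188 (Bound 409) (Cut 31920 (Bound 438) (Cut
  32786 (Bound 453) (Bound 460))))) (Bound 463))) (Grow 1 (Ask 1 3 (Cut 27110 (Bound 365) (Grow
  2 (Grow 5 Full (Cut 29635 (Cut 28372 (Bound 407) (Cut 29003 (Bound 417) (Bound 421))) (Cut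
  34181 (Ask 2 3 (Cut 31908 (Bound 437) (Bound 450)) (Cut 31908 (Ask 1 4 (Bound 422) (Bound
  421)) (Cut 33044 (Cut 32476 (Cut 32192 (Bound 442) (Bound 445)) (Bound 447)) (Bound 453))))
  (Bound 463)))) (Cut 31151 (Bound 405) (Cut 33171 (Cut 32161 (Bound 443) (Cut 32666 (Bound
  452) (Cut 32918 (Bound 456) (Bound 458)))) (Cut 34181 (Cut 33676 (Bound 459) (Bound 464))
  (Bound 472)))))) (Cut 31728 (Ask 1 4 (Cut 27303 (Bound 384) (Ask 2 4 (Bound 394) (Cut 28962
  (Ask 1 2 (Bound 394) (Bound 0)) (Cut 30345 (Cut 29653 (Cut 29307 (Bound 407) (Bound 411))
  (Bound 417)) (Bound 0))))) (Cut 24537 (Grow 2 (Grow 5 Full (Bound 363)) (Bound 368)) (Cut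
  28132 (Cut 26334 (Cut 25435 (Cut 24986 (Cut 24761 (Bound 364) (Bound 366)) (Bound 368))
  (Bound 374)) (Bound 0)) (Bound 0)))) (Bound 432))) (Cut 25571 (Bound 369) (Cut 33652 (Ask 1 4
  (Cut 29611 (Bound 393) (Cut 31631 (Bound 427) (Bound 443))) (Cut 31378 (Ask 2 4 (Cut 28474
  (Bound 393) (Bound 414)) (Cut 28474 (Ask 1 3 (Bound 402) (Ask 2 3 (Bound 401) (Cut 27022 (Ask
  1 2 (Bound 397) (Grow 1 (Bound 463) (Bound 409))) (Cut 27748 (Cut 27385 (Bound 407) (Bound
  411)) (Bound 416))))) (Cut 29926 (Cut 29200 (Bound 418) (Bound 430)) (Bound 441)))) (Cut
  32515 (Cut 31946 (Bound 445) (Bound 454)) (Bound 462)))) (Bound 463)))))) (Bound 470)) (Cut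
  26056 (Bound 363) (Cut 34001 (Ask 1 4 (Cut 30028 (Bound 398) (Bound 427)) (Cut 26304 (Bound
  394) (Ask 1 5 (Cut 30152 (Bound 403) (Cut 32076 (Bound 436) (Cut 33038 (Bound 453) (Bound
  460)))) (Ask 1 6 (Cut 30152 (Bound 405) (Cut 32076 (Bound 437) (Bound 452))) (Grow 1 (Cut
  31114 (Ask 1 3 (Cut 28709 (Bound 399) (Cut 29911 (Bound 419) (Cut 30512 (Bound 429) (Bound
  434)))) (Bound 0)) (Cut 32557 (Cut 31835 (Bound 433) (Bound 451)) (Bound 468))) (Cut 30152
  (Cut 28228 (Bound 406) (Bound 419)) (Cut 32076 (Cut 31114 (Bound 436) (Bound 443)) (Cut 33038
  (Bound 451) (Bound 458))))))))) (Bound 462))))))) (Cut 27922 (Cut 25299 (Bound 372) (Cut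
  26610 (Bound 392) (Cut 27266 (Bound 402) (Cut 27594 (Bound 408) (Bound 410))))) (Cut 33975
  (Ask 1 3 (Cut 30948 (Bound 421) (Cut 32461 (Bound 445) (Bound 456))) (Ask 1 5 (Cut 30948
  (Bound 423) (Cut 32461 (Bound 448) (Bound 459))) (Ask 1 6 (Cut 30948 (Bound 423) (Cut 32461
  (Bound 448) (Bound 459))) (Grow 1 (Cut 30948 (Ask 1 4 (Bound 410) (Bound 0)) (Cut 32461 (Cut
  31704 (Cut 31326 (Bound 435) (Bound 438)) (Bound 447)) (Bound 465))) (Cut 30948 (Bound 418)
  (Cut 32461 (Bound 444) (Bound 455))))))) (Bound 462)))) (Cut 37795 (Bound 470) (Bound
  497))))).

Definition plan_5_6 : plan :=
  Cut 25312 (Bound 324) (Cut 33125 (Ask 1 3 (Cut 29218 (Bound 353) (Cut 31171 (Bound 392) (Cut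
  32148 (Bound 411) (Bound 421)))) (Ask 1 4 (Bound 353) (Grow 1 (Cut 30682 (Ask 1 5 (Bound 353)
  (Bound 353)) (Cut 31903 (Bound 406) (Bound 419))) Full))) (Cut 41562 (Cut 37343 (Cut 35234
  (Cut 34179 (Cut 33652 (Cut 33388 (Bound 431) (Bound 433)) (Bound 436)) (Bound 441)) (Bound
  452)) (Bound 473)) (Bound 515))).

Definition plan_5_7 : plan :=
  Cut 24375 (Cut 17187 (Bound 0) (Cut 20781 (Bound 0) (Cut 22578 (Bound 307) (Cut 23476 (Bound
  325) (Cut 23925 (Bound 334) (Bound 339)))))) (Cut 37500 (Ask 1 5 (Cut 30937 (Bound 343) (Cut
  34218 (Cut 32577 (Bound 409) (Bound 425)) (Cut 35859 (Bound 442) (Bound 458)))) (Ask 2 5 (Cut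
  30937 (Bound 343) (Cut 34218 (Cut 32577 (Bound 409) (Bound 425)) (Cut 35859 (Bound 442)
  (Bound 458)))) (Ask 3 5 (Cut 30937 (Bound 343) (Cut 34218 (Cut 32577 (Bound 409) (Bound 425))
  (Cut 35859 (Bound 442) (Bound 458)))) (Ask 4 5 (Cut 30937 (Bound 343) (Cut 34218 (Cut 32577
  (Bound 409) (Bound 425)) (Cut 35859 (Bound 442) (Bound 458)))) (Grow 5 (Cut 36474 (Grow 4
  (Ask 1 4 (Cut 30424 (Cut 27399 (Bound 343) (Cut 28911 (Bound 373) (Bound 389))) (Cut 36095
  (Grow 1 (Grow 2 (Grow 3 Full (Cut 33259 (Bound 417) (Bound 443))) (Cut 33259 (Bound 417)
  (Bound 443))) (Bound 415)) (Bound 460))) (Grow 1 (Grow 2 (Grow 3 Full (Cut 30424 (Cut 27399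
  (Bound 359) (Cut 28911 (Bound 387) (Cut 29667 (Bound 401) (Cut 30045 (Bound 409) (Bound
  412))))) (Cut 33449 (Cut 31936 (Bound 415) (Bound 429)) (Bound 452)))) (Cut 28533 (Cut 26454
  (Bound 360) (Cut 27493 (Bound 379) (Bound 388))) (Cut 30424 (Ask 1 2 (Bound 404) (Bound 0))
  (Cut 33449 (Cut 31936 (Cut 31180 (Bound 415) (Bound 422)) (Bound 429)) (Bound 452))))) (Cut
  28155 (Cut 26265 (Bound 360) (Cut 27210 (Bound 378) (Cut 27682 (Bound 387) (Bound 391))))
  (Cut 33449 (Ask 1 2 (Cut 30802 (Bound 399) (Cut 32125 (Bound 423) (Bound 435))) (Cut 28485
  (Bound 395) (Grow 1 (Cut 30656 (Ask 1 3 (Bound 402) (Bound 397)) (Cut 32052 (Cut 31354 (Bound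
  417) (Bound 424)) (Bound 430))) (Bound 406)))) (Cut 34961 (Cut 34205 (Cut 33827 (Bound 444)
  (Bound 447)) (Bound 450)) (Bound 459)))))) (Cut 30424 (Cut 27399 (Bound 359) (Cut 28911
  (Bound 387) (Bound 401))) (Cut 33449 (Cut 31936 (Cut 31180 (Bound 415) (Bound 422)) (Cut
  32692 (Bound 429) (Bound 436))) (Cut 34961 (Cut 34205 (Bound 443) (Bound 450)) (Bound
  457))))) (Bound 464)) (Cut 30937 (Cut 27656 (Bound 358) (Cut 29296 (Bound 389) (Bound 404)))
  (Cut 34218 (Cut 32577 (Cut 31757 (Bound 420) (Bound 427)) (Bound 435)) (Cut 35859 (Bound 450)
  (Bound 466))))))))) (Cut 43750 (Cut 40625 (Cut 39062 (Cut 38281 (Bound 475) (Bound 482))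
  (Bound 490)) (Bound 506)) (Bound 537))).

End Plans.

Definition plan6 d := nth Full [:: Full; plan_1_6; plan_2_6; plan_3_6; plan_4_6; plan_5_6] d.
Definition plan7 d := nth Full [:: Full; plan_1_7; plan_2_7; plan_3_7; plan_4_7; plan_5_7] d.

(** On six vertices the second smallest effective order is about [4.895], that of
    a triangle with a pendant path; hence the threshold [488 / 100]. *)
Lemma plan6_ok : all (fun d => check 6 true 488 d (plan6 d) (start_state d)
  unitZ (Z.of_nat d * unitZ)) [:: 1; 2; 3; 4; 5]%N.
Proof. by vm_cast_no_check (erefl true). Qed.

(** With at least seven vertices all graphs but the hinged ones have effective
    order at least [51 / 10]. *)
Lemma plan7_ok : all (fun d => check 7 false 510 d (plan7 d) (start_state d)
  unitZ (Z.of_nat d * unitZ)) [:: 1; 2; 3; 4; 5]%N.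
Proof. by vm_cast_no_check (erefl true). Qed.

Section StarBounds.
Variables (R : realType) (T : finType) (e : rel T).
Hypotheses (e_sym : symmetric e) (e_irr : irreflexive e).
Hypothesis e_conn : forall u w, connect e u w.
Variables (x : T -> R) (lam : R) (v : T).
Hypotheses (x_gt0 : forall u, 0 < x u) (x_le1 : forall u, x u <= 1).
Hypotheses (x_eig : eigenfun e x lam) (xv : x v = 1).

Lemma nbr_ge w : e v w -> 1 <= lam * x w.
Proof.
move=> vw; rewrite -x_eig (bigD1 v) ?xv ?lerDl ?[e w v]e_sym//=.
by apply: sumr_ge0 => u _; exact: ltW.
Qed.

Lemma eig_center : \sum_(w | e v w) x w = lam.
Proof. by rewrite x_eig xv mulr1. Qed.

Lemma big_star (F : T -> R) : \sum_w F w =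
  F v + \sum_(w | e v w) F w + \sum_(w | (w != v) && ~~ e v w) F w.
Proof.
rewrite (bigD1 v)//= -addrA (bigID (e v))/=; congr (_ + (_ + _)).
by apply: eq_bigl => w; have [->|] := eqVneq w v; rewrite ?e_irr.
Qed.

(** Each of the at least six neighbours lies between [lam^-1] and [1], so its
    square lies below the chord of the square over that interval. *)
Lemma large_star_bound : (6 <= #|[pred w | e v w]|)%N ->
  510 * \sum_u x u ^+ 2 <= 100 * (\sum_u x u) ^+ 2.
Proof.
move=> d6; set d : R := #|[pred w | e v w]|%:R.
have dE : d = \sum_(w | e v w) 1 by rewrite sumr_const.
have d_ge6 : 6 <= d by rewrite ler_nat.
have lam_gt0 : 0 < lam.
  have /card_gt0P[w vw] : (0 < #|[pred w | e v w]|)%N by exact: leq_trans d6.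
  by have := nbr_ge vw; rewrite -(pmulr_lgt0 _ (x_gt0 w)); apply: lt_le_trans.
have lam2 : d <= lam ^+ 2.
  rewrite expr2 -{2}eig_center mulr_sumr dE; apply: ler_sum => w; exact: nbr_ge.
have chord : lam * (\sum_(w | e v w) x w ^+ 2) <= (1 + lam) * lam - d.
  have -> : (1 + lam) * lam - d = \sum_(w | e v w) ((1 + lam) * x w - 1).
    by rewrite sumrB -mulr_sumr eig_center dE.
  rewrite mulr_sumr; apply: ler_sum => w vw.
  have := nbr_ge vw; have := x_le1 w; have := x_gt0 w; nra.
rewrite !big_star xv expr1n eig_center.
set r := \sum_(w | _ && _) x w.
have r_ge0 : 0 <= r by apply: sumr_ge0 => w _; exact: ltW.
have r2 : \sum_(w | (w != v) && ~~ e v w) x w ^+ 2 <= r.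
  by apply: ler_sum => w _; rewrite expr2 ler_piMr// ltW.
set q2 := \sum_(w | _ && _) x w ^+ 2 in r2 *.
set q1 := \sum_(w | e v w) x w ^+ 2 in chord *.
rewrite -(ler_pM2l lam_gt0).
have lam_ge : 12 / 5 <= lam.
  rewrite leNgt; apply/negP => lam_lt; have : lam ^+ 2 < 6; last by lra.
  by rewrite expr2; nra.
(* The polynomial is positive on the positive axis, with a minimum near [3]. *)
have cubic : 0 <= lam * (1 + lam) ^+ 2 * 100 - 510 * (lam ^+ 2 + lam *+ 2 - 6).
  have := sqr_ge0 (lam - 3); have : 0 <= (lam - 3) ^+ 2 * lam.
    by rewrite mulr_ge0 ?sqr_ge0// ltW.
  rewrite !expr2 mulr2n; nra.
have rest : 0 <= lam * r * (200 * (1 + lam) + 100 * r - 510).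
  have h : 0 <= 200 * (1 + lam) + 100 * r - 510 by lra.
  exact: mulr_ge0 (mulr_ge0 (ltW lam_gt0) r_ge0) h.
move: cubic rest; rewrite !expr2 mulr2n => cubic rest.
have := ler_wpM2l (ltW lam_gt0) r2; nra.
Qed.

Lemma search_bound n (exact_n : bool) (cn : Z) (P : nat -> plan) :
  (n <= #|T|)%N -> (exact_n -> #|T| = n) -> (1 < #|T|)%N -> (0 <= cn)%BZ ->
  all (fun d => check n exact_n cn d (P d) (start_state d)
    unitZ (Z.of_nat d * unitZ)) [:: 1; 2; 3; 4; 5]%N ->
  (#|[pred w | e v w]| <= 5)%N ->
  zr R cn * \sum_u x u ^+ 2 <= 100 * (\sum_u x u) ^+ 2 \/
  (lam <= 16 / 5 /\ exists a b c y, K4_hinge e v a b c y).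
Proof.
move=> n_le n_exact T1 cn0 /allP P_ok d_le5.
pose N := sort (fun a b => x b <= x a) (enum [pred w | e v w]).
have N_nbr : e v =i N by move=> w; rewrite mem_sort mem_enum.
have N_uniq : uniq N by rewrite sort_uniq enum_uniq.
have N_sorted : sorted (fun a b => x b <= x a) N.
  by apply: sort_sorted => a b; exact: le_total.
have sN : size N = #|[pred w | e v w]| by rewrite size_sort -cardE.
have d_gt0 : (0 < size N)%N.
  have [w wv] : exists w, w != v.
    by move: T1; rewrite (cardD1 v) => /card_gt0P[w]; rewrite !inE andbT; exists w.
  have /connectP[p] := e_conn v w; case: p => [_ wE|u p /= /andP[vu _] _].
    by rewrite wE eqxx in wv.
  have : u \in N by rewrite -N_nbr.
  by case: (N).
have d15 : size N \in [:: 1; 2; 3; 4; 5]%N.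
  by rewrite -sN in d_le5; move: d_gt0 d_le5; case: (size N) => [|[|[|[|[|[|]]]]]].
have lam_ge1 : 1 <= lam.
  have [w vw] : exists w, e v w.
    case E : N d_gt0 => [//|w N'] _; exists w.
    by have := N_nbr w; rewrite E mem_head.
  have lam_gt0 : 0 < lam.
    by have := nbr_ge vw; rewrite -(pmulr_lgt0 _ (x_gt0 w)); apply: lt_le_trans.
  by apply: le_trans (nbr_ge vw) _; rewrite ler_piMr// ltW.
have lam_le : lam <= (size N)%:R.
  rewrite sN -eig_center -sumr_const; apply: ler_sum => w _; exact: x_le1.
apply: (check_sound e_sym e_irr e_conn x_gt0 x_le1 x_eig xv N_uniq N_nbr N_sorted
  n_le n_exact cn0 (realizes_start e_irr N_uniq N_nbr) _ (P_ok _ d15)).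
have K0 := @unit_gt0 R; rewrite ler_peMr ?(ltW K0)//=.
by rewrite zrM zr_nat mulrC ler_wpM2r ?(ltW K0).
Qed.

End StarBounds.

(** * Constants of the ray *)

Section RayConstants.
Variable R : realType.

Definition rt3 : R := Num.sqrt 3.
(** Along the ray the eigenvector decays by the factor [ray_ratio]; the triangle,
    the attaching vertex and the path give [lam = 2 + 3 t] and [lam = t + t^-1],
    whence [2 t ^+ 2 + 2 t = 1]. *)
Definition ray_eig : R := (1 + 3 * rt3) / 2.
Definition ray_ratio : R := (rt3 - 1) / 2.
Definition ray_order : R := (5 + 3 * rt3) / 2.

Lemma rt3_sq : rt3 * rt3 = 3.
Proof. by rewrite -expr2 sqr_sqrtr. Qed.

Lemma rt3_bounds : 1732 / 1000 < rt3 < 1733 / 1000.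
Proof.
have s0 : 0 <= rt3 by exact: sqrtr_ge0.
have s2 := rt3_sq; apply/andP; split; rewrite ltNge; apply/negP => h; nra.
Qed.

(** The summand [2 m z - c z ^+ 2] of the linearization of [S ^+ 2 - c Q], with
    [c = ray_order] and [m = 3 + rt3], the sum of the eigenvector of the ray when
    its entries on the triangle are [1]. *)
Definition phi (z : R) := (6 + 2 * rt3) * z - ray_order * z ^+ 2.
(** The sum of [phi (z * t ^+ j)] over [j > 0], for [t = ray_ratio]. *)
Definition geom (z : R) := (2 + 2 * rt3) * z - (rt3 + 3) / 6 * z ^+ 2.

Lemma phi_ge0 z : 0 <= z -> z <= 6 / 5 -> 0 <= phi z.
Proof.
move=> z0 z1; rewrite /phi /ray_order expr2; have /andP[s1 s2] := rt3_bounds.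
have : 0 <= (6 / 5 - z) * rt3 by rewrite mulr_ge0; lra.
nra.
Qed.

(** [phi + geom] is a concave parabola that increases up to [6 / 5], and at
    [ray_ratio * z] it takes the value [geom z]. *)
Lemma geom_step z u : 0 <= z -> ray_ratio * z <= u -> u <= 6 / 5 ->
  geom z <= phi u + geom u.
Proof.
rewrite /ray_ratio => z0 zu u1; have s2 := rt3_sq; have /andP[sl su] := rt3_bounds.
have E : phi u + geom u - geom z =
    (u - (rt3 - 1) / 2 * z) * ((8 + 4 * rt3) - (9 + 5 * rt3) / 3 * (u + (rt3 - 1) / 2 * z)).
  by rewrite /phi /geom /ray_order; field: s2.
rewrite -subr_ge0 E mulr_ge0 ?subr_ge0//.
have : (9 + 5 * rt3) / 3 * (u + (rt3 - 1) / 2 * z) <= (9 + 5 * rt3) / 3 * (12 / 5).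
  by rewrite ler_wpM2l//; lra.
lra.
Qed.

(** Two branches of weight at least [z / lam] each are worth more than the whole
    geometric continuation of [z], because [2 / lam] exceeds [t / (1 - t)]. *)
Lemma geom_fork lam z u w : 3 <= lam -> lam <= 16 / 5 -> 0 <= z -> z <= 6 / 5 ->
  z <= lam * u -> u <= 6 / 5 -> z <= lam * w -> w <= 6 / 5 ->
  geom z <= phi u + phi w.
Proof.
move=> l3 l32 z0 z1.
have half y : z <= lam * y -> y <= 6 / 5 -> geom z <= phi y *+ 2.
  move=> zy y1; have s2 := rt3_sq; have /andP[sl su] := rt3_bounds.
  (* [phi] takes a larger value at [y] than at its lower bound [y0]: on the far
     side of the vertex of the parabola [y] is still closer to it than [y0]. *)
  pose y0 := z * (5 / 16).
  have y0y : y0 <= y by rewrite /y0; nra.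
  have y00 : 0 <= y0 by rewrite /y0 mulr_ge0.
  have y01 : y0 <= 3 / 8 by rewrite /y0; lra.
  have E : phi y - phi y0 = (y - y0) * (6 + 2 * rt3 - (5 + 3 * rt3) / 2 * (y + y0)).
    by rewrite /phi /ray_order; ring.
  have : 0 <= phi y - phi y0.
    rewrite E mulr_ge0 ?subr_ge0//.
    have : (5 + 3 * rt3) / 2 * (y + y0) <= (5 + 3 * rt3) / 2 * (63 / 40).
      by rewrite ler_wpM2l//; lra.
    lra.
  have : geom z <= phi y0 *+ 2; last by lra.
  rewrite /geom /phi /ray_order /y0 mulr2n -subr_ge0.
  have -> : (6 + 2 * rt3) * (z * (5 / 16)) - (5 + 3 * rt3) / 2 * (z * (5 / 16)) ^+ 2 +
    ((6 + 2 * rt3) * (z * (5 / 16)) - (5 + 3 * rt3) / 2 * (z * (5 / 16)) ^+ 2) -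
    ((2 + 2 * rt3) * z - (rt3 + 3) / 6 * z ^+ 2) =
    z * ((7 - 3 * rt3) / 4 + ((rt3 + 3) / 6 - (5 + 3 * rt3) * 25 / 256) * z) by field.
  rewrite mulr_ge0//; nra.
by move=> zu u1 zw w1; have := half u zu u1; have := half w zw w1; lra.
Qed.

(** The bound is attained by the ray itself, where [z = 3 * ray_ratio]. *)
Lemma ray_final z : 3 * ray_ratio <= z -> z <= 6 / 5 ->
  (3 + rt3) ^+ 2 <= phi 1 *+ 3 + phi z + geom z.
Proof.
rewrite /ray_ratio => zl zu; have s2 := rt3_sq; have /andP[sl su] := rt3_bounds.
have E : phi 1 *+ 3 + phi z + geom z - (3 + rt3) ^+ 2 =
    (z - (rt3 - 1) / 2 * 3) *
    ((8 + 4 * rt3) - (9 + 5 * rt3) / 3 * (z + (rt3 - 1) / 2 * 3)).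
  by rewrite /phi /geom /ray_order; field: s2.
rewrite -subr_ge0 E mulr_ge0 ?subr_ge0//; first lra.
have : (9 + 5 * rt3) / 3 * (z + (rt3 - 1) / 2 * 3) <= (9 + 5 * rt3) / 3 * (12 / 5).
  by rewrite ler_wpM2l//; lra.
lra.
Qed.

Lemma ray_ratio_defect lam v y : v = lam - 2 -> lam * v = 3 + y ->
  y - ray_ratio * v = (lam - ray_eig) * (lam - 1 + rt3).
Proof.
move=> -> yE; have s2 := rt3_sq; have -> : y = lam * (lam - 2) - 3 by lra.
by rewrite /ray_eig /ray_ratio; field: s2.
Qed.

End RayConstants.

(** * Hinged graphs *)

(** The sequence [s] continues a path from [z]: consecutive vertices are
    adjacent and there are no other adjacencies. *)
Fixpoint tail_path (T : eqType) (e : rel T) (z : T) (s : seq T) : bool :=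
  if s is z' :: s' then [&& e z z', all (fun u => ~~ e z u) s' & tail_path e z' s']
  else true.

Section Dichotomy.
Variables (R : realType) (T : finType) (e : rel T).
Hypotheses (e_sym : symmetric e) (e_irr : irreflexive e).
Hypothesis e_conn : forall u w, connect e u w.
Variables (x : T -> R) (lam : R).
Hypotheses (x_gt0 : forall u, 0 < x u) (x_eig : eigenfun e x lam).

Local Notation s3 := (rt3 R).
Local Notation t := (ray_ratio R).
Local Notation mu := (ray_eig R).

Section Tail.
Hypotheses (x_le : forall u, x u <= 6 / 5) (lam3 : 3 <= lam) (lam_le : lam <= 16 / 5).

(** The ratio of consecutive entries along a path has [ray_ratio] as a repelling
    fixed point when [lam = ray_eig]; being above or below it persists. *)
Lemma ratio_lt (a b : R) : lam < mu -> 0 < b -> b < t * a -> lam * b - a < t * b.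
Proof.
rewrite /ray_ratio /ray_eig => lm b0 ba; have s2 := rt3_sq R; have /andP[sl su] := rt3_bounds R.
have ab : (1 + s3) * b < a.
  have : (1 + s3) * b < (1 + s3) * ((s3 - 1) / 2 * a) by rewrite ltr_pM2l//; lra.
  by have -> : (1 + s3) * ((s3 - 1) / 2 * a) = a by field: s2.
have : lam * b <= (1 + 3 * s3) / 2 * b by rewrite ler_pM2r// ltW.
lra.
Qed.

Lemma ratio_ge (a b : R) : mu <= lam -> 0 < b -> t * a <= b -> t * b <= lam * b - a.
Proof.
rewrite /ray_ratio /ray_eig => lm b0 ba; have s2 := rt3_sq R; have /andP[sl su] := rt3_bounds R.
have ab : a <= (1 + s3) * b.
  have : (1 + s3) * ((s3 - 1) / 2 * a) <= (1 + s3) * b by rewrite ler_pM2l//; lra.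
  by have -> : (1 + s3) * ((s3 - 1) / 2 * a) = a by field: s2.
have : (1 + 3 * s3) / 2 * b <= lam * b by rewrite ler_pM2r.
lra.
Qed.

(** Walk along the path that starts with the edge from [p] to [z], where [W] is
    what has been left behind. Either the walk ends and the graph beyond [z] is a
    path, or it reaches a fork. A fork makes the sum over the next vertices too
    large for an eigenvalue below [ray_eig]; and then the entries beyond [z] are
    worth at least as much as those of the ray, which is proved backwards from the
    fork by [geom_fork] and [geom_step]. *)
Lemma tail_dichotomy k (W : {set T}) p z : (#|~: W| <= k)%N ->
  p \in W -> z \in W -> e p z ->
  (forall w, w \in W -> w != z -> forall u, e w u -> u \in W) ->
  (forall u, u \in W -> e z u -> u = p) ->
  (lam < mu /\ x z < t * x p) \/ (mu <= lam /\ t * x p <= x z) ->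
  (exists s, [/\ uniq s, s =i ~: W & tail_path e z s]) \/
  (mu <= lam /\ geom (x z) <= \sum_(w | w \notin W) phi (x w)).
Proof.
elim: k W p z => [|k IHk] W p z Wk pW zW pz W_closed z_back ratio.
  have W_all u : u \in W.
    move: Wk; rewrite leqn0 cards_eq0 => /eqP W0.
    apply: contraT => uW; have : u \in ~: W by rewrite inE.
    by rewrite W0 inE.
  by left; exists [::]; split=> // u; rewrite finset.in_setC W_all.
pose A := [set u | e z u] :\: W.
have sum_z : lam * x z = x p + \sum_(u in A) x u.
  rewrite -x_eig (bigID (mem W))/=; congr (_ + _); last first.
    by apply: eq_bigl => u; rewrite !inE andbC.
  rewrite (big_pred1 p)// => u; apply/andP/eqP => [[zu uW]|->]; first exact: z_back.
  by rewrite e_sym.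
have [A0|] := finset.set_0Vmem A.
  left; exists [::]; split=> // u; rewrite finset.in_setC.
  suff -> : u \in W by [].
  have /connectP[l + ->] := e_conn z u; move: zW.
  elim: l {1 2 3}z => [|w l IHl] z' z'W //= /andP[z'w]; apply: IHl.
  have [z'z|] := eqVneq z' z; last by move=> /(W_closed _ z'W); apply.
  apply: contraT => wW; have : w \in A by rewrite !inE wW -z'z z'w.
  by rewrite A0 inE.
case=> w wA; have /andP[wW zw] : (w \notin W) && e z w by move: wA; rewrite !inE.
have [A1|A2] := eqVneq A [set w].
  have xw : x w = lam * x z - x p by rewrite sum_z A1 big_set1 addrC addKr.
  have [|||||u uW' wu||[s [s_uniq sE s_path]]|[mul IH]] := IHk (w |: W) z w.
  - rewrite finset.setCU; move: Wk; rewrite (cardsD1 w (~: W)) inE wW => Wk.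
    apply: leq_trans (subset_leq_card _) Wk.
    by apply/fintype.subsetP => u; rewrite !inE.
  - by rewrite !inE zW orbT.
  - by rewrite !inE eqxx.
  - by [].
  - move=> u; rewrite !inE => /orP[/eqP ->|uW uw u' uu']; first by rewrite eqxx.
    have [uz|uz] := eqVneq u z; last by rewrite !inE (W_closed u uW uz _ uu') orbT.
    have [u'W|u'W] := boolP (u' \in W); first by rewrite !inE u'W orbT.
    have : u' \in A by rewrite !inE u'W -uz.
    by rewrite A1 !inE => ->.
  - move: uW'; rewrite !inE => /predU1P[uw|uW]; first by rewrite uw e_irr in wu.
    apply/eqP; apply: contraT => uz; have := W_closed u uW uz w.
    by rewrite e_sym => /(_ wu); rewrite (negbTE wW).
  - case: ratio => -[h1 h2]; [left|right]; split=> //; rewrite xw.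
      exact: ratio_lt.
    exact: ratio_ge.
  - left; exists (w :: s); split=> /=.
    + by rewrite s_uniq sE !inE eqxx.
    + by move=> u; rewrite !inE sE !inE negb_or; case: eqVneq => // ->; rewrite wW.
    + rewrite zw s_path andbT /=; apply/allP => u; rewrite sE !inE negb_or => /andP[uw uW].
      apply: contra uw => zu; have : u \in A by rewrite !inE uW.
      by rewrite A1 inE.
  - right; split=> //.
    rewrite (bigD1 w)//=; apply: (@le_trans _ _ (phi (x w) + geom (x w))).
      apply: geom_step => //; first exact: ltW.
      case: ratio => -[h1 h2]; first by lra.
      by rewrite xw; exact: ratio_ge.
    rewrite lerD2l; apply: le_trans IH _; rewrite le_eqVlt; apply/orP; left; apply/eqP.
    by apply: eq_bigl => u; rewrite !inE negb_or andbC.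
have [w' w'A w'w] : exists2 w', w' \in A & w' != w.
  apply/exists_inP; apply: contraNT A2; rewrite negb_exists => /forallP A1.
  apply/eqP/finset.setP => u; rewrite inE; apply/idP/eqP => [uA|->//].
  by have := A1 u; rewrite uA negbK => /eqP.
have /andP[w'W zw'] : (w' \notin W) && e z w' by move: w'A; rewrite !inE.
have nbr u : e z u -> x z <= lam * x u.
  move=> zu; rewrite -x_eig (bigD1 z) 1?e_sym//= lerDl.
  by apply: sumr_ge0 => ? _; exact: ltW.
have := nbr w zw; have := nbr w' zw' => nw' nw.
have fork : x p + x w + x w' <= lam * x z.
  rewrite sum_z (bigD1 w)//= (bigD1 w')/=; last by rewrite w'A.
  by rewrite -!addrA !lerD2l lerDl; apply: sumr_ge0 => ? _; exact: ltW.
have xz := x_gt0 z; right; case: ratio => -[h1 h2].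
  exfalso; have := ratio_lt h1 xz h2; move: h2.
  have /andP[sl su] := rt3_bounds R; rewrite /ray_ratio => h2 h3.
  have : (s3 - 1) / 2 * x z <= 2 / 5 * x z by rewrite ler_pM2r//; lra.
  have : lam * (x w + x w') <= 16 / 5 * (x w + x w').
    by rewrite ler_wpM2r// addr_ge0// ltW.
  by move: (x w) (x w') nw nw' fork h3 => a b; lra.
split=> //; rewrite (bigD1 w)//= (bigD1 w')/=; last by rewrite w'W.
rewrite addrA; apply: (@le_trans _ _ (phi (x w) + phi (x w'))).
  by apply: (@geom_fork _ lam) => //; exact: ltW.
by rewrite lerDl; apply: sumr_ge0 => u _; rewrite phi_ge0// ltW.
Qed.
End Tail.

Variables (v a b c y : T).
Hypothesis hinge : K4_hinge e v a b c y.

Lemma hinge_eig : [/\ x b = x a, x c = x a, x v = (lam - 2) * x a &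
  lam * x v = 3 * x a + x y].
Proof.
case: hinge => vabcy Nv Na Nb Nc.
have sub m : uniq (mask m [:: v; a; b; c; y]).
  exact: (subseq_uniq (mask_subseq _ _) vabcy).
have := sum_nbr_seq x_eig (sub [:: false; true; true; true; true]) Nv.
have := sum_nbr_seq x_eig (sub [:: true; false; true; true; false]) Na.
have := sum_nbr_seq x_eig (sub [:: true; true; false; true; false]) Nb.
have := sum_nbr_seq x_eig (sub [:: true; true; true; false; false]) Nc.
rewrite !big_cons !big_nil /= => hc hb ha hv.
have xa := x_gt0 a; have xb := x_gt0 b; have xc := x_gt0 c; have xv := x_gt0 v.
have lam0 : 0 < lam.
  by rewrite -(pmulr_lgt0 _ xa) -ha; lra.
have ab : x b = x a.
  have : (lam + 1) * (x b - x a) = 0 by lra.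
  by move/eqP; rewrite mulf_eq0 (gt_eqF (_ : 0 < lam + 1)) ?subr_eq0 => [/eqP|]; lra.
have ac : x c = x a.
  have : (lam + 1) * (x c - x a) = 0 by lra.
  by move/eqP; rewrite mulf_eq0 (gt_eqF (_ : 0 < lam + 1)) ?subr_eq0 => [/eqP|]; lra.
by split=> //; [lra | rewrite -hv ab ac; lra].
Qed.

End Dichotomy.

Section HingeDichotomy.
Variables (R : realType) (T : finType) (e : rel T).
Hypotheses (e_sym : symmetric e) (e_irr : irreflexive e).
Hypothesis e_conn : forall u w, connect e u w.
Variables (x : T -> R) (lam : R).
Hypotheses (x_gt0 : forall u, 0 < x u) (x_eig : eigenfun e x lam).
Variables (v a b c y : T).
Hypothesis hinge : K4_hinge e v a b c y.

Local Notation K4y := [set u in [:: v; a; b; c; y]].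

(** Scale the vector to be [1] on the triangle. The value [3 + rt3] in the
    linearization is the sum of the eigenvector of the ray. *)
Lemma hinge_dichotomy : lam <= 16 / 5 -> (forall u, x u <= x v) ->
  (exists s, [/\ uniq s, s =i ~: K4y & tail_path e y s]) \/
  ray_order R * (\sum_u x u ^+ 2) <= (\sum_u x u) ^+ 2.
Proof.
move=> lam_le xv_max; have xa := x_gt0 a.
pose z u := x u / x a.
have z_gt0 u : 0 < z u by rewrite divr_gt0.
have z_eig : eigenfun e z lam by move=> u; rewrite -mulr_suml x_eig mulrA.
have [zb zc zv zy] := hinge_eig z_gt0 z_eig hinge.
have za : z a = 1 by rewrite /z divff// gt_eqF.
rewrite za !mulr1 in zb zc zv zy.
have zy0 := z_gt0 y; have zv0 := z_gt0 v.
have lam3 : 3 <= lam.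
  rewrite leNgt; apply/negP => lam_lt; have : (lam + 1) * (lam - 3) < 0.
    by rewrite nmulr_llt0; lra.
  by rewrite zv in zy; lra.
have z_le u : z u <= 6 / 5.
  apply: (@le_trans _ _ (z v)); last by rewrite zv; lra.
  by rewrite ler_pM2r ?invr_gt0.
case: (hinge) => vabcy Nv Na Nb Nc.
have NvE u : e v u = (u \in [:: a; b; c; y]) by rewrite -Nv.
have NaE u : e a u = (u \in [:: v; b; c]) by rewrite -Na.
have NbE u : e b u = (u \in [:: v; a; c]) by rewrite -Nb.
have NcE u : e c u = (u \in [:: v; a; b]) by rewrite -Nc.
have vy : e v y by rewrite NvE !inE eqxx !orbT.
have ratio : (lam < ray_eig R /\ z y < ray_ratio R * z v) \/
    (ray_eig R <= lam /\ ray_ratio R * z v <= z y).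
  have /andP[sl su] := rt3_bounds R; have E := ray_ratio_defect zv zy.
  have lam_pos : 0 < lam - 1 + rt3 R by lra.
  case: (ltP lam (ray_eig R)) => lm; [left|right]; split=> //.
    by rewrite -subr_lt0 E nmulr_rlt0// subr_lt0.
  by rewrite -subr_ge0 E mulr_ge0 ?subr_ge0// ltW.
have [||w|u||[mul tail]] := @tail_dichotomy R T e e_sym e_irr e_conn z lam z_gt0 z_eig
  z_le lam3 lam_le _ K4y v y (leqnn _) _ _ vy _ _ ratio.
- by rewrite !inE eqxx.
- by rewrite !inE eqxx !orbT.
- rewrite !inE => /or4P[/eqP -> _ u|/eqP -> _ u|/eqP -> _ u|].
  + by rewrite NvE !inE => ->; rewrite orbT.
  + by rewrite NaE !inE => /or3P[] ->; rewrite ?orbT.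
  + by rewrite NbE !inE => /or3P[] ->; rewrite ?orbT.
  + case/orP => [/eqP -> _ u|->//].
    by rewrite NcE !inE => /or3P[] ->; rewrite ?orbT.
- move: vabcy; rewrite -[_ :: _]/([:: v; a; b; c] ++ [:: y]) cat_uniq /= !inE !negb_or.
  rewrite !andbT !(eq_sym _ y) => /and5P[_ yv ya yb yc].
  case/or4P => [/eqP ->//|/eqP ->|/eqP ->|/orP[] /eqP ->].
  + by rewrite e_sym NaE !inE (negbTE yv) (negbTE yb) (negbTE yc).
  + by rewrite e_sym NbE !inE (negbTE yv) (negbTE ya) (negbTE yc).
  + by rewrite e_sym NcE !inE (negbTE yv) (negbTE ya) (negbTE yb).
  + by rewrite e_irr.
- by left.
right.
have := sqr_ge0 (\sum_u z u - (3 + rt3 R)).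
have total : (3 + rt3 R) ^+ 2 <= \sum_u phi (z u).
  apply: (le_trans (ray_final (_ : _ <= z v) (z_le v))).
    rewrite zv; move: mul; rewrite /ray_eig /ray_ratio; have := rt3_sq R; lra.
  rewrite [leRHS](bigID (mem K4y))/=.
  rewrite (eq_bigl (mem [:: v; a; b; c; y])); last by move=> u; rewrite !inE.
  rewrite -big_uniq// !big_cons big_nil zb zc za.
  have : geom (z v) <= phi (z y) + geom (z y).
    apply: geom_step; rewrite ?z_le ?(ltW zv0)//.
    by case: ratio => -[h1 h2]//; lra.
  by rewrite /=; lra.
have sum_phi : \sum_u phi (z u) =
    (6 + 2 * rt3 R) * (\sum_u z u) - ray_order R * \sum_u z u ^+ 2.
  by rewrite !mulr_sumr -sumrB; apply: eq_bigr.
move: total; rewrite sum_phi.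
have -> : \sum_u z u = (\sum_u x u) / x a by rewrite mulr_suml.
have -> : \sum_u z u ^+ 2 = (\sum_u x u ^+ 2) / x a ^+ 2.
  by rewrite mulr_suml; apply: eq_bigr => u _; rewrite expr_div_n.
move=> h1 h2; rewrite -(ler_pM2r (_ : 0 < (x a ^+ 2)^-1)) ?invr_gt0 ?exprn_gt0//.
rewrite -mulrA -exprVn -exprMn exprVn.
move: h1 h2; set S := _ / x a; set Q := _ / x a ^+ 2; rewrite !expr2; nra.
Qed.
End HingeDichotomy.

Lemma tail_path_nth (T : eqType) (e : rel T) (z0 z : T) s i j :
  symmetric e -> irreflexive e -> tail_path e z s ->
  (i <= size s)%N -> (j <= size s)%N ->
  e (nth z0 (z :: s) i) (nth z0 (z :: s) j) = (i.+1 == j) || (j.+1 == i).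
Proof.
move=> e_sym e_irr; elim: s z i j => [|z' s IHs] z i j.
  by move=> _; case: i => // _; case: j => //= _; rewrite e_irr.
move=> /= /and3P[zz' /allP z_s s_path].
have zE m : (m <= size s)%N -> e z (nth z0 (z' :: s) m) = (m == 0%N).
  by case: m => [|m] // m_lt; apply/negbTE/z_s; exact: mem_nth.
case: i j => [|i] [|j] i_le j_le; rewrite ?eqSS.
- by rewrite e_irr.
- by rewrite /= -/(nth z0 (z' :: s) j) zE// orbF eq_sym.
- by rewrite e_sym /= -/(nth z0 (z' :: s) i) zE// eq_sym.
- exact: IHs.
Qed.

(** List the vertices as the [K_4] followed by the path; the position in this list
    is the isomorphism. *)
Lemma hinge_iso (T : finType) (e : rel T) v a b c y s :
  symmetric e -> irreflexive e -> K4_hinge e v a b c y ->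
  uniq s -> s =i ~: [set u in [:: v; a; b; c; y]] -> tail_path e y s ->
  graph_iso e (K4_path (#|T| - 4)).
Proof.
move=> e_sym e_irr [vabcy Nv Na Nb Nc] s_uniq sE s_path.
have NvE u : e v u = (u \in [:: a; b; c; y]) by rewrite -Nv.
have NaE u : e a u = (u \in [:: v; b; c]) by rewrite -Na.
have NbE u : e b u = (u \in [:: v; a; c]) by rewrite -Nb.
have NcE u : e c u = (u \in [:: v; a; b]) by rewrite -Nc.
pose full := [:: v; a; b; c] ++ y :: s.
have fullE : full = [:: v; a; b; c; y] ++ s by [].
have full_uniq : uniq full.
  rewrite fullE cat_uniq vabcy s_uniq andbT; apply/hasPn => u.
  by rewrite sE finset.in_setC finset.in_set.
have full_all u : u \in full.
  by rewrite fullE mem_cat sE finset.in_setC finset.in_set orbN.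
have full_size : size full = #|T|.
  by rewrite -(card_uniqP full_uniq); apply: eq_card => u; rewrite full_all.
have sizeT : #|T| = (4 + (size s).+1)%N by rewrite -full_size.
rewrite sizeT addKn; set k := (size s).+1.
pose pos (w : 'I_4 + 'I_k) : nat := match w with inl i => i | inr j => (4 + j)%N end.
have pos_lt w : (pos w < size full)%N.
  rewrite full_size sizeT; case: w => [i|j] /=; last by rewrite ltn_add2l.
  by apply: leq_trans (ltn_ord i) _; rewrite leq_addr.
pose g w := nth v full (pos w).
have g_inj : injective g.
  move=> w w' /eqP; rewrite nth_uniq// => /eqP.
  case: w w' => [i|j] [i'|j'] /=.
  - by move=> ii'; congr inl; exact: val_inj.
  - by move=> ij; have := ltn_ord i; rewrite ij ltnNge leq_addr.
  - by move=> ij; have := ltn_ord i'; rewrite -ij ltnNge leq_addr.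
  - by move=> /addnI jj'; congr inr; exact: val_inj.
have [|h gK hK] := inj_card_bij g_inj; first by rewrite card_sum !card_ord sizeT.
have gl i : g (inl i) = nth v [:: v; a; b; c] i.
  by rewrite /g /= nth_cat ltn_ord.
have gr j : g (inr j) = nth v (y :: s) j.
  by rewrite /g -[pos _]/(4 + j)%N nth_cat ltnNge leq_addr /= addKn.
have tail_notin m : (m < k)%N -> [/\ nth v (y :: s) m != v, nth v (y :: s) m != a,
    nth v (y :: s) m != b & nth v (y :: s) m != c].
  move=> mk; have : nth v (y :: s) m \in y :: s by exact: mem_nth.
  move: full_uniq; rewrite /full cat_uniq => /and3P[_ /hasPn disj _] /disj.
  by rewrite /= !inE !negb_or => /and4P[].
have cross (i : 'I_4) (j : 'I_k) :
    e (nth v [:: v; a; b; c] i) (nth v (y :: s) j) = (i == ord0) && (j == 0%N :> nat).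
  have [jv ja jb jc] := tail_notin j (ltn_ord j).
  case: i => [[|[|[|[|]]]] //= i4]; rewrite -?val_eqE.
  - rewrite NvE !inE (negbTE ja) (negbTE jb) (negbTE jc) /=.
    have -> : y = nth v (y :: s) 0 by [].
    rewrite nth_uniq ?ltn_ord//.
    by move: full_uniq; rewrite /full cat_uniq => /and3P[].
  - by rewrite NaE !inE (negbTE jv) (negbTE jb) (negbTE jc).
  - by rewrite NbE !inE (negbTE jv) (negbTE ja) (negbTE jc).
  - by rewrite NcE !inE (negbTE jv) (negbTE ja) (negbTE jb).
exists h; first by exists g.
move=> u w; rewrite -{2}(hK u) -{2}(hK w).
case: (h u) (h w) => [i|j] [i'|j'] /=.
- rewrite !gl; move: i i'.
  have vv := e_irr v; have aa := e_irr a; have bb := e_irr b; have cc := e_irr c.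
  by do 2![case=> [[|[|[|[|]]]] //= ?]]; rewrite -?val_eqE /= ?vv ?aa ?bb ?cc//
    ?NvE ?NaE ?NbE ?NcE !inE ?eqxx ?orbT.
- by rewrite gl gr cross.
- by rewrite gl gr e_sym cross.
- by rewrite !gr tail_path_nth// -ltnS.
Qed.

Lemma K4_path_connected k : connected_graph (k + 4) (K4_path k).
Proof.
have sym : symmetric (K4_path k).
  by case=> [i|j] [i'|j'] //=; [rewrite eq_sym | rewrite orbC].
split=> //.
- by rewrite card_sum !card_ord addnC.
- by case=> [i|j] /=; rewrite ?eqxx// orbb; apply/negbTE; rewrite neq_ltn ltnSn orbT.
have to0 u : connect (K4_path k) (inl ord0) u.
  case: u => [i|[j jk]].
    have [->|i0] := eqVneq i ord0; first exact: connect0.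
    by apply: connect1; rewrite /= eq_sym.
  elim: j jk => [|j IHj] jk; first by apply: connect1.
  apply: connect_trans (IHj (ltnW jk)) _; apply: connect1.
  by rewrite /= eqxx.
by move=> u w; apply: connect_trans (to0 w); rewrite (sym_connect_sym sym).
Qed.

(** * The effective order of a path attached to K_4 *)

Section PathOrder.
Variables (R : realType) (k : nat).
Hypothesis k_gt0 : (0 < k)%N.
Local Notation e := (K4_path k).
Local Notation s3 := (rt3 R).
Local Notation t := (ray_ratio R).
Local Notation tri i := (inl (inord i) : 'I_4 + 'I_k).

Lemma K4_path_hinge : K4_hinge e (tri 0) (tri 1) (tri 2) (tri 3) (inr (Ordinal k_gt0)).
Proof.
have tE i : (i < 4)%N -> forall m : 'I_4, (m == inord i) = (m == i :> nat).
  by move=> i4 m; rewrite -val_eqE /= inordK.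
split; first by rewrite /= !inE -![inl _ == inl _]/(_ == _ :> 'I_4) !tE// !inordK.
- case=> [m|j]; rewrite !inE /in_mem /= -?[inl _ == inl _]/(_ == _ :> 'I_4) ?tE// ?inordK//.
    by rewrite eq_sym tE//; case: m => [[|[|[|[|]]]]].
  by rewrite -val_eqE /= inordK.
- case=> [m|j]; rewrite !inE /in_mem /= -?[inl _ == inl _]/(_ == _ :> 'I_4) ?tE// ?inordK//.
    by rewrite eq_sym tE//; case: m => [[|[|[|[|]]]]].
  by rewrite -val_eqE /= inordK.
- case=> [m|j]; rewrite !inE /in_mem /= -?[inl _ == inl _]/(_ == _ :> 'I_4) ?tE// ?inordK//.
    by rewrite eq_sym tE//; case: m => [[|[|[|[|]]]]].
  by rewrite -val_eqE /= inordK.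
- case=> [m|j]; rewrite !inE /in_mem /= -?[inl _ == inl _]/(_ == _ :> 'I_4) ?tE// ?inordK//.
    by rewrite eq_sym tE//; case: m => [[|[|[|[|]]]]].
  by rewrite -val_eqE /= inordK.
Qed.

Variables (x : 'I_4 + 'I_k -> R) (lam : R).
Hypotheses (x_gt0 : forall u, 0 < x u) (x_eig : eigenfun e x lam).
Hypothesis x_tri : x (tri 1) = 1.

(** The entries read along the path, starting at its attaching vertex in [K_4]
    and continued by zero beyond its end. *)
Definition along (i : nat) : R :=
  if i is j.+1 then oapp (fun j' => x (inr j')) 0 (insub j) else x (tri 0).

Arguments along : simpl never.

Lemma alongS (j : 'I_k) : along j.+1 = x (inr j).
Proof. by rewrite /along valK. Qed.

Lemma along_out i : (k <= i)%N -> along i.+1 = 0.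
Proof. by move=> ki; rewrite /along insubN// -leqNgt. Qed.

Lemma along_gt0 i : (i <= k)%N -> 0 < along i.
Proof. by case: i => [|i] ik; [exact: x_gt0 | rewrite (alongS (Ordinal ik))]. Qed.

Lemma along_pick m : \sum_(i < k | i == m :> nat) along i.+1 = along m.+1.
Proof.
rewrite (big_ord1_eq _ (fun i => along i.+1)); case: ltnP => // km.
by rewrite along_out.
Qed.

Lemma along_rec j : (j < k)%N -> lam * along j.+1 = along j + along j.+2.
Proof.
move=> jk; rewrite -[j.+1]/((Ordinal jk : nat).+1) alongS -x_eig big_sumType/=.
rewrite -(along_pick j.+1).
under [X in _ + X = _]eq_bigr do rewrite -alongS.
rewrite (bigID (fun i : 'I_k => i == j.+1 :> nat))/=.
rewrite (eq_bigl (fun i : 'I_k => i == j.+1 :> nat)); last first.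
  by move=> [i ?] /=; lia.
rewrite addrCA [RHS]addrC; congr (_ + _).
case: j jk => [|j] jk.
  rewrite (big_pred1 (inord 0)) => [|m]; last first.
    by rewrite andbT; congr (_ == _); apply: val_inj; rewrite /= inordK.
  by rewrite big_pred0 ?addr0// => -[i ?] /=; lia.
rewrite big_pred0 ?add0r => [|m]; last by rewrite andbF.
rewrite -(along_pick j); apply: eq_bigl => i /=.
by case: i => i ? /=; lia.
Qed.

Lemma path_eqns : [/\ 0 < along 0, along 0 = lam - 2, lam * along 0 = 3 + along 1,
  \sum_u x u = 3 + along 0 + \sum_(i < k) along i.+1 &
  \sum_u x u ^+ 2 = 3 + along 0 ^+ 2 + \sum_(i < k) along i.+1 ^+ 2].
Proof.
have [xb xc xv xy] := hinge_eig x_gt0 x_eig K4_path_hinge.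
rewrite x_tri mulr1 in xb xc xv xy.
have tail (F : R -> R) : \sum_u F (x u) =
    F 1 *+ 3 + F (along 0) + \sum_(i < k) F (along i.+1).
  rewrite big_sumType/=; congr (_ + _); last first.
    by apply: eq_bigr => j _; rewrite alongS.
  have inE4 (m : 'I_4) i : m = i :> nat -> m = inord i.
    by move=> mi; rewrite -mi inord_val.
  rewrite !big_ord_recl big_ord0 (inE4 (lift _ (lift _ (lift _ _))) 3%N)//.
  rewrite (inE4 (lift _ (lift _ _)) 2%N)// (inE4 (lift _ _) 1%N)// (inE4 ord0 0%N)//.
  rewrite xb xc x_tri.
  by rewrite addr0 mulrS mulr2n; ring.
split=> //; first exact: x_gt0.
- have -> : along 1 = x (inr (Ordinal k_gt0)) := alongS (Ordinal k_gt0).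
  by rewrite -[along 0]/(x (tri 0)) xy mulr1.
- by rewrite (tail id).
- by rewrite (tail (fun z => z ^+ 2)) expr1n.
Qed.

(** Were [lam] at least [ray_eig], the entries could never drop below the ratio
    of the ray, so they could not end in zero. *)
Lemma path_eig_lt : lam < ray_eig R.
Proof.
have [a0 a0E a1E _ _] := path_eqns.
rewrite ltNge; apply/negP => mul; have /andP[sl su] := rt3_bounds R.
have t_gt0 : 0 < t by rewrite /ray_ratio; lra.
have ratio i : (i <= k)%N -> t * along i <= along i.+1.
  elim: i => [_|i IHi ik].
    by rewrite -subr_ge0 (ray_ratio_defect a0E a1E) mulr_ge0 ?subr_ge0//; lra.
  have -> : along i.+2 = lam * along i.+1 - along i by rewrite along_rec// addrC addKr.
  by apply: ratio_ge => //; [exact: along_gt0 | apply: IHi; exact: ltnW].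
have := ratio k (leqnn k); rewrite along_out// leNgt => /negP; apply.
by rewrite mulr_gt0// along_gt0.
Qed.

Lemma along_ratio i : (i <= k)%N -> along i.+1 <= t * along i.
Proof.
have [a0 a0E a1E _ _] := path_eqns; have lt_mu := path_eig_lt.
have /andP[sl su] := rt3_bounds R => ik.
suff : along i.+1 < t * along i by move/ltW.
elim: i ik => [_|i IHi ik].
  by rewrite -subr_lt0 (ray_ratio_defect a0E a1E) nmulr_rlt0 ?subr_lt0//; lra.
have -> : along i.+2 = lam * along i.+1 - along i by rewrite along_rec// addrC addKr.
by apply: ratio_lt => //; [exact: along_gt0 | apply: IHi; exact: ltnW].
Qed.

Lemma along_le0 i : (i <= k)%N -> along i <= along 0.
Proof.
have /andP[sl su] := rt3_bounds R.
elim: i => // i IHi ik; apply: le_trans (IHi (ltnW ik)).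
apply: le_trans (along_ratio (ltnW ik)) _.
by rewrite ler_piMl ?(ltW (along_gt0 (ltnW ik)))// /ray_ratio; lra.
Qed.

(** Compare the path with the geometric sequence of ratio [t]: the defects
    [t * along i - along i.+1] are nonnegative, the sum of the entries falls
    short of the geometric sum by a multiple of the total defect [D], and the
    sum of squares by at most a smaller multiple of [D]. *)
Lemma path_order_lt :
  (\sum_u x u) ^+ 2 < ray_order R * (\sum_u x u ^+ 2).
Proof.
have [a0 a0E _ -> ->] := path_eqns; have lt_mu := path_eig_lt.
have s2 := rt3_sq R; have /andP[sl su] := rt3_bounds R.
have a0_lt : along 0 < 3 * t by rewrite a0E; move: lt_mu; rewrite /ray_eig /ray_ratio; lra.
set S := \sum_(i < k) along i.+1; set Q := \sum_(i < k) along i.+1 ^+ 2.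
have S0 : 0 <= S by apply: sumr_ge0 => i _; exact: (ltW (along_gt0 (ltn_ord i))).
have shift (F : R -> R) : F 0 = 0 ->
    \sum_(i < k.+1) F (along i.+1) = \sum_(i < k) F (along i.+1).
  by move=> F0; rewrite big_ord_recr /= along_out// F0 addr0.
pose D := \sum_(i < k.+1) (t * along i - along i.+1).
have D0 : 0 <= D.
  by apply: sumr_ge0 => i _; rewrite subr_ge0 along_ratio// -ltnS.
have DE : D = t * (along 0 + S) - S.
  rewrite /D sumrB -mulr_sumr (shift id)//; congr (t * _ - _).
  by rewrite big_ord_recl.
have Q_ge : t ^+ 2 * (along 0 ^+ 2 + Q) - Q <= 2 * t * along 0 * D.
  have -> : t ^+ 2 * (along 0 ^+ 2 + Q) - Q =
      \sum_(i < k.+1) (t ^+ 2 * along i ^+ 2 - along i.+1 ^+ 2).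
    rewrite sumrB -mulr_sumr (shift (fun z => z ^+ 2)) ?expr0n//.
    by congr (_ * _ - _); rewrite big_ord_recl.
  rewrite /D mulr_sumr; apply: ler_sum => i _.
  have ik : (i <= k)%N by rewrite -ltnS.
  have := along_ratio ik; have := along_le0 ik; have := along_gt0 ik.
  have t0 : 0 < t by rewrite /ray_ratio; lra.
  move: (along i) (along i.+1) (along 0) t t0 => p q p0 r r0 p_gt0 pp0 qp.
  have -> : r ^+ 2 * p ^+ 2 - q ^+ 2 = (r * p + q) * (r * p - q) by ring.
  rewrite ler_wpM2r ?subr_ge0//.
  have : r * p <= r * p0 by rewrite ler_pM2l.
  lra.
move: S0 D0 DE Q_ge a0_lt a0.
move: (along 0) S Q D => v S Q D S0 D0 DE Q_ge v_lt v0.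
have SE : S = s3 / 3 * v - (1 + s3 / 3) * D.
  have -> : D = t * (v + S) - S by [].
  by rewrite /ray_ratio; field: s2.
have Q_ge' : (2 * s3 / 3 - 1) * v ^+ 2 - (2 - 2 * s3 / 3) * v * D <= Q.
  have h : 0 <= 2 * s3 / 3 by lra.
  have := ler_wpM2l h Q_ge; rewrite /ray_ratio.
  have -> : 2 * s3 / 3 * (((s3 - 1) / 2) ^+ 2 * (v ^+ 2 + Q) - Q) =
      (2 * s3 / 3 - 1) * v ^+ 2 - Q by field: s2.
  have -> : 2 * s3 / 3 * (2 * ((s3 - 1) / 2) * v * D) = (2 - 2 * s3 / 3) * v * D.
    by field: s2.
  lra.
have c0 : 0 < ray_order R by rewrite /ray_order; lra.
suff h : (3 + v + S) ^+ 2 < ray_order R *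
    (3 + v ^+ 2 + ((2 * s3 / 3 - 1) * v ^+ 2 - (2 - 2 * s3 / 3) * v * D)).
  by apply: lt_le_trans h _; rewrite ler_pM2l//; lra.
rewrite -subr_gt0 SE.
have -> : ray_order R * (3 + v ^+ 2 + ((2 * s3 / 3 - 1) * v ^+ 2 - (2 - 2 * s3 / 3) * v * D)) -
    (3 + v + (s3 / 3 * v - (1 + s3 / 3) * D)) ^+ 2 =
  (3 * t - v) * (4 + s3 - (5 + 3 * s3) / 3 * v) +
  D * ((1 + s3 / 3) * (3 + v + (s3 / 3 * v - (1 + s3 / 3) * D)) + (3 + s3) - v * ((2 + 2 * s3) / 3)).
  by rewrite /ray_order /ray_ratio; field: s2.
have v_lt' : v < 11 / 10 by move: v_lt; rewrite /ray_ratio; lra.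
apply: ltr_pwDl.
  apply: mulr_gt0; first by rewrite subr_gt0.
  have : (5 + 3 * s3) / 3 * v <= (5 + 3 * s3) / 3 * (11 / 10) by rewrite ler_pM2l; lra.
  lra.
apply: mulr_ge0 => //; rewrite -SE.
have : v * ((2 + 2 * s3) / 3) <= 11 / 10 * ((2 + 2 * s3) / 3) by rewrite ler_pM2r; lra.
have : 0 <= (1 + s3 / 3) * (3 + v + S) by apply: mulr_ge0; lra.
lra.
Qed.

End PathOrder.

Arguments along : simpl never.

Lemma K4_path_normalized (R : realType) k (k_gt0 : (0 < k)%N) :
  exists x : 'I_4 + 'I_k -> R, exists lam, [/\ forall u, 0 < x u,
    eigenfun (K4_path k) x lam, x (inl (inord 1)) = 1 &
    effective_order (K4_path k) = (\sum_u x u) ^+ 2 / \sum_u x u ^+ 2 ].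
Proof.
have [cardT e_sym e_irr e_conn] := K4_path_connected k.
have T0 : (0 < #|{: 'I_4 + 'I_k}|)%N by rewrite cardT addn4.
have [x [lam [x0 xe]]] := perron_exists R e_sym e_conn T0.
have xa := x0 (inl (inord 1)).
exists (fun u => x u / x (inl (inord 1))), lam.
have pos u : 0 < x u / x (inl (inord 1)) by rewrite divr_gt0.
have eig : eigenfun (K4_path k) (fun u => x u / x (inl (inord 1))) lam.
  by move=> u; rewrite -mulr_suml xe mulrA.
by split=> //; [rewrite divff// gt_eqF | exact: effective_orderE pos eig].
Qed.

Lemma K4_path_order_lt (R : realType) k : (0 < k)%N ->
  effective_order (K4_path k) < ray_order R.
Proof.
move=> k0; have [x [lam [x0 xe xa ->]]] := K4_path_normalized R k0.
have := path_order_lt k0 x0 xe xa; rewrite ltr_pdivrMr//.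
rewrite (bigD1 (inl (inord 1)))//= xa expr1n ltr_pwDl//.
by apply: sumr_ge0 => u _; exact: sqr_ge0.
Qed.

(** With [lam = 3 + h] the eigenvalue equation is a quartic in [h]. Its root lies
    between the fractions [11 / 114] and [25 / 259], and the entries are increasing
    in [h]. *)
Lemma K4_path2_order (R : realType) :
  effective_order (K4_path 2) <= 488 / 100 :> R.
Proof.
have k0 : (0 < 2)%N by [].
have [x [lam [x0 xe xa ->]]] := K4_path_normalized R k0.
have [v0 vE v1 -> ->] := path_eqns k0 x0 xe xa.
have r1 := along_rec k0 xe (isT : (0 < 2)%N).
have r2 := along_rec k0 xe (isT : (1 < 2)%N).
have q1 := along_gt0 x0 (isT : (1 <= 2)%N).
rewrite (along_out x (leqnn 2)) addr0 in r2.
rewrite !big_ord_recl !big_ord0 /= /bump /= !add1n.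
move: v0 vE v1 r1 r2 q1.
move: (along x 0) (along x 1) (along x 2) => v p q v0 vE v1 r1 r2 p0.
pose h := lam - 3.
have lamE : lam = 3 + h by rewrite /h; ring.
have vh : v = 1 + h by rewrite vE lamE; ring.
have pE : p = h * (4 + h) by move: v1; rewrite vh lamE; lra.
have qE : q = (3 + h) * (h * (4 + h)) - 1 - h by move: r1; rewrite vh lamE pE; lra.
pose f (z : R) := z * (28 + z * (31 + z * (10 + z))).
have root : f h = 3 by move: r2; rewrite qE pE lamE /f; lra.
have h0 : 0 < h.
  rewrite ltNge; apply/negP => hn; have l0 : 0 < 4 + h by move: v0; rewrite vh; lra.
  by move: p0; rewrite pE pmulr_lgt0// ltNge hn.
have f_mono a b : 0 <= a -> a < b -> f a < f b.
  move=> a0 ab; have b0 : 0 < b by exact: le_lt_trans ab.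
  have h1 : a * (10 + a) < b * (10 + b) by apply: ltr_pM; lra.
  have h10 : 0 <= a * (10 + a) by apply: mulr_ge0; lra.
  have h2 : a * (31 + a * (10 + a)) < b * (31 + b * (10 + b)) by apply: ltr_pM; lra.
  have h20 : 0 <= a * (31 + a * (10 + a)) by apply: mulr_ge0; lra.
  by apply: ltr_pM; lra.
have h_ge : 11 / 114 <= h.
  rewrite leNgt; apply/negP => /(f_mono _ _ (ltW h0)); rewrite root /f; lra.
have h_le : h <= 25 / 259.
  rewrite leNgt; apply/negP => h_gt; have : 0 <= 25 / 259 :> R by lra.
  by move=> /f_mono /(_ h_gt); rewrite root /f; lra.
have S_le : 3 + v + (p + (q + 0)) <= 231 / 50.
  have : h * (16 + h * (8 + h)) <= 25 / 259 * (16 + 25 / 259 * (8 + 25 / 259)).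
    have h1 : h * (8 + h) <= 25 / 259 * (8 + 25 / 259) by apply: ler_pM; lra.
    have h10 : 0 <= h * (8 + h) by apply: mulr_ge0; lra.
    by apply: ler_pM; lra.
  by rewrite vh qE pE; lra.
have v_ge : 125 / 114 <= v by rewrite vh; lra.
have p_ge : 49 / 124 <= p.
  rewrite pE; apply: (@le_trans _ _ (11 / 114 * (4 + 11 / 114))); first by lra.
  by apply: ler_pM; lra.
have q_ge : 7 / 55 <= q.
  have -> : q = h * (11 + h * (7 + h)) - 1 by rewrite qE; ring.
  have : 11 / 114 * (11 + 11 / 114 * (7 + 11 / 114)) <= h * (11 + h * (7 + h)).
    have h1 : 11 / 114 * (7 + 11 / 114) <= h * (7 + h) by apply: ler_pM; lra.
    by apply: ler_pM; lra.
  lra.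
have sq (a z : R) : 0 <= a -> a <= z -> a ^+ 2 <= z ^+ 2.
  by move=> a0 az; rewrite lerXn2r ?nnegrE// (le_trans a0).
have v2 : (125 / 114) ^+ 2 <= v ^+ 2 by apply: sq v_ge; lra.
have p2 : (49 / 124) ^+ 2 <= p ^+ 2 by apply: sq p_ge; lra.
have q2 : (7 / 55) ^+ 2 <= q ^+ 2 by apply: sq q_ge; lra.
rewrite ler_pdivrMr; last first.
  by rewrite addr0 -!addrA ltr_pwDl// !addr_ge0 ?sqr_ge0.
apply: (@le_trans _ _ ((231 / 50) ^+ 2)).
  have S_ge : 0 <= 3 + v + (p + (q + 0)) by move: v_ge p_ge q_ge; lra.
  exact: sq S_ge S_le.
by move: v2 p2 q2; rewrite !expr2; lra.
Qed.

(** * The spectrum of locally finite graphs *)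

Section SquareSummable.
Local Open Scope classical_set_scope.
Variables (R : realType) (V : choiceType).
Implicit Types (f : V -> R) (x y : V -> R) (s : seq V).

Lemma esum_le_seq f M : (forall s, uniq s -> \sum_(v <- s) f v <= M) ->
  (\esum_(v in setT) (f v)%:E <= M%:E)%E.
Proof.
move=> fM; apply: ge_ereal_sup => _ [X [finX _] <-].
by rewrite fsbig_finite// sumEFin lee_fin fM.
Qed.

Lemma seq_le_esum f s : uniq s ->
  ((\sum_(v <- s) f v)%:E <= \esum_(v in setT) (f v)%:E)%E.
Proof.
move=> s_uniq; apply: esum_ge; exists [set` s]; last by rewrite -fsbig_seq// sumEFin.
by split=> //; exact: finite_seq.
Qed.

(** Square summability with an explicit bound, stated on finite lists so that
    operators on locally finite graphs can be estimated by finite sums. *)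
Definition l2_bound x (M : R) := forall s, uniq s -> \sum_(v <- s) x v ^+ 2 <= M.

Lemma ell2E x : ell2 x <-> (\esum_(v in setT) (x v ^+ 2)%:E < +oo)%E.
Proof.
rewrite /ell2 /= /summable (@eq_esum _ _ _ (fun v => `|(x v ^+ 2)%:E|%E) (fun v => (x v ^+ 2)%:E))//.
by move=> v _; rewrite gee0_abs// lee_fin sqr_ge0.
Qed.

Lemma esum_sqr_ge0 x : (0 <= \esum_(v in setT) (x v ^+ 2)%:E)%E.
Proof. by apply: esum_ge0 => v _; rewrite lee_fin sqr_ge0. Qed.

Lemma l2_boundP x M : l2_bound x M -> ell2 x /\ norm2 x ^+ 2 <= M.
Proof.
move=> /esum_le_seq xM; have fin : \esum_(v in setT) (x v ^+ 2)%:E \is a fin_num.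
  rewrite ge0_fin_numE; first exact: le_lt_trans xM (ltry _).
  exact: esum_sqr_ge0.
split; first by apply/ell2E; exact: le_lt_trans xM (ltry _).
rewrite /norm2 sqr_sqrtr ?fine_ge0 ?esum_sqr_ge0//.
by rewrite -lee_fin fineK.
Qed.

Lemma ell2_bound x : ell2 x -> l2_bound x (norm2 x ^+ 2).
Proof.
move=> /ell2E xfin s s_uniq.
have fin : \esum_(v in setT) (x v ^+ 2)%:E \is a fin_num.
  by rewrite ge0_fin_numE// esum_sqr_ge0.
rewrite /norm2 sqr_sqrtr ?fine_ge0 ?esum_sqr_ge0// -lee_fin fineK//.
exact: (seq_le_esum (fun v => x v ^+ 2)).
Qed.

Lemma norm2_ge0 x : 0 <= norm2 x.
Proof. exact: sqrtr_ge0. Qed.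

Lemma norm2_le x M : 0 <= M -> l2_bound x (M ^+ 2) -> norm2 x <= M.
Proof.
by move=> M0 /l2_boundP[_]; rewrite ler_sqr ?nnegrE ?norm2_ge0.
Qed.

Lemma norm2_eq0 x : ell2 x -> norm2 x = 0 -> forall v, x v = 0.
Proof.
move=> /ell2_bound xb x0 v; have := xb [:: v] isT.
by rewrite big_seq1 x0 expr0n /= real_exprn_even_le0 ?num_real//= => /eqP.
Qed.

(** Used instead of the triangle inequality: it can be summed term by term. *)
Lemma sqrD_le (eps a b : R) : 0 < eps ->
  (a + b) ^+ 2 <= (1 + eps) * a ^+ 2 + (1 + eps^-1) * b ^+ 2.
Proof.
move=> e0; have : 0 <= (eps * a - b) ^+ 2 / eps by rewrite divr_ge0 ?sqr_ge0// ltW.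
have -> : (eps * a - b) ^+ 2 / eps = eps * a ^+ 2 - 2 * a * b + eps^-1 * b ^+ 2.
  by field; rewrite gt_eqF.
rewrite !expr2; lra.
Qed.

Lemma l2_boundD eps x y M N : 0 < eps -> l2_bound x M -> l2_bound y N ->
  l2_bound (fun v => x v + y v) ((1 + eps) * M + (1 + eps^-1) * N).
Proof.
move=> e0 xM yN s s_uniq; have ei : 0 < eps^-1 by rewrite invr_gt0.
apply: (@le_trans _ _ (\sum_(v <- s) ((1 + eps) * x v ^+ 2 + (1 + eps^-1) * y v ^+ 2))).
  by apply: ler_sum => v _; exact: sqrD_le.
rewrite big_split/= -!mulr_sumr lerD// ler_wpM2l ?xM ?yN//; lra.
Qed.

Lemma l2_boundZ a x M : l2_bound x M -> l2_bound (fun v => a * x v) (a ^+ 2 * M).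
Proof.
move=> xM s s_uniq; under eq_bigr do rewrite exprMn.
by rewrite -mulr_sumr ler_wpM2l ?sqr_ge0// xM.
Qed.

Lemma l2_bound_le x y M : (forall v, `|x v| <= `|y v|) -> l2_bound y M -> l2_bound x M.
Proof.
move=> xy yM s s_uniq; apply: le_trans (yM s s_uniq); apply: ler_sum => v _.
by rewrite -[x v ^+ 2]real_normK ?num_real// -[leRHS]real_normK ?num_real// lerXn2r ?nnegrE.
Qed.

Lemma l2_bound_ext x y M : x =1 y -> l2_bound x M -> l2_bound y M.
Proof. by move=> xy; apply: l2_bound_le => v; rewrite xy. Qed.

Lemma sum_sub_le f s s' : (forall v, 0 <= f v) -> uniq s -> uniq s' ->
  {subset s <= s'} -> \sum_(v <- s) f v <= \sum_(v <- s') f v.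
Proof.
move=> f0 us us' ss'; rewrite [leRHS](bigID (mem s))/=.
have <- : \sum_(v <- s) f v = \sum_(v <- s' | v \in s) f v.
  rewrite -[RHS]big_filter; apply: perm_big.
  apply: uniq_perm; rewrite ?filter_uniq// => v; rewrite mem_filter.
  by case: (boolP (v \in s)) => // /ss' ->.
by rewrite lerDl sumr_ge0.
Qed.

End SquareSummable.

Section LocallyFinite.
Local Open Scope classical_set_scope.
Variables (R : realType) (V : choiceType) (e : rel V) (nb : V -> seq V).
Hypotheses (e_sym : symmetric e) (nb_uniq : forall v, uniq (nb v)).
Hypothesis nbE : forall v w, (w \in nb v) = e v w.
Variables (h : V -> R) (mu : R).
Hypotheses (h_gt0 : forall v, 0 < h v) (mu_gt0 : 0 < mu).
Hypothesis h_eig : forall v, \sum_(w <- nb v) h w = mu * h v.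
Implicit Types (x y f g u : V -> R) (s : seq V).

Lemma adjopE x v : adjop e x v = \sum_(w <- nb v) x w.
Proof.
rewrite /adjop; have -> : [set w | e v w] = [set` nb v] by apply/seteqP; split=> w /=; rewrite nbE.
by rewrite -fsbig_seq.
Qed.

Lemma weighted_cauchy (s : seq V) x :
  (\sum_(w <- s) x w) ^+ 2 <= (\sum_(w <- s) h w) * \sum_(w <- s) x w ^+ 2 / h w.
Proof.
elim: s => [|w s IHs]; first by rewrite !big_nil mul0r expr0n.
rewrite !big_cons; have hw := h_gt0 w.
have H0 : 0 <= \sum_(w <- s) h w by apply: sumr_ge0 => v _; exact: ltW.
have X0 : 0 <= \sum_(w <- s) x w ^+ 2 / h w.
  by apply: sumr_ge0 => v _; rewrite divr_ge0 ?sqr_ge0// ltW.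
move: IHs H0 X0; move: (\sum_(w <- s) x w) (\sum_(w <- s) h w) (\sum_(w <- s) (x w ^+ 2 / h w)).
move=> a H X aHX H0 X0; set z := x w; set k := h w in hw *.
have -> : (k + H) * (z ^+ 2 / k + X) = z ^+ 2 + H * X + (k * X + H * (z ^+ 2 / k)).
  by field; rewrite gt_eqF.
suff : 2 * z * a <= k * X + H * (z ^+ 2 / k) by rewrite sqrrD mulr2n; lra.
have [H_eq0|H_neq0] := eqVneq H 0.
  move: aHX; rewrite H_eq0 !mul0r => a0; have -> : a = 0.
    by apply/eqP; move: a0; rewrite real_exprn_even_le0 ?num_real.
  by rewrite mulr0 addr0 mulr_ge0// ltW.
have H_gt0 : 0 < H by rewrite lt_neqAle eq_sym H_neq0.
have : a ^+ 2 / H <= X by rewrite ler_pdivrMr// mulrC.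
rewrite -(ler_pM2l hw) => h1; apply: le_trans (lerD h1 (lexx _)).
rewrite -subr_ge0.
have -> : k * (a ^+ 2 / H) + H * (z ^+ 2 / k) - 2 * z * a = (k * a - H * z) ^+ 2 / (k * H).
  by field; rewrite H_neq0 gt_eqF.
by rewrite divr_ge0 ?sqr_ge0// mulr_ge0// ltW.
Qed.

(** Schur test: a positive eigenfunction of a nonnegative symmetric operator
    bounds its norm by the eigenvalue. *)
Lemma schur_test x M : l2_bound x M -> l2_bound (adjop e x) (mu ^+ 2 * M).
Proof.
move=> xM s s_uniq; pose B := undup (flatten [seq nb v | v <- s]).
have nbB v : v \in s -> perm_eq (nb v) [seq w <- B | w \in nb v].
  move=> vs; apply: uniq_perm; rewrite ?filter_uniq ?undup_uniq// => w.
  rewrite mem_filter; case: (boolP (w \in nb v)) => //= wv.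
  by rewrite mem_undup; apply/esym/flattenP; exists (nb v) => //; exact: map_f.
apply: (@le_trans _ _ (\sum_(v <- s) \sum_(w <- B | w \in nb v) mu * h v * (x w ^+ 2 / h w))).
  rewrite big_seq [leRHS]big_seq; apply: ler_sum => v vs.
  rewrite -[leRHS]big_filter -(perm_big _ (nbB v vs))/= -mulr_sumr -h_eig adjopE.
  exact: weighted_cauchy.
rewrite (exchange_big_dep predT)//=.
apply: (@le_trans _ _ (\sum_(w <- B) mu ^+ 2 * x w ^+ 2)); last first.
  by rewrite -mulr_sumr ler_wpM2l ?sqr_ge0// xM// undup_uniq.
apply: ler_sum => w _; rewrite -mulr_suml -mulr_sumr.
have : \sum_(v <- s | w \in nb v) h v <= mu * h w.
  rewrite -h_eig -big_filter; apply: sum_sub_le => //.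
  - by move=> v; exact: ltW.
  - exact: filter_uniq.
  - by move=> v; rewrite mem_filter !nbE e_sym => /andP[].
move=> sum_le; have xh : 0 <= x w ^+ 2 / h w by rewrite divr_ge0 ?sqr_ge0// ltW.
have -> : mu ^+ 2 * x w ^+ 2 = mu * (mu * h w) * (x w ^+ 2 / h w).
  by field; rewrite gt_eqF.
by rewrite ler_wpM2r// ler_pM2l.
Qed.

Section Resolvent.
Variable l : R.
Hypothesis mu_lt : mu < l.

Lemma l_gt0 : 0 < l. Proof. exact: lt_trans mu_lt. Qed.

(** Room between the bound of the operator and [l], to absorb the factor
    [1 + eps] of [sqrD_le]. *)
Lemma gap : exists2 eps, 0 < eps & (1 + eps) * mu ^+ 2 < l ^+ 2.
Proof.
have mu2 : 0 < mu ^+ 2 by rewrite exprn_gt0.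
have ml : mu ^+ 2 < l ^+ 2 by rewrite ltrXn2r// ltW// l_gt0.
exists ((l ^+ 2 - mu ^+ 2) / (2 * mu ^+ 2)).
  by rewrite divr_gt0 ?subr_gt0// mulr_gt0.
have -> : (1 + (l ^+ 2 - mu ^+ 2) / (2 * mu ^+ 2)) * mu ^+ 2 = (l ^+ 2 + mu ^+ 2) / 2.
  by field; rewrite gt_eqF.
lra.
Qed.

Local Notation F x := (fun v => adjop e x v - l * x v).

Lemma shift_bound x M : l2_bound x M ->
  l2_bound (F x) (2 * (mu ^+ 2 * M) + 2 * (l ^+ 2 * M)).
Proof.
move=> xM; have := l2_boundD ltr01 (schur_test xM) (l2_boundZ (- l) xM).
rewrite invr1 sqrrN; apply: l2_bound_ext => v.
by rewrite mulNr.
Qed.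

Lemma shift_bounded_below : exists C, forall x, ell2 x -> norm2 x <= C * norm2 (F x).
Proof.
have [eps e0 gap_lt] := gap; have ei : 0 < eps^-1 by rewrite invr_gt0.
pose D := l ^+ 2 - (1 + eps) * mu ^+ 2.
have D0 : 0 < D by rewrite subr_gt0.
pose C2 := (1 + eps^-1) / D.
have C20 : 0 <= C2 by apply: divr_ge0; [lra | exact: ltW].
exists (Num.sqrt C2) => x x2.
have xM := ell2_bound x2; have [Fx2 _] := l2_boundP (shift_bound xM).
have FM := ell2_bound Fx2.
have xM' := l2_boundD e0 (schur_test xM) (l2_boundZ (-1) FM).
rewrite sqrrN expr1n mul1r in xM'.
have lx : l2_bound (fun v => l * x v)
    ((1 + eps) * (mu ^+ 2 * norm2 x ^+ 2) + (1 + eps^-1) * norm2 (F x) ^+ 2).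
  by apply: l2_bound_ext xM' => v /=; ring.
have : l2_bound x (l ^- 2 * ((1 + eps) * (mu ^+ 2 * norm2 x ^+ 2) + (1 + eps^-1) * norm2 (F x) ^+ 2)).
  rewrite -exprVn; apply: l2_bound_ext (l2_boundZ l^-1 lx) => v /=.
  by rewrite mulKf// gt_eqF// l_gt0.
move=> /l2_boundP[_]; have l2 : 0 < l ^+ 2 by rewrite exprn_gt0// l_gt0.
rewrite ler_pdivlMl// => xF.
rewrite -(@ler_sqr _ (norm2 x)) ?nnegrE ?norm2_ge0 ?mulr_ge0 ?sqrtr_ge0 ?norm2_ge0//.
rewrite exprMn (@sqr_sqrtr _ C2)// /C2 mulrAC ler_pdivlMr// /D; lra.
Qed.

Lemma shift_inj x y : ell2 x -> ell2 y -> F x = F y -> x = y.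
Proof.
move=> x2 y2 Fxy; have [C shift_C] := shift_bounded_below.
pose d v := x v + -1 * y v.
have dM := l2_boundD ltr01 (ell2_bound x2) (l2_boundZ (-1) (ell2_bound y2)).
have [d2 _] := l2_boundP dM.
have Fd v : adjop e d v - l * d v = 0.
  have := congr1 (fun f => f v) Fxy; rewrite /= !adjopE /d big_split/= -mulr_sumr => H.
  by lra.
have d0 : norm2 d = 0.
  apply: le_anti; rewrite norm2_ge0 andbT; apply: le_trans (shift_C d d2) _.
  have -> : norm2 (F d) = 0.
    apply: le_anti; rewrite norm2_ge0 andbT; apply: norm2_le => // s _.
    by rewrite big1 ?expr0n// => v _; rewrite Fd expr0n.
  by rewrite mulr0.
apply/funext => v; have := norm2_eq0 d2 d0 v; rewrite /d; lra.
Qed.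

Fixpoint iterate g n v : R :=
  if n is n'.+1 then (adjop e (iterate g n') v + g v) / l else 0.

(** The Neumann iteration from zero increases to a solution; its squares stay
    bounded by the Schur test, so the pointwise limit is square summable. *)
Lemma resolvent_nonneg g : (forall v, 0 <= g v) -> ell2 g ->
  exists2 u, ell2 u & forall v, l * u v = adjop e u v + g v.
Proof.
move=> g0 g2; have gM := ell2_bound g2; have l0 := l_gt0.
have [eps e0 gap_lt] := gap; have ei : 0 < eps^-1 by rewrite invr_gt0.
pose D := l ^+ 2 - (1 + eps) * mu ^+ 2.
have D0 : 0 < D by rewrite subr_gt0.
(* [M] is the fixpoint of the bound that [sqrD_le] and the Schur test give for
   one step of the iteration. *)
pose M := (1 + eps^-1) * norm2 g ^+ 2 / D.
have M0 : 0 <= M.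
  by apply: divr_ge0; [apply: mulr_ge0; [lra | exact: sqr_ge0] | exact: ltW].
have l2 : 0 < l ^+ 2 by rewrite exprn_gt0.
have iterM n : l2_bound (iterate g n) M.
  elim: n => [|n IHn] s s_uniq; first by rewrite big1// => v _; rewrite expr0n.
  have := l2_boundZ l^-1 (l2_boundD e0 (schur_test IHn) gM).
  have -> : l^-1 ^+ 2 * ((1 + eps) * (mu ^+ 2 * M) + (1 + eps^-1) * norm2 g ^+ 2) = M.
    have -> : (1 + eps^-1) * norm2 g ^+ 2 = M * D by rewrite divfK ?gt_eqF.
    by rewrite /D; field; rewrite gt_eqF.
  move=> /(_ s s_uniq); congr (_ <= _); apply: eq_bigr => v _ /=.
  by rewrite mulrC.
have iter_le n v : iterate g n v <= iterate g n.+1 v.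
  elim: n v => [|n IHn] v /=.
    by rewrite divr_ge0 ?(ltW l0)// addr_ge0// adjopE big1.
  rewrite ler_pM2r ?invr_gt0// lerD2r !adjopE; apply: ler_sum => w _; exact: IHn.
have iter_nd v : nondecreasing_seq (fun n => iterate g n v).
  by apply/nondecreasing_seqP => n; exact: iter_le.
have iter_ub v : has_ubound (range (fun n => iterate g n v)).
  exists (1 + M) => _ [n _ <-]; have := iterM n [:: v] isT; rewrite big_seq1 expr2.
  by move: (iterate g n v) => z zM; nra.
pose u v := limn (fun n => iterate g n v).
have u_lim v : (fun n => iterate g n v) @ \oo --> u v.
  exact: nondecreasing_is_cvgn.
have sum_lim (G : R -> R) (s : seq V) : continuous G ->
    (fun n => \sum_(v <- s) G (iterate g n v)) @ \oo --> \sum_(v <- s) G (u v).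
  move=> cG; apply: cvg_big => [|v _]; first exact: add_continuous.
  by apply: continuous_cvg; [exact: cG | exact: u_lim].
exists u.
  have uM : l2_bound u M.
    move=> s s_uniq; have lim_s := sum_lim (fun z => z ^+ 2) s (@exprn_continuous R 2).
    by apply: (cvgr_to_le lim_s); apply: nearW => n; exact: iterM.
  by have [] := l2_boundP uM.
move=> v; rewrite adjopE.
have lhs : (fun n => l * iterate g n.+1 v) @ \oo --> l * u v.
  apply: cvgM; first exact: cvg_cst.
  by have := u_lim v; rewrite -(cvg_shiftS (fun n => iterate g n v)).
have rhs : (fun n => l * iterate g n.+1 v) @ \oo --> \sum_(w <- nb v) u w + g v.
  have -> : (fun n => l * iterate g n.+1 v) = (fun n => \sum_(w <- nb v) iterate g n w + g v).
    by apply/funext => n /=; rewrite adjopE mulrC divfK// gt_eqF.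
  apply: cvgD; last exact: cvg_cst.
  by apply: (sum_lim id) => z; exact: cvg_id.
exact: (cvg_unique _ lhs rhs).
Qed.

Lemma shift_invertible : ell2_invertible (fun x v => adjop e x v - l * x v).
Proof.
split; last exact: shift_bounded_below.
split.
- by move=> x /ell2_bound/shift_bound/l2_boundP[].
- by move=> x y /set_mem x2 /set_mem y2; exact: shift_inj.
- move=> f /ell2_bound fM.
  have [||u u2 uE] := @resolvent_nonneg (fun v => Num.max (f v) 0).
  + by move=> v; rewrite le_max lexx orbT.
  + suff : l2_bound (fun v => Num.max (f v) 0) (norm2 f ^+ 2) by move=> /l2_boundP[].
    apply: l2_bound_le fM => v; case: (lerP (f v) 0) => fv; first by rewrite normr0.
    by [].
  have [||w w2 wE] := @resolvent_nonneg (fun v => Num.max (- f v) 0).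
  + by move=> v; rewrite le_max lexx orbT.
  + suff : l2_bound (fun v => Num.max (- f v) 0) (norm2 f ^+ 2) by move=> /l2_boundP[].
    apply: l2_bound_le fM => v; case: (lerP (- f v) 0) => fv; first by rewrite normr0.
    by rewrite normrN.
  have dM := l2_boundD ltr01 (ell2_bound w2) (l2_boundZ (-1) (ell2_bound u2)).
  exists (fun v => w v + -1 * u v); first by have [] := l2_boundP dM.
  apply/funext => v; rewrite adjopE big_split/= -mulr_sumr.
  have := uE v; have := wE v; rewrite !adjopE.
  case: (lerP (f v) 0); case: (lerP (- f v) 0); lra.
Qed.

End Resolvent.

(** Above [mu] the operator is invertible by the resolvent, and at [mu] it is not
    injective. *)
Lemma spectrum_top : ell2 h -> (exists v : V, true) -> greatest (spectrum (R:=R) e) mu.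
Proof.
move=> h2 [v0 _]; split.
  rewrite /spectrum /= => -[[_ F_inj _] _].
  have z2 : ell2 (fun _ : V => 0 : R).
    have /l2_boundP[] // : l2_bound (fun _ : V => 0 : R) 0.
    by move=> s _; rewrite big1// => v _; rewrite expr0n.
  have := F_inj h (fun=> 0) (mem_set h2) (mem_set z2).
  have Fh : (fun v => adjop e h v - mu * h v) = (fun v => adjop e (fun=> 0) v - mu * 0).
    by apply/funext => v; rewrite !adjopE h_eig subrr big1// mulr0 subrr.
  move=> /(_ Fh)/(congr1 (fun f => f v0)) h0.
  by have := h_gt0 v0; rewrite h0 ltxx.
move=> l; rewrite /spectrum /= leNgt => not_inv; apply/negP => mu_l.
by apply: not_inv; exact: shift_invertible.
Qed.

End LocallyFinite.

(** * The ray *)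

Section Ray.
Local Open Scope classical_set_scope.
Variable R : realType.
Local Notation V := ('I_4 + nat)%type.
Local Notation s3 := (rt3 R).
Local Notation t := (ray_ratio R).
Local Notation mu := (ray_eig R).

Definition ray_nbrs (v : V) : seq V :=
  match v with
  | inl i => [seq inl j | j <- enum 'I_4 & j != i] ++ (if i == ord0 then [:: inr 0%N] else [::])
  | inr j => [:: inr j.+1; if j is j'.+1 then inr j' else inl ord0]
  end.

Definition ray_vec (v : V) : R :=
  match v with
  | inl i => if i == ord0 then 3 * t else 1
  | inr j => 3 * t ^+ j.+2
  end.

Lemma ray_nbrs_uniq v : uniq (ray_nbrs v).
Proof.
case: v => [i|j]; last first.
  by case: j => [|j] //=; rewrite inE andbT; apply/eqP => -[]; lia.
rewrite /ray_nbrs.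
have inl_uniq : uniq [seq inl j : V | j <- enum 'I_4 & j != i].
  by rewrite map_inj_uniq; [apply: filter_uniq; exact: enum_uniq | move=> ? ? []].
case: ifP => _; rewrite ?cats0// cat_uniq inl_uniq /= andbT.
by rewrite orbF; apply/negP => /mapP[].
Qed.

Lemma ray_nbrsE v w : (w \in ray_nbrs v) = K4_ray v w.
Proof.
case: v w => [i|j] [i'|j'] //; rewrite /ray_nbrs /K4_ray /K4_plus.
- rewrite mem_cat; have -> : (inl i' \in (if i == ord0 then [:: inr 0%N : V] else [::])) = false.
    by case: ifP.
  rewrite orbF; apply/mapP/idP => [[k + [->]]|ii'].
    by rewrite mem_filter eq_sym => /andP[].
  by exists i' => //; rewrite mem_filter eq_sym ii' mem_enum.
- rewrite mem_cat; have -> : (inr j' \in [seq inl j : V | j <- enum 'I_4 & j != i]) = false.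
    by apply/negP => /mapP[].
  by case: ifP => _; rewrite ?mem_seq1 ?in_nil.
- by rewrite !inE; case: j => [|j] /=; rewrite ?andbT ?andbF.
- have inrE k : (inr j' == inr k :> V) = (j' == k) by [].
  have inlE : (inr j' == inl ord0 :> V) = false by [].
  by case: j => [|j]; rewrite !inE !inrE ?inlE; lia.
Qed.

Lemma sum_ray_nbrs_inl (x : V -> R) i : \sum_(w <- ray_nbrs (inl i)) x w =
  \sum_(j < 4 | j != i) x (inl j) + (if i == ord0 then x (inr 0%N) else 0).
Proof.
rewrite /ray_nbrs big_cat big_map big_filter big_enum_cond/=; congr (_ + _).
by case: ifP => _; rewrite ?big_seq1 ?big_nil.
Qed.

Lemma ray_ratio_gt0 : 0 < t.
Proof. by have /andP[sl su] := rt3_bounds R; rewrite /ray_ratio; lra. Qed.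

Lemma ray_ratio_lt1 : t < 1.
Proof. by have /andP[sl su] := rt3_bounds R; rewrite /ray_ratio; lra. Qed.

Lemma ray_eig_gt0 : 0 < mu.
Proof. by have /andP[sl su] := rt3_bounds R; rewrite /ray_eig; lra. Qed.

Lemma ray_eq_tail : 1 + t ^+ 2 = mu * t.
Proof. by rewrite /ray_eig /ray_ratio; have s2 := rt3_sq R; field: s2. Qed.

Lemma ray_eq_tri : 2 + 3 * t = mu.
Proof. by rewrite /ray_eig /ray_ratio; field. Qed.

Lemma ray_vec_gt0 v : 0 < ray_vec v.
Proof.
have t0 := ray_ratio_gt0.
case: v => [i|j] /=; first by case: ifP => _; [rewrite mulr_gt0 | ].
by rewrite mulr_gt0// exprn_gt0.
Qed.

Lemma ray_vec_eig v : \sum_(w <- ray_nbrs v) ray_vec w = mu * ray_vec v.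
Proof.
have et := ray_eq_tail; have eb := ray_eq_tri.
case: v => [i|j].
  rewrite sum_ray_nbrs_inl big_mkcond !big_ord_recl big_ord0 /=.
  by case: i => [[|[|[|[|]]]]//= i4]; rewrite -?val_eqE /= ?expr2; rewrite expr2 in et; lra.
rewrite /= big_cons big_seq1 /=; have -> : mu * (3 * t ^+ j.+2) = 3 * t ^+ j.+1 * (mu * t).
  by rewrite exprSr; ring.
by rewrite -et; case: j => [|j] /=; rewrite !exprS; ring.
Qed.

(** Every finite set of vertices lies in [K_4] together with an initial segment of
    the path, so the sums over these determine the sum over all vertices. *)
Lemma esum_ray (f : V -> R) (L C q : R) : (forall v, 0 <= f v) -> 0 <= q < 1 -> 0 <= C ->
  (forall N, \sum_(i < 4) f (inl i) + \sum_(j < N) f (inr (j : nat)) = L - C * q ^+ N) ->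
  \esum_(v in setT) (f v)%:E = L%:E.
Proof.
move=> f0 /andP[q0 q1] C0 partial.
pose init N : seq V := [seq inl i | i <- enum 'I_4] ++ [seq inr j | j <- iota 0 N].
have init_uniq N : uniq (init N).
  rewrite cat_uniq; apply/and3P; split.
  - by rewrite map_inj_uniq; [exact: enum_uniq | move=> ? ? []].
  - by apply/hasPn => _ /mapP[j _ ->]; apply/negP => /mapP[].
  - by rewrite map_inj_uniq; [exact: iota_uniq | move=> ? ? []].
have init_sum N : \sum_(v <- init N) f v = L - C * q ^+ N.
  rewrite -partial big_cat !big_map; congr (_ + _).
  by rewrite -(big_mkord xpredT (fun j => f (inr j))) /index_iota subn0.
have le_L : (\esum_(v in setT) (f v)%:E <= L%:E)%E.
  apply: esum_le_seq => s s_uniq.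
  have [N sN] : exists N, forall j, inr j \in s -> (j < N)%N.
    elim: s {s_uniq} => [|v s [N sN]]; first by exists 0%N.
    exists (maxn N (if v is inr j then j.+1 else 0%N)) => j.
    rewrite inE leq_max => /predU1P[<-|/sN ->//]; by rewrite leqnn orbT.
  apply: (@le_trans _ _ (\sum_(v <- init N) f v)).
    apply: sum_sub_le => // -[i|j] vs; rewrite mem_cat.
      by rewrite map_f ?mem_enum.
    by rewrite [X in _ || X]map_f ?orbT// mem_iota /= sN.
  by rewrite init_sum lerBlDr lerDl mulr_ge0// exprn_ge0.
have ge0 : (0 <= \esum_(v in setT) (f v)%:E)%E.
  by apply: esum_ge0 => v _; rewrite lee_fin.
have fin : \esum_(v in setT) (f v)%:E \is a fin_num.
  by rewrite ge0_fin_numE// (le_lt_trans le_L)// ltry.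
apply: le_anti; rewrite le_L /= -(fineK fin) lee_fin.
have lim_q : (fun N => L - C * q ^+ N) @ \oo --> L - C * 0.
  apply: cvgB; first exact: cvg_cst.
  apply: cvgM; first exact: cvg_cst.
  by apply: cvg_expr; rewrite ger0_norm.
rewrite mulr0 subr0 in lim_q; apply: (cvgr_to_le lim_q); apply: nearW => N.
by rewrite -lee_fin fineK// -init_sum; exact: seq_le_esum.
Qed.

Lemma ray_sum b : 0 <= b ->
  \esum_(v in setT) (b * ray_vec v)%:E = (b * (3 + s3))%:E.
Proof.
move=> b0; have s2 := rt3_sq R; have /andP[sl su] := rt3_bounds R.
apply: (@esum_ray _ _ (b * ((3 - s3) / 2)) t).
- by move=> v; rewrite mulr_ge0// ltW// ray_vec_gt0.
- by rewrite (ltW ray_ratio_gt0) ray_ratio_lt1.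
- by rewrite mulr_ge0//; lra.
- move=> N; rewrite -[X in X + _]mulr_sumr -[X in _ + X]mulr_sumr -mulrDr -[_ * t ^+ N]mulrA -mulrBr; congr (_ * _).
  elim: N => [|N IHN].
    rewrite big_ord0 !big_ord_recl big_ord0 /= /ray_ratio expr0; lra.
  rewrite [X in _ + X]big_ord_recr addrA IHN /= !exprS -/(ray_ratio R).
  move: (t ^+ N) => T; rewrite /ray_ratio.
  by field: s2.
Qed.

Lemma ray_sum_sqr b :
  \esum_(v in setT) ((b * ray_vec v) ^+ 2)%:E = (b ^+ 2 * (6 * s3 - 6))%:E.
Proof.
have s2 := rt3_sq R; have /andP[sl su] := rt3_bounds R.
apply: (@esum_ray _ _ (b ^+ 2 * (21 * s3 / 2 - 18)) (t ^+ 2)).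
- by move=> v; exact: sqr_ge0.
- by rewrite sqr_ge0 /= expr_lt1// ?(ltW ray_ratio_gt0) ?ray_ratio_lt1.
- by rewrite mulr_ge0 ?sqr_ge0//; lra.
- move=> N; under eq_bigr do rewrite exprMn.
  under [X in _ + X]eq_bigr do rewrite exprMn.
  rewrite -[X in X + _]mulr_sumr -[X in _ + X]mulr_sumr -mulrDr -[_ * (t ^+ 2) ^+ N]mulrA -mulrBr; congr (_ * _).
  elim: N => [|N IHN].
    rewrite big_ord0 !big_ord_recl big_ord0 /= /ray_ratio expr0 !expr2; lra.
  rewrite [X in _ + X]big_ord_recr addrA IHN /=.
  rewrite [(t ^+ 2) ^+ N.+1]exprAC [(t ^+ 2) ^+ N]exprAC !(exprS t N.+1) !(exprS t N).
  move: (t ^+ N) => T; rewrite /ray_ratio.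
  by field: s2.
Qed.

Lemma ray_ell2 : ell2 ray_vec.
Proof.
apply/ell2E; have := ray_sum_sqr 1.
under eq_esum do rewrite mul1r.
by move=> ->; rewrite ltry.
Qed.

Lemma ray_ell1 : ell1 ray_vec.
Proof.
rewrite /ell1 /= /summable; have := ray_sum (@ler01 R).
rewrite (@eq_esum _ _ _ _ (fun v => `|(ray_vec v)%:E|)%E).
  by move=> ->; rewrite ltry.
by move=> v _; rewrite mul1r gee0_abs// lee_fin ltW// ray_vec_gt0.
Qed.

Lemma ray_adjop (x : V -> R) v : adjop K4_ray x v = \sum_(w <- ray_nbrs v) x w.
Proof. exact: adjopE ray_nbrs_uniq ray_nbrsE x v. Qed.

Lemma K4_ray_sym : symmetric K4_ray.
Proof. by case=> [i|j] [i'|j'] //=; [rewrite eq_sym | rewrite orbC]. Qed.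

Lemma ray_spectrum : greatest (spectrum (R:=R) K4_ray) mu.
Proof.
apply: (spectrum_top K4_ray_sym ray_nbrs_uniq ray_nbrsE ray_vec_gt0 ray_eig_gt0 ray_vec_eig).
  exact: ray_ell2.
by exists (inl ord0).
Qed.

Lemma ray_top : top_eigenvector K4_ray ray_vec.
Proof.
split; [exact: ray_vec_gt0 | exact: ray_ell1 |].
by exists mu; [exact: ray_spectrum | move=> v; rewrite ray_adjop ray_vec_eig].
Qed.

(** The equations on the triangle force equal entries there, and then the equations
    along the path determine one entry after the other. *)
Lemma ray_top_unique x : top_eigenvector K4_ray x ->
  exists2 b, 0 < b & x = (fun v => b * ray_vec v).
Proof.
move=> [x0 _ [lam [lam_spec lam_max] x_eig]].
have lam_mu : lam = mu.
  have [mu_spec mu_max] := ray_spectrum.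
  by apply: le_anti; rewrite mu_max// lam_max.
rewrite lam_mu in x_eig.
have {}x_eig v : \sum_(w <- ray_nbrs v) x w = mu * x v by rewrite -ray_adjop x_eig.
have mu0 := ray_eig_gt0; have et := ray_eq_tail; have eb := ray_eq_tri.
pose o (i : nat) : V := inl (inord i).
have inE4 (m : 'I_4) i : m = i :> nat -> inl m = o i by move=> mi; rewrite /o -mi inord_val.
have eq_i i : (i < 4)%N ->
    (if 0%N != i then x (o 0%N) else 0) + (if 1%N != i then x (o 1%N) else 0) +
    (if 2%N != i then x (o 2%N) else 0) + (if 3%N != i then x (o 3%N) else 0) +
    (if i == 0%N then x (inr 0%N) else 0) = mu * x (o i).
  move=> i4; rewrite -x_eig sum_ray_nbrs_inl big_mkcond !big_ord_recl big_ord0.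
  rewrite (inE4 (lift _ (lift _ (lift _ _))) 3%N)// (inE4 (lift _ (lift _ _)) 2%N)//.
  rewrite (inE4 (lift _ _) 1%N)// (inE4 ord0 0%N)//.
  by rewrite -!val_eqE /= !inordK// addr0 !addrA.
have e0 := eq_i 0%N isT; have e1 := eq_i 1%N isT; have e2 := eq_i 2%N isT.
have e3 := eq_i 3%N isT; rewrite /= in e0 e1 e2 e3.
have mu1 : 0 < mu + 1 by lra.
have x2 : x (o 2) = x (o 1).
  by apply: (mulfI (lt0r_neq0 mu1)); lra.
have x3 : x (o 3) = x (o 1).
  by apply: (mulfI (lt0r_neq0 mu1)); lra.
have xv : x (o 0) = 3 * t * x (o 1) by rewrite -eb in e1; lra.
exists (x (o 1)); first exact: x0.
apply/funext => -[i|j].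
  rewrite /=; have [->|i0] := eqVneq i ord0; first by rewrite (inE4 ord0 0%N)// xv mulrC.
  by rewrite mulr1; case: i i0 => [[|[|[|[|]]]]// i4] _; rewrite (inE4 _ _ erefl).
suff : x (inr j) = x (o 1) * (3 * t ^+ j.+2) /\ x (inr j.+1) = x (o 1) * (3 * t ^+ j.+3).
  by case.
have next j' : x (inr j'.+1) = mu * x (inr j') - x (if j' is j''.+1 then inr j'' else inl ord0).
  by have := x_eig (inr j'); rewrite /= big_cons big_seq1; lra.
have first_x : x (inr 0%N) = x (o 1) * (3 * t ^+ 2).
  rewrite expr2; move: e0; rewrite xv x2 x3.
  have -> : mu * (3 * t * x (o 1)) = (mu * t) * (3 * x (o 1)) by ring.
  by rewrite -et expr2; lra.
elim: j => [|j [IH1 IH2]].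
  split=> //; rewrite next first_x (inE4 ord0 0%N)// xv.
  have -> : mu * (x (o 1) * (3 * t ^+ 2)) = (mu * t) * (3 * t * x (o 1)) by ring.
  by rewrite -et; ring.
split=> //; rewrite next IH2 IH1.
have -> : mu * (x (o 1) * (3 * t ^+ j.+3)) = (mu * t) * (3 * t ^+ j.+2 * x (o 1)).
  by rewrite [t ^+ j.+3]exprS; ring.
by rewrite -et !exprS; ring.
Qed.

Lemma effective_order_ray : effective_order_inf K4_ray = ray_order R.
Proof.
rewrite /effective_order_inf; case: xgetP => [x _ /ray_top_unique[b b0 ->]|/(_ _ ray_top)//].
have b0' := ltW b0; have s2 := rt3_sq R; have /andP[sl su] := rt3_bounds R.
have -> : norm1 (fun v => b * ray_vec v) = b * (3 + s3).
  rewrite /norm1 (@eq_esum _ _ _ _ (fun v => (b * ray_vec v)%:E)) ?ray_sum//.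
  by move=> v _; rewrite ger0_norm// mulr_ge0// ltW// ray_vec_gt0.
have -> : norm2 (fun v => b * ray_vec v) ^+ 2 = b ^+ 2 * (6 * s3 - 6).
  rewrite /norm2 ray_sum_sqr /= sqr_sqrtr// mulr_ge0 ?sqr_ge0//; lra.
rewrite exprMn -mulf_div divff ?mul1r ?expf_neq0 ?gt_eqF// /ray_order.
apply: (mulIf (_ : 6 * s3 - 6 != 0)); first by rewrite gt_eqF//; lra.
rewrite divfK; last by rewrite gt_eqF//; lra.
by field: s2.
Qed.

End Ray.

(** * Comparison of effective orders *)

Lemma effective_order_iso (R : realType) (T1 T2 : finType) (e1 : rel T1) (e2 : rel T2) :
  symmetric e1 -> (forall u w, connect e1 u w) ->
  symmetric e2 -> (forall u w, connect e2 u w) -> (0 < #|T1|)%N ->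
  graph_iso e1 e2 -> effective_order e1 = effective_order e2 :> R.
Proof.
move=> sym1 conn1 sym2 conn2 T1_gt0 [f f_bij fE].
have T2_gt0 : (0 < #|T2|)%N by rewrite -(bij_eq_card f_bij).
have [x [lam [x0 xe]]] := perron_exists R sym2 conn2 T2_gt0.
have xfe : eigenfun e1 (x \o f) lam.
  move=> v; rewrite /= -xe [RHS](reindex f)/=; last exact: onW_bij.
  by apply: eq_bigl => w; rewrite fE.
rewrite (effective_orderE sym2 conn2 T2_gt0 x0 xe).
rewrite (effective_orderE sym1 conn1 T1_gt0 (fun v => x0 (f v)) xfe).
by congr (_ ^+ 2 / _); rewrite [RHS](reindex f)//; exact: onW_bij.
Qed.

Section LowerBounds.
Variables (R : realType) (T : finType) (e : rel T).
Hypotheses (e_sym : symmetric e) (e_irr : irreflexive e).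
Hypothesis e_conn : forall u w, connect e u w.
Local Notation Gamma := (effective_order e : R).

Lemma normalized_perron : (0 < #|T|)%N ->
  exists x : T -> R, exists lam v, [/\ forall u, 0 < x u, forall u, x u <= 1, x v = 1,
    eigenfun e x lam & Gamma = (\sum_u x u) ^+ 2 / \sum_u x u ^+ 2].
Proof.
move=> T0; have [x [lam [x0 xe]]] := perron_exists R e_sym e_conn T0.
have [v0 _] : exists v0 : T, v0 \in T by apply/card_gt0P.
have [v _ v_max] := @Order.TotalTheory.arg_maxP _ _ _ v0 xpredT x isT.
have xv := x0 v; pose z u := x u / x v.
have z0 u : 0 < z u by rewrite divr_gt0.
have ze : eigenfun e z lam by move=> u; rewrite -mulr_suml xe mulrA.
exists z, lam, v; split=> //.
- by move=> u; rewrite ler_pdivrMr// mul1r; exact: v_max.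
- by rewrite /z divff// gt_eqF.
- exact: effective_orderE z0 ze.
Qed.

Lemma hinge_case (x : T -> R) lam v : (forall u, 0 < x u) -> eigenfun e x lam ->
  (forall u, x u <= x v) -> lam <= 16 / 5 ->
  (exists a b c y, K4_hinge e v a b c y) ->
  graph_iso e (K4_path (#|T| - 4)) \/
  ray_order R * \sum_u x u ^+ 2 <= (\sum_u x u) ^+ 2.
Proof.
move=> x0 xe x_max lam_le [a [b [c [y hinge]]]].
have [[s [s_uniq sE s_path]]|] := hinge_dichotomy e_sym e_irr e_conn x0 xe hinge lam_le x_max.
  by left; exact: hinge_iso hinge s_uniq sE s_path.
by right.
Qed.

Lemma ge_quotient (c : R) (x : T -> R) (v : T) : (forall u, 0 < x u) ->
  c * \sum_u x u ^+ 2 <= (\sum_u x u) ^+ 2 ->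
  c <= (\sum_u x u) ^+ 2 / \sum_u x u ^+ 2.
Proof.
move=> x0 le_c; rewrite ler_pdivlMr// (bigD1 v)//= ltr_pwDl ?exprn_gt0//.
by apply: sumr_ge0 => u _; exact: sqr_ge0.
Qed.

Lemma ray_order_le : ray_order R <= 51 / 10.
Proof. by have /andP[sl su] := rt3_bounds R; rewrite /ray_order; lra. Qed.

Lemma lower_bound7 : (7 <= #|T|)%N ->
  graph_iso e (K4_path (#|T| - 4)) \/ ray_order R <= Gamma.
Proof.
move=> T7; have T0 : (0 < #|T|)%N by exact: leq_trans T7.
have [x [lam [v [x0 x1 xv xe ->]]]] := normalized_perron T0.
have strong : 510 * \sum_u x u ^+ 2 <= 100 * (\sum_u x u) ^+ 2 ->
    ray_order R <= (\sum_u x u) ^+ 2 / \sum_u x u ^+ 2.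
  move=> h; apply: le_trans ray_order_le _; apply: (ge_quotient v) => //; lra.
have [d5|d6] := leqP #|[pred w | e v w]| 5; last first.
  right; apply: strong.
  exact: (large_star_bound e_sym e_irr x0 x1 xe xv d6).
have T1 : (1 < #|T|)%N by exact: leq_trans T7.
have cn0 : (0 <= 510)%BZ by [].
have exact7 : false -> #|T| = 7%N by [].
have [h|[lam_le hinge]] := search_bound e_sym e_irr e_conn x0 x1 xe xv T7 exact7 T1 cn0
  plan7_ok d5.
  by right; apply: strong; move: h; rewrite (_ : zr R 510%BZ = 510).
have x_max u : x u <= x v by rewrite xv.
have [iso|ge] := hinge_case x0 xe x_max lam_le hinge; first by left.
by right; exact: (ge_quotient v).
Qed.

Lemma lower_bound6 : #|T| = 6%N ->
  graph_iso e (K4_path (#|T| - 4)) \/ 488 / 100 <= Gamma.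
Proof.
move=> T6; have T0 : (0 < #|T|)%N by rewrite T6.
have [x [lam [v [x0 x1 xv xe ->]]]] := normalized_perron T0.
have d5 : (#|[pred w | e v w]| <= 5)%N.
  rewrite -ltnS -[X in (_ < X)%N]T6; apply: proper_card; apply/properP; split.
    by apply/fintype.subsetP.
  by exists v => //; rewrite inE e_irr.
have T1 : (1 < #|T|)%N by rewrite T6.
have cn0 : (0 <= 488)%BZ by [].
have [h|[lam_le hinge]] := search_bound e_sym e_irr e_conn x0 x1 xe xv
  (eq_leq (esym T6)) (fun _ => T6) T1 cn0 plan6_ok d5.
  right; apply: (ge_quotient v) => //.
  by move: h; rewrite (_ : zr R 488%BZ = 488)//; lra.
have x_max u : x u <= x v by rewrite xv.
have [iso|ge] := hinge_case x0 xe x_max lam_le hinge; first by left.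
right; apply: le_trans (ge_quotient v x0 ge).
by have /andP[sl su] := rt3_bounds R; rewrite /ray_order; lra.
Qed.

End LowerBounds.

Theorem theorem1p3 (R : realType) :
  [/\ effective_order_inf K4_ray = (5 + 3 * Num.sqrt 3) / 2 :> R,
      (forall (n : nat) (T : finType) (e : rel T),
         (7 <= n)%N -> connected_graph n e ->
         ((effective_order e < effective_order_inf K4_ray :> R) <->
          graph_iso e (K4_path (n - 4))))
    & (forall n : nat, (6 <= n)%N ->
         connected_graph n (K4_path (n - 4)) /\
         (forall (T : finType) (e : rel T), connected_graph n e ->
            effective_order (K4_path (n - 4)) <= effective_order e :> R))].
Proof.
have K4_conn n : (4 <= n)%N -> connected_graph n (K4_path (n - 4)).
  by move=> n4; have := K4_path_connected (n - 4); rewrite subnK.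
have iso_eq n (T : finType) (e : rel T) : (4 < n)%N -> connected_graph n e ->
    graph_iso e (K4_path (n - 4)) ->
    effective_order e = effective_order (K4_path (n - 4)) :> R.
  move=> n4 [cardT e_sym _ e_conn] iso.
  have [_ K_sym _ K_conn] := K4_conn n (ltnW n4).
  by apply: effective_order_iso iso => //; rewrite cardT (leq_trans _ n4).
split; first exact: effective_order_ray.
- move=> n T e n7 conn; rewrite effective_order_ray.
  have [cardT e_sym e_irr e_conn] := conn; split.
    rewrite ltNge => /negP lt_ray.
    have := lower_bound7 R e_sym e_irr e_conn; rewrite cardT => /(_ n7)[//|/lt_ray[]].
  move=> iso; rewrite (iso_eq n)//; last exact: leq_trans n7.
  by apply: K4_path_order_lt; rewrite subn_gt0 (leq_trans _ n7).
- move=> n n6; split; first by apply: K4_conn; exact: leq_trans n6.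
  move=> T e conn; have [cardT e_sym e_irr e_conn] := conn.
  have [n_eq6|n_neq6] := eqVneq n 6%N.
    have := lower_bound6 R e_sym e_irr e_conn; rewrite cardT => /(_ n_eq6)[iso|].
      by rewrite (iso_eq n)// n_eq6.
    by apply: le_trans; rewrite n_eq6; exact: K4_path2_order.
  have n7 : (7 <= n)%N by rewrite ltn_neqAle eq_sym n_neq6.
  have := lower_bound7 R e_sym e_irr e_conn; rewrite cardT => /(_ n7)[iso|].
    by rewrite (iso_eq n)// (leq_trans _ n7).
  by apply: le_trans; apply/ltW/K4_path_order_lt; rewrite subn_gt0 (leq_trans _ n7).
Qed.
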